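(* Let $\delta>0$ and let $(u_{\bm k}),(v_{\bm k})\in l^2(\mathbb{Z}^d)$ be real sequences with Fourier series $\widetilde u,\widetilde v$ on $\bm Q=(-\pi,\pi)^d$. Then (i) $\displaystyle (i^h(u_{\bm k}),-\mathcal{L}_\delta i^h(v_{\bm k}))=(2\pi)^{-d}\int_{\bm Q}\widetilde u(\xi)\overline{\widetilde v(\xi)}\,\lambda_G(\delta,\bm h,\xi)\,d\xi$; (ii) $\displaystyle ((u_{\bm k}),-r^h\mathcal{L}_\delta i^h(v_{\bm k}))_{l^2}=(2\pi)^{-d}\int_{\bm Q}\widetilde u(\xi)\overline{\widetilde v(\xi)}\,\lambda_C(\delta,\bm h,\xi)\,d\xi$; (iii) $\lambda_C(\delta,\bm h,\xi)\ge C\,\lambda_G(\delta,\bm h,\xi)$ for $\xi\in\bm Q$, with a constant $C>0$ independent of $\delta$, $\bm h$ and $\xi$; where $$\lambda_G(\delta,\bm h,\xi)=2^{8d}\sum_{\bm r\in\mathbb{Z}^d}\lambda_\delta\big((\xi+2\pi\bm r)\oslash\bm h\big)\prod_{j=1}^d h_j\left(\frac{\sin(\xi_j/2)}{\xi_j+2\pi r_j}\right)^8,$$ $$\lambda_C(\delta,\bm h,\xi)=2^{4d}\sum_{\bm r\in\mathbb{Z}^d}\lambda_\delta\big((\xi+2\pi\bm r)\oslash\bm h\big)\prod_{j=1}^d h_j\left(\frac{\sin(\xi_j/2)}{\xi_j+2\pi r_j}\right)^4,$$ and $\lambda_\delta(\xi)=\int_{B_\delta(0)}\rho_\delta(|s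|)(1-\cos(s\cdot\xi))\,ds$.
   Context: Nonlocal operator. Let $d\ge1$ be an integer and let $\rho:(0,\infty)\to[0,\infty)$ be nonincreasing with $\rho(r)=0$ for $r>1$ and $\int_{B_1(0)}\rho(|s|)|s|^2\,ds=2d$. For $\delta>0$ put $\rho_\delta(r)=\delta^{-(d+2)}\rho(r/\delta)$ and $$\mathcal{L}_\delta u(x)=\int_{B_\delta(0)}\rho_\delta(|s|)\,(u(x+s)-u(x))\,ds .$$ When this integral is not absolutely convergent it is understood symmetrically, i.e. as $\tfrac12\int_{B_\delta(0)}\rho_\delta(|s|)(u(x+s)+u(x-s)-2u(x))\,ds$. Grid. Fix $\hat{\bm h}=(\hat h_1,\dots,\hat h_d)$ with positive entries and $\max_j\hat h_j=1$. For $h_{\max}>0$ let $\bm h=(h_1,\dots,h_d)=h_{\max}\hat{\bm h}$, $x_{\bm k}=(k_1h_1,\dots,k_dh_d)$ for $\bm k\in\mathbb{Z}^d$, and $\square=\{x_{\bm k}:\bm k\in\mathbb{Z}^d\}$. The symbol $\oslash$ denotes component-wise division of vectors. Linear reproducing kernel (RK) basis with support $2\bm h$: $\Psi_{\bm k}(x)=\prod_{j=1}^d\phi\!\left(\frac{|x_j-k_jh_j|}{2h_j}\right)$, where $\phi(t)=\frac23-4t^2+4t^3$ for $0\le t\le\frac12$, $\phi(t)=\frac43(1-t)^3$ for $\frac12\le t\le1$, and $\phi(t)=0$ for $t>1$. Put $i^h(u_{\bm k})=\sum_{\bm k\in\mathbb{Z}^d}u_{\bm k}\Psi_{\bm k}$,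 and $r^hw=(w(x_{\bm k}))_{\bm k\in\mathbb{Z}^d}$ for a function $w$. $(\cdot,\cdot)$ is the $L^2(\mathbb{R}^d)$ inner product, and $((u_{\bm k}),(v_{\bm k}))_{l^2}=\prod_{j=1}^dh_j\sum_{\bm k\in\mathbb{Z}^d}u_{\bm k}v_{\bm k}$. The Fourier series of a sequence is $\widetilde u(\xi)=\sum_{\bm k\in\mathbb{Z}^d}e^{-i\bm k\cdot\xi}u_{\bm k}$ on $\bm Q$. The quotient $\sin(\xi_j/2)/(\xi_j+2\pi r_j)$ is read by continuity (value $\pm\frac12$) where the denominator vanishes. *)

(* Defs.v *)
From HB Require Import structures.
From mathcomp Require Import all_boot all_order all_algebra finmap.
From mathcomp Require Import all_classical all_reals all_analysis.
From mathcomp Require Import complex.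

Set Implicit Arguments.
Unset Strict Implicit.
Unset Printing Implicit Defensive.

Import Order.TTheory GRing.Theory Num.Theory.
Import numFieldNormedType.Exports.

Local Open Scope classical_set_scope.
Local Open Scope ring_scope.

(* The sigma-algebra generated by the coordinates: the library has no
   measurable structure on 'rV[T]_n.  For T = R it is the Borel
   sigma-algebra of R^n. *)
Definition rV_display : measure_display -> measure_display.
Proof. exact. Qed.

Section measurable_rV.
Context {d} {T : measurableType d}.
Variable n : nat.

Definition rV_coord (i : 'I_n) (x : 'rV[T]_n) : T := x ord0 i.

Let rV_set0 : g_sigma_preimage rV_coord set0.
Proof. exact: sigma_algebra0. Qed.

Let rV_setC A : g_sigma_preimage rV_coord A ->
  g_sigma_preimage rV_coord (~` A).
Proof. exact: sigma_algebraC. Qed.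

Let rV_bigcup (F : (set 'rV[T]_n)^nat) :
  (forall i, g_sigma_preimage rV_coord (F i)) ->
  g_sigma_preimage rV_coord (\bigcup_i (F i)).
Proof. exact: sigma_algebra_bigcup. Qed.

HB.instance Definition _ := Pointed.on 'rV[T]_n.
HB.instance Definition _ := @isMeasurable.Build (rV_display d)
  'rV[T]_n (g_sigma_preimage rV_coord) rV_set0 rV_setC rV_bigcup.

Lemma measurable_rV_coord (i : 'I_n) :
  measurable_fun [set: 'rV[T]_n] (rV_coord i).
Proof.
move=> _ Y mY; rewrite setTI; apply: sub_sigma_algebra => /=.
rewrite -bigcup_seq/=; exists i => /=; first by rewrite mem_index_enum.
by exists Y => //; rewrite setTI.
Qed.

Lemma measurable_fun_rV d1 (T1 : measurableType d1) (f : T1 -> 'rV[T]_n) :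
  (forall i, measurable_fun [set: T1] (fun x => f x ord0 i)) ->
  measurable_fun [set: T1] f.
Proof.
move=> mf; apply: (measurability
  (\big[setU/set0]_(i < n) preimage_set_system setT (rV_coord i) measurable)).
  by [].
move=> _ [C + <-]; rewrite -bigcup_seq/= => -[i _ [Y mY <-]].
by have := mf i measurableT _ mY; rewrite !setTI.
Qed.

End measurable_rV.

Section lebesgue_rV.
Variable R : realType.

Definition rV_cons n (p : R * 'rV[R]_n) : 'rV[R]_n.+1 :=
  row_mx (p.1)%:M p.2 : 'rV[R]_(1 + n).

Definition rV_uncons n (v : 'rV[R]_n.+1) : R * 'rV[R]_n :=
  (v ord0 ord0, rsubmx (v : 'rV[R]_(1 + n))).

Lemma rV_consK n : cancel (@rV_cons n) (@rV_uncons n).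
Proof.
case=> a v; rewrite /rV_cons /rV_uncons /= row_mxKr; congr pair.
by rewrite mxE; case: splitP => // j _; rewrite mxE (ord1 j) eqxx mulr1n.
Qed.

Lemma rV_cons0 n p : @rV_cons n p ord0 ord0 = p.1.
Proof. by have := rV_consK p; case: p => a v [/= ->]. Qed.

Lemma rV_consS n p i : @rV_cons n p ord0 (lift ord0 i) = p.2 ord0 i.
Proof.
rewrite mxE; case: splitP => j /=; rewrite /bump leq0n add1n.
  by rewrite (ord1 j).
by case=> ij; congr (p.2 _ _); exact/val_inj.
Qed.

Lemma measurable_rV_cons n : measurable_fun setT (@rV_cons n).
Proof.
apply: measurable_fun_rV => i; case: (unliftP ord0 i) => [j|] ->.
  under eq_fun do rewrite rV_consS.
  apply: (measurableT_comp (measurable_rV_coord j)); exact: measurable_snd.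
under eq_fun do rewrite rV_cons0.
exact: measurable_fst.
Qed.

Lemma measurable_rV_uncons n : measurable_fun setT (@rV_uncons n).
Proof.
apply/measurable_fun_pairP; split; first exact: measurable_rV_coord.
apply: measurable_fun_rV => i /=; rewrite /comp /=.
under eq_fun do rewrite mxE.
exact: measurable_rV_coord.
Qed.

Section leb_step.
Variables (n : nat) (mu : {sigma_finite_measure set 'rV[R]_n -> \bar R}).
Local Open Scope ereal_scope.

Definition leb_step : set 'rV[R]_n.+1 -> \bar R :=
  pushforward (@lebesgue_measure R \x mu) (@rV_cons n).

Let mcons A : measurable A -> measurable (@rV_cons n @^-1` A).
Proof.
by move=> mA; rewrite -[X in measurable X]setTI; exact: measurable_rV_cons.
Qed.

Let leb_step0 : leb_step set0 = 0.
Proof. by rewrite /leb_step /pushforward preimage_set0 measure0. Qed.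

Let leb_step_ge0 A : 0 <= leb_step A.
Proof. by rewrite /leb_step /pushforward; exact: measure_ge0. Qed.

Let leb_step_sigma_additive : semi_sigma_additive leb_step.
Proof.
move=> F mF tF mUF; rewrite /leb_step /pushforward preimage_bigcup.
apply: measure_semi_sigma_additive.
- by move=> k; exact: mcons.
- apply/trivIsetP => /= i j _ _ ij; rewrite -preimage_setI.
  by move/trivIsetP : tF => /(_ _ _ _ _ ij) ->//; rewrite preimage_set0.
- by rewrite -preimage_bigcup; exact: mcons.
Qed.

HB.instance Definition _ := isMeasure.Build _ _ _ leb_step
  leb_step0 leb_step_ge0 leb_step_sigma_additive.

Let leb_step_sigma_finite : sigma_finite setT leb_step.
Proof.
have /sigma_finiteP[F [FT ndF Foo]] := sigma_finiteT (@lebesgue_measure R).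
have /sigma_finiteP[G [GT ndG Goo]] := sigma_finiteT mu.
exists (fun k => @rV_uncons n @^-1` (F k `*` G k)).
  rewrite -preimage_bigcup -[LHS](preimage_setT (@rV_uncons n)).
  congr (_ @^-1` _); rewrite -setXTT FT GT predeqE => -[x y]; split.
    move=> [/= [i _ Fix] [k _ Gky]]; exists (maxn i k) => //; split.
    - by move: x Fix; exact/subsetPset/ndF/leq_maxl.
    - by move: y Gky; exact/subsetPset/ndG/leq_maxr.
  by move=> [i _ []/= ? ?]; split; exists i.
move=> k; have [mF Fk] := Foo k; have [mG Gk] := Goo k; split.
  rewrite -[X in measurable X]setTI; apply: measurable_rV_uncons => //.
  exact: measurableX.
rewrite /leb_step /pushforward -comp_preimage.
rewrite (_ : _ \o _ = id); last by apply/funext => x; exact: rV_consK.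
by rewrite preimage_id product_measure1E// lte_mul_pinfty// ge0_fin_numE.
Qed.

HB.instance Definition _ := Measure_isSigmaFinite.Build _ _ _ leb_step
  leb_step_sigma_finite.

End leb_step.

(* Lebesgue measure on R^n: R^0 is a point of mass 1, and the measure on
   R^n.+1 is the product of the measures on R and R^n. *)
Fixpoint leb (n : nat) : {sigma_finite_measure set 'rV[R]_n -> \bar R} :=
  if n is m.+1 then leb_step (leb m) else dirac (0 : 'rV[R]_0).

Definition rV_box n (a b : 'rV[R]_n) : set 'rV[R]_n :=
  [set x : 'rV[R]_n | forall i, a ord0 i <= x ord0 i <= b ord0 i].

Lemma measurable_rV_box n (a b : 'rV[R]_n) : measurable (rV_box a b).
Proof.
have -> : rV_box a b =
    \bigcap_(i in [set: 'I_n]) (rV_coord i @^-1` `[a ord0 i, b ord0 i]).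
  apply/seteqP; split => x /= h i; first by move=> _; rewrite /= in_itv /= h.
  by have := h i I; rewrite /= in_itv.
apply: fin_bigcap_measurable; first exact: finite_finset.
move=> i _; rewrite -[X in measurable X]setTI.
exact: (measurable_rV_coord i).
Qed.

Lemma leb_box n (a b : 'rV[R]_n) : (forall i, a ord0 i <= b ord0 i) ->
  leb n (rV_box a b) = (\prod_(i < n) (b ord0 i - a ord0 i))%:E.
Proof.
elim: n a b => [|n IH] a b ab.
  by rewrite big_ord0 /= diracE mem_set// => -[].
pose a' : 'rV[R]_n := rsubmx (a : 'rV[R]_(1 + n)).
pose b' : 'rV[R]_n := rsubmx (b : 'rV[R]_(1 + n)).
have aE i : a' ord0 i = a ord0 (lift ord0 i).
  by rewrite mxE; congr (a _ _); exact/val_inj.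
have bE i : b' ord0 i = b ord0 (lift ord0 i).
  by rewrite mxE; congr (b _ _); exact/val_inj.
have consE : @rV_cons n @^-1` rV_box a b =
    `[a ord0 ord0, b ord0 ord0] `*` rV_box a' b'.
  apply/seteqP; split => -[t x] /=.
    move=> h; split.
      by have := h ord0; rewrite rV_cons0 in_itv.
    by move=> i; have := h (lift ord0 i); rewrite rV_consS aE bE.
  move=> [h0 h] i; case: (unliftP ord0 i) => [j|] ->.
    by have := h j; rewrite rV_consS aE bE.
  by move: h0; rewrite rV_cons0 /= in_itv.
transitivity ((@lebesgue_measure R \x leb n)%E
    (`[a ord0 ord0, b ord0 ord0] `*` rV_box a' b')).
  by rewrite -consE.
rewrite product_measure1E//; last exact: measurable_rV_box.
rewrite IH; last by move=> i; rewrite aE bE.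
rewrite big_ord_recl EFinM; under eq_bigr do rewrite aE bE.
congr (_ * _)%E; apply: etrans (lebesgue_measure_itv _) _.
rewrite /= lte_fin; case: ltP => h; first by rewrite -EFinD.
by have /eqP -> : b ord0 ord0 == a ord0 ord0; rewrite ?subrr // eq_le h ab.
Qed.
End lebesgue_rV.

Section definitions.
Variables (R : realType) (d : nat).
Implicit Types (x s xi h : 'rV[R]_d) (k : 'rV[int]_d).

Definition dot x s : R := \sum_(j < d) x ord0 j * s ord0 j.

(* Euclidean norm; the library's `|x| on 'rV[R]_d is the sup norm. *)
Definition enorm x : R := Num.sqrt (dot x x).

Definition eball (r : R) : set 'rV[R]_d := [set s | enorm s < r].

Definition cube : set 'rV[R]_d := [set xi | forall j, - pi < xi ord0 j < pi].

(* Only the values of rho on ]0, +oo[ are constrained. *)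
Definition kernel_profile (rho : R -> R) : Prop :=
  [/\ forall r, 0 < r -> 0 <= rho r,
      forall r1 r2, 0 < r1 -> r1 <= r2 -> rho r2 <= rho r1,
      forall r, 1 < r -> rho r = 0 &
      (\int[leb R d]_(s in eball 1) (rho (enorm s) * enorm s ^+ 2)%:E
         = (2 * d%:R)%:E)%E].

Definition rescale (rho : R -> R) (delta : R) : R -> R :=
  fun r => delta ^- (d + 2) * rho (r / delta).

(* The literal integral if it converges absolutely, and its symmetrization
   otherwise. *)
Definition nonlocal (rho : R -> R) (delta : R) (u : 'rV[R]_d -> R) x : R :=
  let rhod s := rescale rho delta (enorm s) in
  let B := eball delta in
  if `[< (leb R d).-integrable B
           (EFin \o fun s => rhod s * (u (x + s) - u x)) >]
  then \int[leb R d]_(s in B) (rhod s * (u (x + s) - u x))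
  else 2^-1 * \int[leb R d]_(s in B)
                (rhod s * (u (x + s) + u (x - s) - 2 * u x)).

Definition admissible_shape (hhat : 'rV[R]_d) : Prop :=
  (forall j, 0 < hhat ord0 j) /\ \big[Num.max/0]_(j < d) hhat ord0 j = 1.

Definition gridpoint h k : 'rV[R]_d := \row_j ((k ord0 j)%:~R * h ord0 j).

(* Only used for t >= 0. *)
Definition spline (t : R) : R :=
  if t <= 2^-1 then 2 / 3 - 4 * t ^+ 2 + 4 * t ^+ 3
  else if t <= 1 then 4 / 3 * (1 - t) ^+ 3 else 0.

Definition rk_basis h k x : R :=
  \prod_(j < d)
    spline (`|x ord0 j - (k ord0 j)%:~R * h ord0 j| / (2 * h ord0 j)).

(* For positive h, only finitely many terms are nonzero at a given x. *)
Definition interp h (u : 'rV[int]_d -> R) x : R :=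
  \sum_(k \in [set: 'rV[int]_d]) u k * rk_basis h k x.

Definition restr h (w : 'rV[R]_d -> R) k : R := w (gridpoint h k).

Definition zsummable (f : 'rV[int]_d -> R) : Prop := summable setT (EFin \o f).

(* The sum of an absolutely summable family, as the difference of the sums of
   its positive and negative parts. *)
Definition zsum (f : 'rV[int]_d -> R) : R :=
  fine (\esum_(k in setT) ((EFin \o f)^\+)%E k)
  - fine (\esum_(k in setT) ((EFin \o f)^\-)%E k).

Definition square_summable (u : 'rV[int]_d -> R) : Prop :=
  zsummable (fun k => u k ^+ 2).

Definition inner_l2 h (u v : 'rV[int]_d -> R) : R :=
  (\prod_(j < d) h ord0 j) * zsum (fun k => u k * v k).

Definition inner_L2 (f g : 'rV[R]_d -> R) : R := \int[leb R d]_x (f x * g x).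

Definition expi (t : R) : R[i] := (cos t +i* sin t)%C.

Definition fourier_sum (u : 'rV[int]_d -> R) (A : {fset 'rV[int]_d}) xi :
    R[i] :=
  \sum_(k <- A) expi (- dot (map_mx intr k) xi) * (u k)%:C%C.

(* For square summable u the Fourier series converges unconditionally in
   L^2(cube), in general not pointwise; f is any representative of its sum. *)
Definition is_fourier_series (u : 'rV[int]_d -> R) (f : 'rV[R]_d -> R[i]) :
    Prop :=
  [/\ measurable_fun cube (fun xi => complex.Re (f xi)),
      measurable_fun cube (fun xi => complex.Im (f xi)) &
      forall eps : R, 0 < eps -> exists A : {fset 'rV[int]_d},
        forall B : {fset 'rV[int]_d}, (A `<=` B)%fset ->
        (\int[leb R d]_(xi in cube)
           (complex.Re (f xi - fourier_sum u B xi) ^+ 2 +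
            complex.Im (f xi - fourier_sum u B xi) ^+ 2)%:E < eps%:E)%E].

Definition cintegrable (D : set 'rV[R]_d) (f : 'rV[R]_d -> R[i]) : Prop :=
  (leb R d).-integrable D (EFin \o fun x => complex.Re (f x)) /\
  (leb R d).-integrable D (EFin \o fun x => complex.Im (f x)).

Definition cintegral (D : set 'rV[R]_d) (f : 'rV[R]_d -> R[i]) : R[i] :=
  (\int[leb R d]_(x in D) complex.Re (f x) +i*
   \int[leb R d]_(x in D) complex.Im (f x))%C.

Definition symbol (rho : R -> R) (delta : R) xi : R :=
  \int[leb R d]_(s in eball delta)
    (rescale rho delta (enorm s) * (1 - cos (dot s xi))).

(* sin (t / 2) / (t + 2 * pi * m); at t = - 2 * pi * m its limit is
   cos (t / 2) / 2 = +- 1 / 2. *)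
Definition sin_quot (t : R) (m : int) : R :=
  let q := t + 2 * pi * m%:~R in
  if q == 0 then cos (t / 2) / 2 else sin (t / 2) / q.

Definition shifted_freq h xi (r : 'rV[int]_d) : 'rV[R]_d :=
  \row_j ((xi ord0 j + 2 * pi * (r ord0 j)%:~R) / h ord0 j).

Definition lambda_term (p : nat) (rho : R -> R) (delta : R) h xi
    (r : 'rV[int]_d) : R :=
  symbol rho delta (shifted_freq h xi r) *
  \prod_(j < d) (h ord0 j * sin_quot (xi ord0 j) (r ord0 j) ^+ p).

Definition lambda_G (rho : R -> R) (delta : R) h xi : R :=
  2 ^+ (8 * d) * zsum (lambda_term 8 rho delta h xi).

Definition lambda_C (rho : R -> R) (delta : R) h xi : R :=
  2 ^+ (4 * d) * zsum (lambda_term 4 rho delta h xi).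

End definitions.

(* Main.v *)
(* The basis function [Psi_k] is the product over [j] of [B (x_j / h_j - k_j)], where
   [B] is the cubic B-spline, whose Fourier transform is [(2 sin (w / 2) / w)^4].
   Put [w_r = (xi + 2 pi r) / h] and let [b_r] be the product over [j] of
   [(2 sin (xi_j / 2) / (xi_j + 2 pi r_j))^4]. By Poisson summation in each
   coordinate, [sum_r b_r cos (x . w_r)] is the interpolated plane wave
   [Phi = sum_k cos (k . xi) Psi_k]. The operator [-L] multiplies the [r]-th term by
   [lambda_delta (w_r)]; evaluating at [0], resp. pairing with [Psi_0], gives
   [lambda_C = (prod_j h_j) (- L Phi) (0)] and [lambda_G = (Psi_0, - L Phi)].
   As [Phi] is a locally finite sum, both are cosine polynomials in [xi], with
   coefficients [(prod_j h_j) (- L Psi_m) (0)] and [(Psi_0, - L Psi_m)]. By translation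
   invariance both bilinear forms are convolutions with these coefficients, so (i)
   and (ii) are Parseval's identity for multipliers. Finally [C = 1] works in (iii),
   since [lambda_delta >= 0] and [0 <= b_r <= 1]. *)

Require Import Defs.
From mathcomp Require Import all_boot all_order all_algebra finmap.
From mathcomp Require Import all_classical all_reals all_analysis measurable_realfun.
From mathcomp Require Import complex.
From mathcomp Require Import ring lra zify.

Import Order.TTheory GRing.Theory Num.Theory.
Import numFieldNormedType.Exports.

Local Open Scope classical_set_scope.
Local Open Scope ring_scope.
Set Implicit Arguments.
Unset Strict Implicit.
Unset Printing Implicit Defensive.

(** * Lebesgue measure on R^n *)

(** The kernel may be singular at the origin and has only a finite second moment, so every use of
    the operator rests on second differences: those of [B] are of order [s^2], and
    [1 - cos t <= t^2 / 2] gives [lambda_delta (w) <= C |w|^2]. This growth is beaten by [b_r],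
    which decays like the product of the [(xi_j + 2 pi r_j)^-4]. Hence dominated convergence carries
    [-L] through the sum over [r], although Poisson summation itself is only proved as a pointwise
    limit along growing boxes. The Fourier series of [u] and [v] exist only as L^2 limits. Since the
    multipliers are cosine polynomials, multiplying by them is a finite combination of modulations,
    that is, of index shifts; Parseval for two square summable sequences then suffices. *)

Lemma lebesgue_affine (R : realType) (a c : R) (A : set R) : a != 0 ->
  measurable A ->
  @lebesgue_measure R A =
   (`|a|%:E * @lebesgue_measure R ((fun x : R => a * x + c)%R @^-1` A))%E.
Proof.
move=> a0 mA.
pose phi : measurableTypeR R -> measurableTypeR R := fun x => a * x + c.
have mphi : measurable_fun setT phi.
  by apply: measurable_funD => //; exact: measurable_funM.
(* The right-hand side is a measure in [A], so half-open intervals decide. For negative [a] the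
   preimage is closed at the other end, which does not change its length. *)
apply: (@lebesgue_measure_unique R (mscale (`|a|%:nng) (pushforward (@lebesgue_measure R) phi))) => //.
move=> _ [[u v]] _ <- /=.
rewrite /mscale /pushforward /=.
have [uv|uv] := ltP u v; last first.
  rewrite set_itv_ge ?bnd_simp -?leNgt//. rewrite /pushforward preimage_set0 !measure0.
  by rewrite mule0.
have [ap|an|] := ltgtP 0 a; last by move=> e; move: a0; rewrite -e eqxx.
- rewrite /pushforward; have -> : phi @^-1` `]u, v]%classic = `](u - c) / a, (v - c) / a]%classic.
    apply/seteqP; split=> x /=; rewrite /phi !in_itv/= ltr_pdivrMr// ler_pdivlMr// ltrBlDr lerBrDr (mulrC x) //.
  rewrite !lebesgue_measure_itv/= !lte_fin ltr_pM2r ?invr_gt0// ltrD2r uv.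
  rewrite -EFinM gtr0_norm//; congr (_%:E); by field.
- rewrite /pushforward; have -> : phi @^-1` `]u, v]%classic = `[(v - c) / a, (u - c) / a[%classic.
    apply/seteqP; split=> x /=; rewrite /phi !in_itv/= ltr_ndivlMr// ler_ndivrMr// ltrBlDr lerBrDr (mulrC x) andbC //.
  rewrite !lebesgue_measure_itv/= !lte_fin ltr_nM2r ?invr_lt0// ltrD2r uv.
  rewrite -EFinM ltr0_norm//; congr (_%:E); field; by rewrite lt_eqF.
Qed.

Lemma lebesgue_affine_ge0 (R : realType) (a c : R) (f : R -> \bar R) : a != 0 ->
  measurable_fun setT f -> (forall x, 0 <= f x)%E ->
  (\int[@lebesgue_measure R]_x f x =
   `|a|%:E * \int[@lebesgue_measure R]_x f (a * x + c)%R)%E.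
Proof.
move=> a0 mf f0.
pose phi : measurableTypeR R -> measurableTypeR R := fun x => a * x + c.
have mphi : measurable_fun setT phi.
  by apply: measurable_funD => //; exact: measurable_funM.
rewrite -[X in (_ * X)%E]/(\int[@lebesgue_measure R]_(x in phi @^-1` setT) (f \o phi) x)%E.
rewrite -ge0_integral_pushforward//.
rewrite -(ge0_integral_mscale (pushforward (@lebesgue_measure R) phi) measurableT (`|a|%:nng))//.
by apply: eq_measure_integral => // A mA _; first [exact: (lebesgue_affine c a0 mA)|exact: esym (lebesgue_affine c a0 mA)].
Qed.

Section change_of_variables.
Context d (T : measurableType d) (R : realType).
Variables (mu : {measure set T -> \bar R}) (phi : T -> T) (c : R).
Hypotheses (c0 : 0 < c) (mphi : measurable_fun setT phi).
Hypothesis phiE : forall f : T -> \bar R, measurable_fun setT f ->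
  (forall x, 0 <= f x)%E -> (\int[mu]_x f x = c%:E * \int[mu]_x f (phi x))%E.

(** The section starts from the formula for nonnegative functions only, so that it serves both the
    line and R^n. An infinite integral of [|f o phi|] would stay infinite after multiplication by
    [c > 0]. *)
Lemma integrable_change (f : T -> R) :
  mu.-integrable setT (EFin \o f) -> mu.-integrable setT (EFin \o (f \o phi)).
Proof.
move=> /integrableP[mf foo]; apply/integrableP; split.
  exact: (measurableT_comp mf mphi).
have := phiE (measurableT_comp (@abse_measurable R setT) mf)
   (fun x => abse_ge0 _).
rewrite /= => fE; move: foo; rewrite fE.
rewrite !ltey; apply: contraNN => /eqP ->.
by rewrite gt0_muley// lte_fin.
Qed.

Lemma Rintegral_change (f : T -> R) : mu.-integrable setT (EFin \o f) ->
  \int[mu]_x f x = c * \int[mu]_x f (phi x).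
Proof.
move=> fi; have fai := integrable_change fi.
rewrite /Rintegral (_ : c = fine c%:E)// -fineM//; last first.
  exact: integrable_fin_num fai.
pose g := f \o phi.
have Ep : (EFin \o g)^\+%E = fun x => ((EFin \o f)^\+)%E (phi x).
  by apply/funext => x; rewrite !funeposE.
have En : (EFin \o g)^\-%E = fun x => ((EFin \o f)^\-)%E (phi x).
  by apply/funext => x; rewrite !funenegE.
congr fine; rewrite -/(EFin \o g) integralE [in RHS](integralE _ _ (EFin \o g)) Ep En.
have [mf _] := integrableP _ _ _ fi.
rewrite (phiE (measurable_funepos mf))//.
rewrite (phiE (measurable_funeneg mf))//.
rewrite -muleBr//; last first.
  apply: fin_num_adde_defl; rewrite fin_numN.
  by have := integrable_neg_fin_num measurableT fai; rewrite -[X in (X^\-)%E]/(EFin \o g) En.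
Qed.

End change_of_variables.

Section lebesgue_change.
Variables (R : realType) (a c : R).
Hypothesis a0 : a != 0.
Implicit Types f : R -> R.

Let mphi : measurable_fun setT (fun x : measurableTypeR R => a * x + c).
Proof. by apply: measurable_funD => //; exact: measurable_funM. Qed.

Let na0 : 0 < `|a|. Proof. by rewrite normr_gt0. Qed.

Lemma integrable_affine1 f :
  (@lebesgue_measure R).-integrable setT (EFin \o f) ->
  (@lebesgue_measure R).-integrable setT (EFin \o (fun x => f (a * x + c))).
Proof.
move=> fi; apply: (@integrable_change _ (measurableTypeR R) R
  (@lebesgue_measure R) _ `|a| na0 mphi _ f fi) => g mg g0.
exact: lebesgue_affine_ge0.
Qed.

Lemma Rintegral_affine1 f :
  (@lebesgue_measure R).-integrable setT (EFin \o f) ->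
  \int[@lebesgue_measure R]_x f x =
    `|a| * \int[@lebesgue_measure R]_x f (a * x + c).
Proof.
move=> fi; apply: (@Rintegral_change _ (measurableTypeR R) R
  (@lebesgue_measure R) _ `|a| na0 mphi _ f fi) => g mg g0.
exact: lebesgue_affine_ge0.
Qed.

End lebesgue_change.

Section leb_facts.
Variable R : realType.
Implicit Types n : nat.

Lemma leb_tonelli n (F : 'rV[R]_n.+1 -> \bar R) :
  measurable_fun setT F -> (forall x, 0 <= F x)%E ->
  (\int[leb R n.+1]_x F x =
   \int[@lebesgue_measure R]_t \int[leb R n]_x F (rV_cons (t, x)))%E.
Proof.
move=> mF F0.
have H := @ge0_integral_pushforward _ _ (measurableTypeR R * 'rV[R]_n)%type _ R (@rV_cons R n)
  (@measurable_rV_cons R n) (@lebesgue_measure R \x leb R n)%E setT F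
  measurableT mF (fun y _ => F0 y).
apply: etrans; first exact: H.
rewrite preimage_setT.
rewrite fubini_tonelli1//. 
  exact: (measurableT_comp mF (@measurable_rV_cons R n)).
by move=> x; exact: F0.
Qed.

Lemma leb0E (F : 'rV[R]_0 -> \bar R) : measurable_fun setT F ->
  (\int[leb R 0]_x F x = F 0%R)%E.
Proof. by move=> mF; rewrite /= integral_dirac// diracT mul1e. Qed.

Lemma measurable_rV_affine n (a : R) (c : 'rV[R]_n) :
  measurable_fun setT (fun x : 'rV[R]_n => a *: x + c).
Proof.
apply: measurable_fun_rV => i; under eq_fun do rewrite !mxE.
apply: measurable_funD => //; apply: measurable_funM => //.
exact: (measurable_rV_coord i).
Qed.

Lemma rV_cons_affine n (a : R) (c : 'rV[R]_n.+1) t x :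
  a *: rV_cons (t, x) + c =
  rV_cons (a * t + c ord0 ord0, a *: x + (rV_uncons c).2).
Proof.
apply/rowP => i; rewrite [LHS]mxE [X in X + _]mxE.
case: (unliftP ord0 i) => [j|] ->.
  rewrite !rV_consS /= !mxE; congr (_ + c _ _); exact/val_inj.
by rewrite !rV_cons0.
Qed.

(** Induction on the dimension: Tonelli splits off the first coordinate, and the formula on the line
    contributes one factor [|a|]. *)
Lemma leb_affine_ge0 n (a : R) (c : 'rV[R]_n) (f : 'rV[R]_n -> \bar R) :
  a != 0 -> measurable_fun setT f -> (forall x, 0 <= f x)%E ->
  (\int[leb R n]_x f x =
   (`|a| ^+ n)%:E * \int[leb R n]_x f (a *: x + c)%R)%E.
Proof.
move=> a0; elim: n c f => [|n IH] c f mf f0.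
  rewrite expr0 mul1e !leb0E//; first by congr f; apply/rowP => -[].
  exact: measurableT_comp mf (measurable_rV_affine a c).
have mfc := measurableT_comp mf (measurable_rV_affine a c).
have f0c x : (0 <= (f \o (fun x => (a *: x + c)%R)) x)%E by exact: f0.
rewrite leb_tonelli// (leb_tonelli mfc)//.
set G := fun t => (\int[leb R n]_x f (rV_cons (t, x)))%E.
have mG : measurable_fun setT G.
  apply: (measurable_fun_fubini_tonelli_F (T1 := measurableTypeR R) (f \o @rV_cons R n)).
    exact: (measurableT_comp mf (@measurable_rV_cons R n)).
  by move=> x; exact: f0.
have G0 t : (0 <= G t)%E by apply: integral_ge0 => x _; exact: f0.
rewrite (lebesgue_affine_ge0 (c ord0 ord0) a0 mG G0).
rewrite exprS EFinM -muleA; congr (_ * _)%E.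
rewrite -ge0_integralZl_EFin//; last 2 first.
- by move=> t _; apply: integral_ge0 => x _; exact: f0.
- apply: (measurable_fun_fubini_tonelli_F (T1 := measurableTypeR R)
    ((f \o (fun x => a *: x + c)) \o @rV_cons R n)).
    exact: (measurableT_comp mfc (@measurable_rV_cons R n)).
  by move=> x; exact: f0.
apply: eq_integral => t _; rewrite /G (IH (rV_uncons c).2).
- by congr (_ * _)%E; apply: eq_integral => x _ /=; rewrite rV_cons_affine.
- exact: (measurable_fun_pair2 (f := f \o @rV_cons R n) (a * t + c ord0 ord0)
   (measurableT_comp mf (@measurable_rV_cons R n))).
- by move=> x; exact: f0.
Qed.

Lemma integrable_affine n (a : R) (c : 'rV[R]_n) (f : 'rV[R]_n -> R) :
  a != 0 -> (leb R n).-integrable setT (EFin \o f) ->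
  (leb R n).-integrable setT (EFin \o (fun x => f (a *: x + c))).
Proof.
move=> a0; apply: (integrable_change _ (measurable_rV_affine a c) (fun f => @leb_affine_ge0 n a c f a0)).
by rewrite exprn_gt0// normr_gt0.
Qed.

Lemma Rintegral_affine n (a : R) (c : 'rV[R]_n) (f : 'rV[R]_n -> R) :
  a != 0 -> (leb R n).-integrable setT (EFin \o f) ->
  \int[leb R n]_x f x = `|a| ^+ n * \int[leb R n]_x f (a *: x + c).
Proof.
move=> a0; apply: (Rintegral_change _ (measurable_rV_affine a c) (fun f => @leb_affine_ge0 n a c f a0)).
by rewrite exprn_gt0// normr_gt0.
Qed.

(** The inner integral stays extended-valued, since for exceptional [t] the section of [F] need not
    be integrable. *)
Lemma leb_fubini n (F : 'rV[R]_n.+1 -> R) :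
  (leb R n.+1).-integrable setT (EFin \o F) ->
  \int[leb R n.+1]_x F x =
    fine (\int[@lebesgue_measure R]_t \int[leb R n]_x (F (rV_cons (t, x)))%:E)%E.
Proof.
move=> Fi; have [mF Foo] := integrableP _ _ _ Fi.
have mFc := measurableT_comp mF (@measurable_rV_cons R n).
have iFc : (@lebesgue_measure R \x leb R n)%E.-integrable setT
   ((EFin \o F) \o @rV_cons R n : measurableTypeR R * 'rV[R]_n -> \bar R).
  apply/integrable12ltyP => //.
  move: Foo; rewrite leb_tonelli//.
  exact: measurableT_comp.
have H := @integral_pushforward _ _ (measurableTypeR R * 'rV[R]_n)%type _ R
  (@rV_cons R n) (@measurable_rV_cons R n) (@lebesgue_measure R \x leb R n)%E
  setT (EFin \o F) mF iFc measurableT.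
congr fine; apply: etrans; first exact: H.
by rewrite preimage_setT -integral12_prod_meas1.
Qed.

Lemma leb_prod2 n (f : R -> R) (g : 'rV[R]_n -> R) :
  (@lebesgue_measure R).-integrable setT (EFin \o f) ->
  (leb R n).-integrable setT (EFin \o g) ->
  let F := fun x : 'rV[R]_n.+1 => f (x ord0 ord0) * g (rV_uncons x).2 in
  (leb R n.+1).-integrable setT (EFin \o F) /\
  \int[leb R n.+1]_x F x = (\int[@lebesgue_measure R]_t f t) *
     (\int[leb R n]_x g x).
Proof.
move=> fi gi F.
have [/measurable_EFinP mf foo] := integrableP _ _ _ fi.
have [/measurable_EFinP mg goo] := integrableP _ _ _ gi.
have mF : measurable_fun setT F.
  apply: measurable_funM.
    exact: (measurableT_comp mf (measurable_rV_coord ord0)).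
  apply: (measurableT_comp mg).
  exact: (measurableT_comp measurable_snd (@measurable_rV_uncons R n)).
have FE t x : F (rV_cons (t, x)) = f t * g x.
  by rewrite /F rV_consK rV_cons0.
have iF : (leb R n.+1).-integrable setT (EFin \o F).
  apply/integrableP; split; first exact/measurable_EFinP.
  rewrite leb_tonelli//; last first.
    by apply: measurableT_comp => //; exact/measurable_EFinP.
  under eq_integral => t _.
    under eq_integral => x _ do rewrite /= FE normrM EFinM.
    rewrite ge0_integralZl_EFin//; last first.
      by apply: measurableT_comp => //; exact: measurableT_comp.
    over.
  rewrite ge0_integralZr//; last 2 first.
  - by apply: measurableT_comp => //; exact: measurableT_comp.
  - exact: integral_ge0.
  by rewrite lte_mul_pinfty// ?integral_ge0// ge0_fin_numE// integral_ge0.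
split => //; rewrite leb_fubini//.
under eq_integral => t _.
  under eq_integral => x _ do rewrite FE EFinM.
  rewrite integralZl//.
  over.
rewrite /= /Rintegral.
rewrite -(fineK (integrable_fin_num measurableT gi)).
rewrite integralZr// fineM//; exact: integrable_fin_num fi.
Qed.

Lemma leb_prod n (f : 'I_n -> R -> R) :
  (forall i, (@lebesgue_measure R).-integrable setT (EFin \o f i)) ->
  let F := fun x : 'rV[R]_n => \prod_(i < n) f i (x ord0 i) in
  (leb R n).-integrable setT (EFin \o F) /\
  \int[leb R n]_x F x = \prod_(i < n) \int[@lebesgue_measure R]_t f i t.
Proof.
elim: n f => [|n IH] f fi F.
  have -> : F = cst 1 by apply/funext => x; rewrite /F big_ord0.
  have mc : measurable_fun setT (EFin \o cst 1 : 'rV[R]_0 -> \bar R).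
    by apply/measurable_EFinP; exact: measurable_cst.
  split; last by rewrite /Rintegral (leb0E mc) big_ord0.
  apply/integrableP; split => //.
  rewrite (eq_integral (EFin \o cst 1)); last by move=> x _; rewrite /= normr1.
  by rewrite (leb0E mc) ltry.
have [] := IH (fun i => f (lift ord0 i)) (fun i => fi _).
set G := fun x => _ => iG GE.
have [] := leb_prod2 (fi ord0) iG.
have -> : (fun x : 'rV[R]_n.+1 => f ord0 (x ord0 ord0) * G (rV_uncons x).2) = F.
  apply/funext => x; rewrite /F big_ord_recl; congr (_ * _).
  apply: eq_bigr => i _; rewrite mxE; congr (f _ (x _ _)); exact/val_inj.
by move=> ? ->; rewrite big_ord_recl GE.
Qed.

End leb_facts.

(** * Absolutely summable families on Z^d *)

Section fset_sums.
Variables (R : realType) (T : choiceType).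
Implicit Types (A B : {fset T}) (f : T -> R).

Lemma sum_fset_sub (V : nmodType) A B (f : T -> V) : (A `<=` B)%fset ->
  \sum_(k <- B) f k = \sum_(k <- A) f k + \sum_(k <- (B `\` A)%fset) f k.
Proof.
move=> AB; rewrite (big_fsetID _ (mem A)) /=; congr (_ + _).
  apply: eq_fbigl => k; rewrite !inE /=.
  by apply/andP/idP => [[]//|kA]; split => //; exact: (fsubsetP AB).
by apply: eq_fbigl => k; rewrite !inE /= andbC.
Qed.

Lemma ler_sum_fset A B f : (A `<=` B)%fset -> (forall k, 0 <= f k) ->
  \sum_(k <- A) f k <= \sum_(k <- B) f k.
Proof. by move=> AB f0; rewrite (sum_fset_sub _ AB) lerDl sumr_ge0. Qed.

(** Unconditional convergence, along the directed set of finite index sets. It is additive without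
    any splitting by sign, and any exhaustion by boxes inherits it. *)
Definition has_zsum f (s : R) := forall eps : R, 0 < eps ->
  exists A, forall B, (A `<=` B)%fset -> `|\sum_(k <- B) f k - s| < eps.

Lemma has_zsumD f g s t : has_zsum f s -> has_zsum g t ->
  has_zsum (fun k => f k + g k) (s + t).
Proof.
move=> fs gt e e0; have e2 : 0 < e / 2 by rewrite divr_gt0.
have [A HA] := fs _ e2; have [B HB] := gt _ e2.
exists (A `|` B)%fset => C; rewrite fsubUset => /andP[AC BC].
rewrite big_split /= opprD addrACA (splitr e).
by rewrite (le_lt_trans (ler_normD _ _))// ltrD ?HA ?HB.
Qed.

Lemma has_zsumN f s : has_zsum f s -> has_zsum (fun k => - f k) (- s).
Proof.
move=> fs e e0; have [A HA] := fs _ e0; exists A => B AB.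
by rewrite sumrN -opprD normrN HA.
Qed.

(** The extended sum is the supremum of the finite sums: a finite set coming within [eps] of it is
    the witness, and the sums over larger sets stay in between. *)
Lemma nneg_has_zsum f M : (forall k, 0 <= f k) ->
  (forall A, \sum_(k <- A) f k <= M) ->
  (\esum_(k in setT) (f k)%:E < +oo)%E /\
  has_zsum f (fine (\esum_(k in setT) (f k)%:E)).
Proof.
move=> f0 fM.
have sumE A : (\sum_(k \in [set` A]) (f k)%:E = (\sum_(k <- A) f k)%:E)%E.
  by rewrite fsbig_finite//= set_fsetK sumEFin.
have leM : (\esum_(k in setT) (f k)%:E <= M%:E)%E.
  apply: ge_ereal_sup => _ [X [finX _] <-].
  by rewrite -(fset_setK finX) sumE lee_fin.
have fin : (\esum_(k in setT) (f k)%:E)%E \is a fin_num.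
  by rewrite ge0_fin_numE ?esum_ge0// => [|k _]; rewrite ?lee_fin// (le_lt_trans leM)// ltry.
split; first by rewrite -ge0_fin_numE// esum_ge0// => k _; rewrite lee_fin.
move=> e e0.
have [_ [X [finX _] <-]] := ub_ereal_sup_adherent e0 fin.
rewrite -(fset_setK finX) sumE => h.
have {}h : fine (\esum_(k in setT) (f k)%:E) - e < \sum_(k <- fset_set X) f k.
  by rewrite -lte_fin EFinB fineK.
exists (fset_set X) => B AB.
rewrite ltr_distl; apply/andP; split.
  apply: (lt_le_trans h).
  exact: ler_sum_fset.
rewrite (le_lt_trans _ (_ : fine (\esum_(k in setT) (f k)%:E) < _))//; last first.
  by rewrite ltrDl.
rewrite -lee_fin fineK// -sumE; apply: ereal_sup_ubound.
by exists [set` B] => //; split.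
Qed.

Lemma summable_bound f M : (forall A, \sum_(k <- A) `|f k| <= M) ->
  summable setT (EFin \o f).
Proof.
by move=> fM; have [] := @nneg_has_zsum (fun k => `|f k|) M _ fM.
Qed.

Lemma bound_summable f : summable setT (EFin \o f) ->
  exists M, forall A, \sum_(k <- A) `|f k| <= M.
Proof.
rewrite summableE => fin.
exists (fine (\esum_(x in setT) `|(EFin \o f) x|%E)) => A.
rewrite -lee_fin fineK//; apply: ereal_sup_ubound.
by exists [set` A] => //; rewrite fsbig_finite//= set_fsetK sumEFin.
Qed.

Lemma summable_has_zsum f : summable setT (EFin \o f) ->
  has_zsum f (fine (\esum_(k in setT) ((EFin \o f)^\+)%E k)
  - fine (\esum_(k in setT) ((EFin \o f)^\-)%E k)).
Proof.
move=> /bound_summable[M fM].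
have p k : ((EFin \o f)^\+)%E k = (Num.max (f k) 0)%:E by rewrite funeposE EFin_max.
have n k : ((EFin \o f)^\-)%E k = (Num.max (- f k) 0)%:E by rewrite funenegE EFin_max.
have -> : \esum_(k in setT) ((EFin \o f)^\+)%E k =
    \esum_(k in setT) (Num.max (f k) 0)%:E by apply: eq_esum => k _; exact: p.
have -> : \esum_(k in setT) ((EFin \o f)^\-)%E k =
    \esum_(k in setT) (Num.max (- f k) 0)%:E by apply: eq_esum => k _; exact: n.
have hp A : \sum_(k <- A) Num.max (f k) 0 <= M.
  rewrite (le_trans _ (fM A))// ler_sum// => k _.
  by rewrite ge_max ler_norm normr_ge0.
have hn A : \sum_(k <- A) Num.max (- f k) 0 <= M.
  rewrite (le_trans _ (fM A))// ler_sum// => k _.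
  by rewrite ge_max -normrN ler_norm normr_ge0.
have [|_ zp] := nneg_has_zsum _ hp.
  by move=> k; rewrite le_max lexx orbT.
have [|_ zn] := nneg_has_zsum _ hn.
  by move=> k; rewrite le_max lexx orbT.
have := has_zsumD zp (has_zsumN zn).
congr (has_zsum _ _); apply/funext => k.
have [h|h] := boolP (0 <= f k).
  by rewrite max_l// max_r ?oppr_le0// subr0.
have {}h : f k <= 0 by rewrite ltW// ltNge.
by rewrite max_r// max_l ?oppr_ge0// opprK add0r.
Qed.

End fset_sums.

Lemma zsum_has_zsum (R : realType) d (f : 'rV[int]_d -> R) : zsummable f ->
  has_zsum f (zsum f).
Proof. exact: summable_has_zsum. Qed.

Section boxes.
Variables (d : nat).

(** Points of a box are coded by finite functions so that [bigA_distr_bigA] turns a box sum of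
    products into a product of one-dimensional sums. *)
Definition boxpt N (f : {ffun 'I_d -> 'I_N.*2.+1}) : 'rV[int]_d :=
  \row_j ((f j)%:Z - N%:Z).

Definition box N : {fset 'rV[int]_d} :=
  [fset boxpt f | f in enum {ffun 'I_d -> 'I_N.*2.+1}]%fset.

Lemma boxpt_inj N : injective (@boxpt N).
Proof.
move=> f g /rowP fg; apply/ffunP => j; have := fg j; rewrite !mxE.
by move=> /addIr [] /val_inj.
Qed.

Lemma mem_box N k : (k \in box N) = [forall j, `|k ord0 j| <= N%:Z].
Proof.
apply/imfsetP/forallP => /= [[f _ ->] j|kN].
  rewrite mxE ler_norml; have := ltn_ord (f j); move: (nat_of_ord _) => i; lia.
have lt j : (absz (k ord0 j + N%:Z)%R < N.*2.+1)%N.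
  move: (kN j); rewrite ler_norml; move: (k ord0 j : int) => x /andP[]; lia.
exists [ffun j => Ordinal (lt j)]; first exact: mem_enum.
apply/rowP => j; rewrite mxE ffunE /=.
by move: (kN j); rewrite ler_norml; move: (k ord0 j : int) => x /andP[]; lia.
Qed.

Lemma subset_box N M : (N <= M)%N -> (box N `<=` box M)%fset.
Proof.
move=> NM; apply/fsubsetP => k; rewrite !mem_box => /forallP kN.
by apply/forallP => j; apply: le_trans (kN j) _; rewrite lez_nat.
Qed.

Lemma fset_sub_box (A : {fset 'rV[int]_d}) : exists N, (A `<=` box N)%fset.
Proof.
exists (\max_(k <- A) \max_(j < d) absz (k ord0 j))%N.
apply/fsubsetP => k kA; rewrite mem_box; apply/forallP => j.
rewrite -abszE lez_nat.
apply: (@leq_trans (\max_(j < d) absz (k ord0 j))%N).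
  exact: (leq_bigmax (F := fun j => absz (k ord0 j)) j).
exact: (leq_bigmax_seq (F := fun k : 'rV[int]_d => (\max_(j < d) absz (k ord0 j))%N)).
Qed.

Lemma sum_box (V : nmodType) N (F : 'rV[int]_d -> V) :
  \sum_(k <- box N) F k =
  \sum_(f : {ffun 'I_d -> 'I_N.*2.+1}) F (boxpt f).
Proof.
rewrite /box big_imfset /=; last by move=> f g _ _; exact: boxpt_inj.
by rewrite undup_id ?enum_uniq// -[RHS]big_enum.
Qed.

Definition isum (V : nmodType) N (a : int -> V) : V :=
  \sum_(i < N.*2.+1) a (i%:Z - N%:Z).

Lemma sum_box_prod (V : comPzSemiRingType) N (a : 'I_d -> int -> V) :
  \sum_(k <- box N) \prod_(j < d) a j (k ord0 j) =
  \prod_(j < d) isum N (a j).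
Proof.
rewrite sum_box /isum bigA_distr_bigA /=; apply: eq_bigr => f _.
by apply: eq_bigr => j _; rewrite mxE.
Qed.

Lemma cvg_box (R : realType) (f : 'rV[int]_d -> R) s : has_zsum f s ->
  (fun N => \sum_(k <- box N) f k) @ \oo --> s.
Proof.
move=> fs; apply/cvgrPdist_lt => e e0; have [A HA] := fs _ e0.
have [N AN] := fset_sub_box A.
exists N => // M /= NM; rewrite distrC; apply: HA.
exact: fsubset_trans AN (subset_box NM).
Qed.

Lemma cvg_box_zsum (R : realType) (f : 'rV[int]_d -> R) : zsummable f ->
  (fun N => \sum_(k <- box N) f k) @ \oo --> zsum f.
Proof. by move=> fs; apply: cvg_box; exact: zsum_has_zsum. Qed.

Lemma summable_box (R : realType) (f : 'rV[int]_d -> R) M :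
  (forall N, \sum_(k <- box N) `|f k| <= M) -> zsummable f.
Proof.
move=> fM; apply: (@summable_bound _ _ _ M) => A.
have [N AN] := fset_sub_box A.
by rewrite (le_trans _ (fM N))// ler_sum_fset.
Qed.

(** Lattice sums can be evaluated by symmetric partial sums, the form in which Poisson summation
    delivers them, once absolute summability is known separately. *)
Lemma cvg_box_eq (R : realType) (f : 'rV[int]_d -> R) s : zsummable f ->
  (fun N => \sum_(k <- box N) f k) @ \oo --> s -> zsum f = s.
Proof.
move=> /cvg_box_zsum fz fs.
by rewrite -(cvg_lim _ fz)// -(cvg_lim _ fs).
Qed.

End boxes.

(** * Bounded measurable functions *)

Section bounded_measurable.
Context d (T : measurableType d) (R : realType).

(** A class closed under the algebraic operations, whose members are integrable on sets of finite
    measure and are multipliers of integrable functions; it discharges most integrability conditions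
    below. *)
Definition bmeas (f : T -> R) :=
  measurable_fun setT f /\ exists M, forall x, `|f x| <= M.

Lemma bmeas_cst c : bmeas (fun=> c).
Proof. by split; [exact: measurable_cst|exists `|c|]. Qed.

Lemma bmeasD f g : bmeas f -> bmeas g -> bmeas (fun x => f x + g x).
Proof.
move=> [mf [M fM]] [mg [N gN]]; split; first exact: measurable_funD.
by exists (M + N) => x; rewrite (le_trans (ler_normD _ _))// lerD.
Qed.

Lemma bmeasM f g : bmeas f -> bmeas g -> bmeas (fun x => f x * g x).
Proof.
move=> [mf [M fM]] [mg [N gN]]; split; first exact: measurable_funM.
by exists (M * N) => x; rewrite normrM ler_pM.
Qed.

Lemma bmeasZ c f : bmeas f -> bmeas (fun x => c * f x).
Proof. by move=> bf; apply: bmeasM => //; exact: bmeas_cst. Qed.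

Lemma bmeasN f : bmeas f -> bmeas (fun x => - f x).
Proof.
move=> [mf [M fM]]; split; first exact: measurableT_comp.
by exists M => x; rewrite normrN.
Qed.

Lemma bmeasB f g : bmeas f -> bmeas g -> bmeas (fun x => f x - g x).
Proof. by move=> bf bg; apply: bmeasD => //; exact: bmeasN. Qed.

Lemma bmeas_sum I (r : seq I) (f : I -> T -> R) : (forall i, bmeas (f i)) ->
  bmeas (fun x => \sum_(i <- r) f i x).
Proof.
move=> bf; elim: r => [|i r IH].
  by under eq_fun do rewrite big_nil; exact: bmeas_cst.
by under eq_fun do rewrite big_cons; exact: bmeasD.
Qed.

Lemma bmeas_comp (g : T -> T) f : measurable_fun setT g -> bmeas f -> bmeas (f \o g).
Proof.
move=> mg [mf [M fM]]; split; first exact: measurableT_comp.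
by exists M => x /=.
Qed.

Variable mu : {measure set T -> \bar R}.

Lemma bmeas_integrable (D : set T) f : measurable D -> (mu D < +oo)%E ->
  bmeas f -> mu.-integrable D (EFin \o f).
Proof.
move=> mD Doo [mf [M fM]]; apply: measurable_bounded_integrable => //.
  exact: measurable_funTS.
exists M; split; first exact: num_real.
by move=> N MN x _; apply: le_trans (fM x) (ltW MN).
Qed.

Lemma bmeasM_integrable (D : set T) f g : measurable D -> bmeas f ->
  mu.-integrable D (EFin \o g) ->
  mu.-integrable D (EFin \o (fun x => f x * g x)).
Proof.
move=> mD [mf [M fM]] ig.
apply: (integrableMr mD (measurable_funTS mf) _ ig).
exists M; split; first exact: num_real.
by move=> N MN x _; apply: le_trans (fM x) (ltW MN).
Qed.

(** Integrability is returned with the value so that the lemma can be fed back into itself for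
    double sums. *)
Lemma Rintegral_sum I (r : seq I) (D : set T) (f : I -> T -> R) :
  measurable D -> (forall i, mu.-integrable D (EFin \o f i)) ->
  \int[mu]_(x in D) (\sum_(i <- r) f i x) = \sum_(i <- r) \int[mu]_(x in D) f i x
  /\ mu.-integrable D (EFin \o (fun x => \sum_(i <- r) f i x)).
Proof.
move=> mD fi; elim: r => [|i r [IH1 IH2]].
  rewrite big_nil; under eq_Rintegral do rewrite big_nil.
  rewrite Rintegral_cst// mul0r; split => //.
  apply: (eq_integrable mD (cst 0%E)) => [x _|] /=; first by rewrite big_nil.
  exact: integrable0.
rewrite big_cons; under eq_Rintegral do rewrite big_cons.
rewrite RintegralD// IH1; split => //.
pose S x := \sum_(i <- r) f i x.
apply: (eq_integrable mD ((EFin \o f i) \+ (EFin \o S))%E).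
  by move=> x _ /=; rewrite big_cons EFinD.
exact: integrableD.
Qed.

End bounded_measurable.

(** * Integrals of cosines over an interval *)

Section one_dim.
Variable R : realType.
Notation mu := (@lebesgue_measure R).

Lemma continuous_bmeas (f : R -> R) M : continuous f -> (forall x, `|f x| <= M) ->
  bmeas f.
Proof.
by move=> cf fM; split; [exact: continuous_measurable_fun|exists M].
Qed.

Lemma FTC_R (F f : R -> R) (a b : R) : a < b ->
  (forall x : R, is_derive x 1 F (f x)) -> continuous f ->
  \int[mu]_(x in `[a, b]) f x = F b - F a.
Proof.
move=> ab dF cf.
have cF : continuous F.
  by move=> x; apply: differentiable_continuous; exact/derivable1_diffP.
rewrite /Rintegral (@continuous_FTC2 _ f F)//.
- exact: continuous_subspaceT.
- split=> [x _||] //.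
  + exact/cvg_at_right_filter/cF.
  + exact/cvg_at_left_filter/cF.
- by move=> x _; rewrite derive1E; exact: derive_val.
Qed.

(** Cosines carry a phase [p] throughout, so that sine is the case [p = - pi / 2]. *)
Lemma continuous_cosM (c p : R) : continuous (fun x => cos (c * x + p)).
Proof.
move=> x; apply: continuous_comp; last exact: continuous_cos.
by apply: continuousD; [apply: continuousM; [exact: cvg_cst|exact: cvg_id]|exact: cvg_cst].
Qed.

Lemma bmeas_cosM (c p : R) : bmeas (fun x : R => cos (c * x + p)).
Proof. by apply: (@continuous_bmeas _ 1); [exact: continuous_cosM|move=> x; exact: cos_max]. Qed.

Lemma sin_cosM (c x : R) : sin (c * x) = cos (c * x + - (pi / 2)).
Proof. by rewrite cosBpihalf. Qed.

Lemma bmeas_sinM (c : R) : bmeas (fun x : R => sin (c * x)).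
Proof. by under eq_fun do rewrite sin_cosM; exact: bmeas_cosM. Qed.

Lemma Rintegral_cosM (c p a b : R) : a < b -> c != 0 ->
  \int[mu]_(x in `[a, b]) cos (c * x + p) = (sin (c * b + p) - sin (c * a + p)) / c.
Proof.
move=> ab c0.
have dF (x : R) : is_derive x 1 (fun x => c^-1 * sin (c * x + p)) (cos (c * x + p)).
  apply: is_derive_eq; rewrite /GRing.scale /=.
  by field.
by rewrite (FTC_R ab dF (@continuous_cosM c p)); field.
Qed.

End one_dim.

(** * Periodicity, and a lower bound for the sine near the origin *)

Section trigo_periodicity.
Variable R : realType.

Lemma cos_period (x : R) (n : int) : cos (x + 2 * pi * n%:~R) = cos x.
Proof.
have E (m : nat) y : cos (y + 2 * pi * m%:R) = cos y :> R.
  rewrite -(periodicn (@cosD2pi R) m y); congr (cos (_ + _)).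
  by rewrite -[_ *+ m]mulr_natr -[pi *+ 2]mulr_natr; ring.
case: n => m; first exact: E.
by rewrite NegzE mulrNz mulrN -[LHS](E m.+1) subrK.
Qed.

Lemma sin_period (x : R) (n : int) : sin (x + 2 * pi * n%:~R) = sin x.
Proof.
by rewrite -!cosBpihalf addrAC cos_period.
Qed.

Lemma sin_intpi (n : int) : sin (n%:~R * pi) = 0 :> R.
Proof.
apply/eqP; rewrite -norm_cos_eq1 -sqrp_eq1// real_normK ?num_real//.
have := cos_period 0 n; rewrite add0r cos0.
rewrite (_ : 2 * pi * _ = n%:~R * pi *+ 2); last by rewrite -[RHS]mulr_natr; ring.
rewrite cos_mulr2n => /eqP; rewrite subr_eq -[_ *+ 2]mulr_natr => /eqP h.
apply/eqP; lra.
Qed.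

(** Half angles: with [y = x / 2] the mean value theorem gives [sin y >= y cos y], and
    [cos y ^ 2 >= 1 / 2] because [cos x >= 0]; so [sin x = 2 sin y cos y >= y]. *)
Lemma le_sin_half (x : R) : 0 <= x -> x <= pi / 2 -> x / 2 <= sin x.
Proof.
move=> x0 xpi.
pose y := x / 2.
have y0 : 0 <= y by rewrite divr_ge0.
have pi0 := pi_gt0 R.
have cmono z w : 0 <= z -> z <= w -> w <= pi -> cos w <= cos z.
  rewrite le_eqVlt => /predU1P[<-|z0] zw wpi; first by rewrite cos0 cos_le1.
  move: zw; rewrite le_eqVlt => /predU1P[->//|zw].
  have zi : z \in `[0, pi] by rewrite in_itv/=; apply/andP; split; lra.
  have wi : w \in `[0, pi] by rewrite in_itv/=; apply/andP; split; lra.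
  by rewrite ltW// ltr_cos.
have syc : y * cos y <= sin y.
  move: y0; rewrite le_eqVlt => /predU1P[<-|y0]; first by rewrite mul0r sin0.
  have [|c cy] := @MVT R sin cos 0 y y0 (fun x _ => is_derive_sin x).
    exact/continuous_subspaceT/continuous_sin.
  rewrite sin0 !subr0 => ->; move: cy; rewrite in_itv/= => /andP[c0 cy].
  rewrite mulrC ler_pM2r// cmono// ?ltW//.
  by rewrite /y; lra.
have c2 : 1 / 2 <= cos y ^+ 2.
  have : 0 <= cos x by rewrite -cos_pihalf cmono//; lra.
  rewrite {1}(_ : x = y *+ 2); last by rewrite -mulr_natr /y; field.
  by rewrite cos_mulr2n -mulr_natr => h; lra.
have cy0 : 0 <= cos y.
  by apply: cos_ge0_pihalf; rewrite /y; apply/andP; split; lra.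
rewrite {2}(_ : x = y *+ 2); last by rewrite -mulr_natr /y; field.
rewrite sin_mulr2n -mulr_natr.
have : y * cos y * cos y <= sin y * cos y by apply: ler_wpM2r.
have : y * (1 / 2) <= y * cos y ^+ 2 by apply: ler_wpM2l.
rewrite expr2 mulrA /y => h1 h2; lra.
Qed.

(** The factor [1 / 2] of [le_sin_half] is regained from [pi >= 2]. This keeps quotients by
    [sin (pi * x)] bounded on [half]. *)
Lemma norm_sin_ge (x : R) : `|x| <= 2^-1 -> `|x| <= `|sin (pi * x)|.
Proof.
move=> xh.
have pi2 := pi_ge2 R.
have -> : `|sin (pi * x)| = `|sin (pi * `|x|)|.
  by case: (ger0P x) => //; rewrite mulrN sinN normrN.
have := normr_ge0 x; move: (`|x|) xh => y yh y0.
have : pi * y / 2 <= sin (pi * y).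
  apply: le_sin_half; nra.
move=> h; rewrite ger0_norm; nra.
Qed.

End trigo_periodicity.

(** * Poisson summation on the line *)

Section riemann_lebesgue.
Variable R : realType.
Notation mu := (@lebesgue_measure R).

Definition half : set R := `[- 2^-1, 2^-1].

Lemma measurable_half : measurable half.
Proof. exact: measurable_itv. Qed.

Lemma mu_half : mu half = 1%E.
Proof.
rewrite /half lebesgue_measure_itv/= lte_fin ifT; last by lra.
by rewrite -EFinB; congr (_%:E); field.
Qed.

Lemma half_integrable (f : R -> R) : bmeas f -> mu.-integrable half (EFin \o f).
Proof.
move=> bf; apply: (@bmeas_integrable _ (measurableTypeR R) R mu half f) => //.
  exact: measurable_half.
by apply: (le_lt_trans _ (ltry 1)); rewrite -mu_half.
Qed.

Lemma Rintegral_cos_half (n : int) :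
  \int[mu]_(x in half) cos (2 * pi * n%:~R * x) = (n == 0)%:R.
Proof.
have [->|n0] := eqVneq n 0.
  under eq_Rintegral do rewrite mulr0 mul0r cos0.
  rewrite Rintegral_cst ?mul1r; last exact: measurable_half.
  exact: (congr1 fine mu_half).
under eq_Rintegral do rewrite -[_ * _]addr0.
have c0 : 2 * pi * n%:~R != 0 :> R.
  by rewrite !mulf_neq0 ?intr_eq0// gt_eqF// pi_gt0.
rewrite Rintegral_cosM//; last by lra.
rewrite !addr0 mulrN sinN (_ : _ / 2 = n%:~R * pi); last by field.
by rewrite sin_intpi oppr0 subr0 mul0r.
Qed.

Let e (n : nat) (x : R) := sin (pi * n.*2.+1%:R * x).

Let be n : bmeas (e n). Proof. exact: bmeas_sinM. Qed.

(** The product-to-sum formula leaves cosines of the integer frequencies [n - m] and [n + m + 1].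
    The second is never zero, so only the diagonal contributes. *)
Lemma sin_half_orthogonal (n m : nat) :
  \int[mu]_(x in half) (e n x * e m x) = (n == m)%:R / 2.
Proof.
under eq_Rintegral => x _.
  rewrite (_ : e n x * e m x =
     2^-1 * (cos (2 * pi * (n%:Z - m%:Z)%:~R * x) -
             cos (2 * pi * (n%:Z + m%:Z + 1)%:~R * x))); last first.
    rewrite (_ : 2 * pi * (n%:Z - m%:Z)%:~R * x = pi * n.*2.+1%:R * x - pi * m.*2.+1%:R * x); last first.
      by rewrite !(intrD, intrM, rmorphN) /= -!muln2 -!natr1 !natrM; ring.
    rewrite (_ : 2 * pi * (n%:Z + m%:Z + 1)%:~R * x = pi * n.*2.+1%:R * x + pi * m.*2.+1%:R * x); last first.
      by rewrite !(intrD, intrM, rmorphN) /= -!muln2 -!natr1 !natrM; ring.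
    by rewrite cosB cosD /e; field.
  over.
have bc (k : int) : mu.-integrable half (EFin \o (fun x => cos (2 * pi * k%:~R * x))).
  apply: half_integrable; under eq_fun do rewrite -[_ * _]addr0; exact: bmeas_cosM.
rewrite RintegralZl; [|exact: measurable_half|]; last first.
  apply: half_integrable; apply: bmeasB;
    under eq_fun do rewrite -[_ * _]addr0; exact: bmeas_cosM.
rewrite RintegralB//; last exact: measurable_half.
rewrite !Rintegral_cos_half subr_eq0.
rewrite (_ : (n%:Z + m%:Z + 1 == 0) = false); last by lia.
by rewrite subr0 mulrC eqz_nat.
Qed.

(* Bessel: the functions [e n] are orthogonal on [half], hence the coefficients of
   [H] are square summable. *)
Lemma riemann_lebesgue_sin (H : R -> R) : bmeas H ->
  (fun n => \int[mu]_(x in half) (H x * e n x)) @ \oo --> 0.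
Proof.
move=> bH; pose c n := \int[mu]_(x in half) (H x * e n x).
have mh := measurable_half.
(* The factor 2 compensates for the squared norm [1 / 2] of [e n], so [S N] is the orthogonal
   projection of [H]. *)
pose S N x := \sum_(n < N) 2 * c n * e n x.
have bS N : bmeas (S N).
  by apply: bmeas_sum => i; exact: bmeasZ.
have Se N m : (N <= m)%N -> \int[mu]_(x in half) (S N x * e m x) = 0.
  move=> Nm; under eq_Rintegral => x _ do rewrite /S mulr_suml.
  have Si (n : 'I_N) : mu.-integrable half (EFin \o (fun x => 2 * c n * e n x * e m x)).
    by apply: half_integrable; apply: bmeasM => //; exact: bmeasZ.
  have [-> _] := @Rintegral_sum _ (measurableTypeR R) R mu _ (index_enum 'I_N) half _ mh Si.
  rewrite big1// => n _.
  under eq_Rintegral do rewrite -mulrA.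
  rewrite RintegralZl//; last by apply: half_integrable; exact: bmeasM.
  rewrite sin_half_orthogonal (_ : (nat_of_ord n == m) = false) ?mul0r ?mulr0//.
  by apply/negbTE; rewrite neq_ltn (leq_trans (ltn_ord n) Nm).
(* Pythagoras, one term at a time: the cross term with [S N] vanishes, and the [N]-th step removes
   [2 * c N ^+ 2] from the squared norm of the remainder. *)
have QE N : \int[mu]_(x in half) ((H x - S N x) ^+ 2) =
    \int[mu]_(x in half) (H x ^+ 2) - 2 * \sum_(n < N) c n ^+ 2.
  elim: N => [|N IH].
    rewrite big_ord0 mulr0 subr0; apply: eq_Rintegral => x _.
    by rewrite /S big_ord0 subr0.
  under eq_Rintegral => x _.
    rewrite (_ : _ ^+ 2 = (H x - S N x) ^+ 2 - 4 * c N * (H x * e N x - S N x * e N x)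
       + 4 * c N ^+ 2 * (e N x * e N x)); last first.
      by rewrite /S big_ord_recr /=; ring.
    over.
  have bq : bmeas (fun x => (H x - S N x) ^+ 2).
    by under eq_fun do rewrite expr2; apply: bmeasM; exact: bmeasB.
  have b1 : bmeas (fun x => H x * e N x) by exact: bmeasM.
  have b2 : bmeas (fun x => S N x * e N x) by exact: bmeasM.
  have b3 : bmeas (fun x => 4 * c N * (H x * e N x - S N x * e N x)).
    by apply: bmeasZ; exact: bmeasB.
  have b4 : bmeas (fun x => e N x * e N x) by exact: bmeasM.
  rewrite RintegralD//; [|by apply: half_integrable; exact: bmeasB|by apply: half_integrable; exact: bmeasZ].
  rewrite RintegralB//; [|exact: half_integrable|exact: half_integrable].
  rewrite RintegralZl//; last by apply: half_integrable; exact: bmeasB.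
  rewrite RintegralB//; [|exact: half_integrable|exact: half_integrable].
  rewrite RintegralZl//; last exact: half_integrable.
  rewrite Se// sin_half_orthogonal eqxx IH -/(c N) big_ord_recr /=.
  by field.
have bd N : \sum_(n < N) c n ^+ 2 <= \int[mu]_(x in half) (H x ^+ 2) / 2.
  have : 0 <= \int[mu]_(x in half) ((H x - S N x) ^+ 2).
    by apply: Rintegral_ge0 => x _; exact: sqr_ge0.
  rewrite QE => h; lra.
have cc : cvgn (series (fun n => c n ^+ 2)).
  apply: nondecreasing_is_cvgn.
    apply/nondecreasing_seqP => n.
    by rewrite /series /= big_nat_recr//= lerDl sqr_ge0.
  exists (\int[mu]_(x in half) (H x ^+ 2) / 2) => _ [n _ <-].
  by rewrite /series /= big_mkord.
have c2 := cvg_series_cvg_0 cc.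
apply/cvgrPdist_lt => eps eps0.
have e2 : 0 < eps ^+ 2 by rewrite exprn_gt0.
have /cvgrPdist_lt /(_ _ e2) := c2.
apply: filterS => n; rewrite !sub0r !normrN normrX => h.
by rewrite -(ltr_pXn2r (_ : 0 < 2)%N)// nnegrE// ltW.
Qed.

End riemann_lebesgue.

Section dirichlet.
Variable R : realType.
Notation mu := (@lebesgue_measure R).

Lemma isumS (V : zmodType) N (a : int -> V) :
  isum N.+1 a = a (- N.+1%:Z) + isum N a + a N.+1%:Z.
Proof.
rewrite /isum doubleS big_ord_recr big_ord_recl /=; congr (_ + _ + _).
- by congr a; rewrite sub0r.
- by apply: eq_bigr => i _; congr a; rewrite /bump /= add1n; lia.
- congr a; rewrite /bump /=; lia.
Qed.

Lemma isum0 (V : zmodType) (a : int -> V) : isum 0 a = a 0.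
Proof. by rewrite /isum big_ord1 /= subr0. Qed.

Lemma eq_isum (V : zmodType) N (a b : int -> V) :
  (forall r, `|r| <= N%:Z -> a r = b r) -> isum N a = isum N b.
Proof.
move=> ab; apply: eq_bigr => i _; apply: ab.
rewrite ler_norml; have := ltn_ord i; move: (nat_of_ord i) => k; lia.
Qed.

Lemma isumN (V : zmodType) N (a : int -> V) : isum N (fun r => a (- r)) = isum N a.
Proof.
elim: N => [|N IH]; first by rewrite !isum0 oppr0.
by rewrite !isumS IH opprK addrC addrA addrC addrA [X in X + _]addrC.
Qed.

Lemma isumD (V : zmodType) N (a b : int -> V) :
  isum N (fun r => a r + b r) = isum N a + isum N b.
Proof. by rewrite /isum big_split. Qed.

Lemma isum_odd N (a : int -> R) : (forall r, a (- r) = - a r) -> isum N a = 0.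
Proof.
move=> ao; have := isumN N a.
rewrite {1}/isum; under eq_bigr do rewrite ao.
rewrite sumrN -/(isum N a) => h; lra.
Qed.

Definition dirichlet N (x : R) := isum N (fun r => cos (2 * pi * r%:~R * x)).

Lemma bmeas_dirichlet N : bmeas (dirichlet N).
Proof.
by apply: bmeas_sum => i; under eq_fun do rewrite -[_ * _]addr0; exact: bmeas_cosM.
Qed.

Lemma dirichlet_period N x (k : int) : dirichlet N (x + k%:~R) = dirichlet N x.
Proof.
apply: eq_isum => r _; rewrite mulrDr -[RHS](cos_period _ (r * k)).
by congr cos; rewrite intrM; ring.
Qed.

(** Telescoping: the two terms added at step [N + 1], times [sin (pi * x)], form a difference of
    consecutive right-hand sides. The product form also covers the zeros of the sine. *)
Lemma dirichlet_sin N x :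
  dirichlet N x * sin (pi * x) = sin (pi * N.*2.+1%:R * x).
Proof.
elim: N => [|N IH].
  by rewrite /dirichlet isum0 mulr0 mul0r cos0 mul1r mulr1.
have E (u v w s : R) : (u + v + w) * s = u * s + v * s + w * s by ring.
rewrite [dirichlet _ _]isumS -/(dirichlet N x) E IH.
rewrite mulrNz mulrN mulNr cosN.
set a := 2 * pi * N.+1%:~R * x.
rewrite (_ : pi * N.+1.*2.+1%:R * x = a + pi * x); last first.
  by rewrite /a -[N.+1.*2.+1]addn1 -muln2 natrD natrM; ring.
rewrite (_ : pi * N.*2.+1%:R * x = a - pi * x); last first.
  by rewrite /a -[N.*2.+1]addn1 -[N.+1]addn1 -muln2 !(natrD, natrM, intrD); ring.
rewrite sinB sinD; ring.
Qed.

Lemma Rintegral_dirichlet N : \int[mu]_(x in @half R) dirichlet N x = 1.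
Proof.
have Si (i : 'I_N.*2.+1) : mu.-integrable (@half R)
    (EFin \o (fun x => cos (2 * pi * (i%:Z - N%:Z)%:~R * x))).
  apply: half_integrable; under eq_fun do rewrite -[_ * _]addr0.
  exact: bmeas_cosM.
have [-> _] := @Rintegral_sum _ (measurableTypeR R) R mu _
   (index_enum 'I_N.*2.+1) (@half R) _ (@measurable_half R) Si.
rewrite -/(isum N (fun r => \int[mu]_(x in @half R) cos (2 * pi * r%:~R * x))).
elim: N {Si} => [|N IH]; first by rewrite isum0 Rintegral_cos_half.
by rewrite isumS IH !Rintegral_cos_half oppr_eq0 add0r addr0.
Qed.

Lemma measurable_invr : measurable_fun setT (@GRing.inv R).
Proof.
rewrite (_ : setT = [set 0] `|` [set x : R | x != 0]); last first.
  by apply/seteqP; split=> x // _ /=; have [->|x0] := eqVneq x 0; [left|right].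
apply/measurable_funU; [exact: measurable_set1|exact: open_measurable|split].
  exact: measurable_fun_set1.
apply: open_continuous_measurable_fun => // x; rewrite inE /= => x0.
exact: inv_continuous.
Qed.

End dirichlet.

Section poisson_summation.
Variable R : realType.
Notation mu := (@lebesgue_measure R).
Notation half := (@half R).

Lemma lipschitz_continuous (g : R -> R) K : (forall x y, `|g x - g y| <= K * `|x - y|) ->
  continuous g.
Proof.
move=> gL x; apply/cvgrPdist_lt => e e0.
near=> y.
have : `|x - y| < e / (`|K| + 1).
  near: y; have := @cvg_id _ (nbhs x).
  by move/cvgrPdist_lt; apply; rewrite divr_gt0.
rewrite ltr_pdivlMr// => h; apply: le_lt_trans (gL x y) _.
apply: le_lt_trans h; rewrite mulrC ler_wpM2l// (le_trans (ler_norm _))// lerDl.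
exact: ler01.
Unshelve. all: by end_near. Qed.

(** The indicator of the unit cell centred at [k]; written with [floor], the cells partition the
    line without any discussion of endpoints. *)
Definition cell (k : int) (x : R) : R := (Num.floor (x + 2^-1) == k)%:R.

Lemma cellE k x : cell k x = \1_(`[k%:~R - 2^-1, k%:~R + 2^-1[%classic) x.
Proof.
rewrite /cell indicE floor_eq; congr (_%:R); apply: congr1.
apply/idP/idP; rewrite inE /= in_itv /= intrD => /andP[h1 h2]; apply/andP; split; lra.
Qed.

Lemma bmeas_cell k : bmeas (cell k).
Proof.
split.
  rewrite (_ : cell k = \1_(`[k%:~R - 2^-1, k%:~R + 2^-1[%classic)); last first.
    by apply/funext => x; exact: cellE.
  by apply: measurable_indic; exact: measurable_itv.
by exists 1 => x; rewrite /cell; case: (_ == _); rewrite ?normr1 ?normr0.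
Qed.

Lemma sum_cell (M : nat) (x : R) : `|x| <= M%:R -> isum M (fun k => cell k x) = 1.
Proof.
rewrite ler_norml => /andP[x1 x2].
set f := Num.floor (x + 2^-1).
have f2 : f <= M%:Z.
  rewrite -ltzD1 floor_lt_int intrD /= -pmulrn; lra.
have f1 : - M%:Z <= f.
  rewrite floor_ge_int mulrNz -pmulrn; lra.
have lt : (absz (f + M%:Z)%R < M.*2.+1)%N by lia.
rewrite /isum (bigD1 (Ordinal lt)) //= big1 ?addr0.
  rewrite /cell /= -/f; have /eqP -> // : f = (absz (f + M%:Z)%R)%:Z - M%:Z.
  lia.
move=> i /eqP ij; rewrite /cell -/f; case: eqP => // fi.
by case: ij; apply/val_inj => /=; rewrite fi; lia.
Qed.

Lemma Rintegral_cell0 (f : R -> R) : bmeas f ->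
  \int[mu]_x (f x * cell 0 x) = \int[mu]_(x in half) f x.
Proof.
move=> bf; rewrite -Rintegral_itv_bndo_bndc; last first.
  have := half_integrable bf; apply: integrableS => //; first exact: measurable_half.
  by apply: subset_itv; rewrite bnd_simp.
rewrite [RHS]Rintegral_mkcond; apply: eq_Rintegral => x _.
rewrite cellE patchE sub0r add0r indicE.
by case: ifP; rewrite ?mulr1 ?mulr0.
Qed.

Variables (g : R -> R) (K : R) (M : nat).
Hypothesis gL : forall x y, `|g x - g y| <= K * `|x - y|.
Hypothesis g0 : forall x, M%:R < `|x| -> g x = 0.

Let gc : continuous g. Proof. exact: lipschitz_continuous gL. Qed.

Let K0 : 0 <= K.
Proof.
have := gL 1 0; rewrite subr0 normr1 mulr1; apply: le_trans; exact: normr_ge0.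
Qed.

Lemma bmeas_lipschitz : bmeas g.
Proof.
(* On the support [x] is compared with the point [M + 1], where [g] vanishes and whose distance to
   [x] is at most [2 (M + 1)]. *)
apply: (@continuous_bmeas _ _ (K * (M.+1%:R *+ 2)) gc) => x.
have [h|h] := ltP M%:R `|x|.
  by rewrite g0// normr0 mulr_ge0.
have := gL x M.+1%:R; rewrite (g0 (x := M.+1%:R)) ?subr0; last first.
  by rewrite ger0_norm// ltr_nat.
move=> /le_trans; apply; apply: ler_wpM2l => //.
apply: le_trans (ler_normB _ _) _; rewrite mulr2n lerD// ?normr_nat//.
by rewrite (le_trans h)// ler_nat.
Qed.

Let bgD N (k : int) : bmeas (fun x : R => g (x + k%:~R) * dirichlet N x).
Proof.
apply: bmeasM; last exact: bmeas_dirichlet.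
apply: (@bmeas_comp _ _ _ (fun x : R => x + k%:~R) g); last exact: bmeas_lipschitz.
exact: measurable_funD.
Qed.

(* [g (x + k) - g k = H x * sin (pi * x)] with [H] bounded, and [sin (pi * x)]
   times the Dirichlet kernel is [sin ((2 N + 1) pi x)]. *)
Lemma cvg_dirichlet_shift (k : int) :
  (fun N => \int[mu]_(x in half) (g (x + k%:~R) * dirichlet N x)) @ \oo --> g k%:~R.
Proof.
pose H x := (cell 0 x * (g (x + k%:~R) - g k%:~R)) / sin (pi * x).
have bH : bmeas H.
  split.
    apply: measurable_funM; last first.
      by apply: (measurableT_comp (@measurable_invr R)); exact: (bmeas_sinM pi).1.
    apply: measurable_funM; first exact: (bmeas_cell 0).1.
    apply: measurable_funB => //.
    apply: (measurableT_comp (bmeas_lipschitz).1).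
    exact: measurable_funD.
  exists K => x; rewrite /H /cell floor_eq.
  have [h|_] := boolP (_ <= x + _ < _); last by rewrite !mul0r normr0.
  rewrite mul1r normrM.
  have xh : `|x| <= 2^-1.
    by move: h; rewrite ler_norml => /andP[]; rewrite add0r => h1 h2; apply/andP; split; lra.
  have [->|x0] := eqVneq x 0.
    by rewrite add0r subrr normr0 mul0r.
  have sx := norm_sin_ge xh.
  rewrite normfV ler_pdivrMr; last by rewrite (lt_le_trans _ sx)// normr_gt0.
  apply: le_trans (gL _ _) _; rewrite addrK; exact: ler_wpM2l.
have RL := riemann_lebesgue_sin bH.
have gE : (fun N => \int[mu]_(x in half) (H x * sin (pi * N.*2.+1%:R * x)) + g k%:~R)
    = (fun N => \int[mu]_(x in half) (g (x + k%:~R) * dirichlet N x)).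
  apply/funext => N.
  have bD := half_integrable (bmeas_dirichlet R N).
  transitivity (\int[mu]_(x in half) (H x * sin (pi * N.*2.+1%:R * x)) +
      \int[mu]_(x in half) (g k%:~R * dirichlet N x)).
    congr (_ + _); rewrite RintegralZl ?Rintegral_dirichlet ?mulr1//.
    exact: measurable_half.
  rewrite -RintegralD//; last 3 first.
  - exact: measurable_half.
  - by apply: half_integrable; apply: bmeasM => //; exact: bmeas_sinM.
  - by apply: half_integrable; apply: bmeasZ; exact: bmeas_dirichlet.
  have bg2 : bmeas (fun x => H x * sin (pi * N.*2.+1%:R * x) + g k%:~R * dirichlet N x).
    apply: bmeasD; last by apply: bmeasZ; exact: bmeas_dirichlet.
    by apply: bmeasM => //; exact: bmeas_sinM.
  (* [H] is cut off to the cell around [0], the region where [norm_sin_ge] bounds it; the integrands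
     are therefore compared after multiplication by [cell 0]. *)
  apply: etrans (esym (Rintegral_cell0 bg2)) _.
  apply: etrans _ (Rintegral_cell0 (bgD N k)).
  apply: eq_Rintegral => x _.
  rewrite /H /cell floor_eq add0r.
  have [h|_] := boolP (_ <= x + _ < _); last by rewrite !mulr0.
  rewrite !mulr1 mul1r -dirichlet_sin.
  have [->|x0] := eqVneq x 0.
    by rewrite add0r subrr !mul0r add0r.
  have xh : `|x| <= 2^-1.
    by move: h; rewrite ler_norml => /andP[h1 h2]; apply/andP; split; lra.
  have sx : sin (pi * x) != 0.
    by rewrite -normr_gt0 (lt_le_trans _ (norm_sin_ge xh))// normr_gt0.
  by field.
rewrite -gE -[X in _ --> X]add0r; apply: cvgD => //; exact: cvg_cst.
Qed.

Lemma integrable_compact_support (f : R -> R) : bmeas f ->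
  (forall x, M%:R < `|x| -> f x = 0) -> mu.-integrable setT (EFin \o f).
Proof.
move=> bf f0.
pose D : set R := `[- M%:R, M%:R]%classic.
have mD : measurable D by exact: measurable_itv.
have -> : EFin \o f = ((EFin \o f) \_ D)%E.
  apply/funext => x; rewrite patchE; case: ifPn => //.
  rewrite /D mem_setE in_itv /= -ler_norml -ltNge => xM.
  by rewrite f0.
have [+ _] := @integrable_mkcond _ (measurableTypeR R) R mu D (EFin \o f) mD; apply.
apply: (@bmeas_integrable _ (measurableTypeR R) R mu D f) => //.
by rewrite /D /= lebesgue_measure_itv /=; case: ifP => // _; rewrite -EFinB ltry.
Qed.

(** The line is cut into unit cells and each is translated back to [half]. The Dirichlet kernel has
    period 1, so the cell at [k] contributes the limit [g k] of [cvg_dirichlet_shift]. *)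
Theorem poisson_sum :
  (fun N => \int[mu]_x (g x * dirichlet N x)) @ \oo --> isum M (fun k => g k%:~R).
Proof.
have -> : (fun N => \int[mu]_x (g x * dirichlet N x)) =
    (fun N => isum M (fun k => \int[mu]_(x in half) (g (x + k%:~R) * dirichlet N x))).
  apply/funext => N.
  pose F (i : 'I_M.*2.+1) x := g x * dirichlet N x * cell (i%:Z - M%:Z) x.
  have iF i : mu.-integrable setT (EFin \o F i).
    apply: integrable_compact_support.
      apply: bmeasM; last exact: bmeas_cell.
      by apply: bmeasM; [exact: bmeas_lipschitz|exact: bmeas_dirichlet].
    by move=> x xM; rewrite /F g0// !mul0r.
  transitivity (\int[mu]_x (\sum_(i <- index_enum 'I_M.*2.+1) F i x)).
    apply: eq_Rintegral => x _.
    have [xM|xM] := ltP M%:R `|x|.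
      by rewrite g0// mul0r big1// => i _; rewrite /F g0// !mul0r.
    rewrite -[LHS]mulr1 -(sum_cell xM) /isum mulr_sumr.
    by apply: eq_bigr => i _.
  have [-> _] := @Rintegral_sum _ (measurableTypeR R) R mu _
    (index_enum 'I_M.*2.+1) setT F measurableT iF.
  apply: eq_bigr => i _.
  rewrite (Rintegral_affine1 (i%:Z - M%:Z)%:~R (oner_neq0 R) (iF i)) normr1 mul1r.
  apply: etrans (Rintegral_cell0 (bgD N _)); apply: eq_Rintegral => x _.
  rewrite /F mul1r dirichlet_period; congr (_ * _).
  rewrite /cell addrAC floorDrz ?intr_int// intrKfloor.
  by rewrite -[X in _ == X]add0r (inj_eq (addIr _)).
apply: cvg_big => [|i _]; first exact: add_continuous.
exact: cvg_dirichlet_shift.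
Qed.

End poisson_summation.

(** * The cubic B-spline and its Fourier transform *)

Section bspline.
Variable R : realType.
Notation mu := (@lebesgue_measure R).

Definition bspline (t : R) : R := spline (`|t| / 2).

Let p3 (x : R) : R := Num.max x 0 ^+ 3.

Lemma bsplineN t : bspline (- t) = bspline t.
Proof. by rewrite /bspline normrN. Qed.

Lemma bspline_mid t : 0 <= t -> t <= 1 -> bspline t = 2 / 3 - t ^+ 2 + t ^+ 3 / 2.
Proof. by move=> t0 t1; rewrite /bspline /spline ger0_norm// ifT; [field|lra]. Qed.

Lemma bspline_out t : 1 <= t -> t <= 2 -> bspline t = (2 - t) ^+ 3 / 6.
Proof.
move=> t1 t2; rewrite /bspline /spline ger0_norm; last lra.
have [->|tn1] := eqVneq t 1; first by rewrite ifT; [field|lra].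
by rewrite ifF ?ifT; [field|lra|apply/negbTE; rewrite -ltNge; move: tn1; rewrite neq_lt => /orP[]; lra].
Qed.

Lemma bspline0 t : 2 <= `|t| -> bspline t = 0.
Proof.
move=> t2; rewrite /bspline /spline ifF; last by apply/negbTE; rewrite -ltNge; lra.
case: ifPn => // h; have -> : `|t| = 2 by lra.
by rewrite divff// subrr expr0n mulr0.
Qed.

(** Evenness reduces to [t >= 0]. The pieces overlap at the knots, so only weak inequalities have to
    be handled. *)
Lemma bspline_ind (P : R -> Prop) : (forall t, P t -> P (- t)) ->
  (forall t, 0 <= t -> t <= 1 -> P t) -> (forall t, 1 <= t -> t <= 2 -> P t) ->
  (forall t, 2 <= t -> P t) -> forall t, P t.
Proof.
move=> PN P1 P2 P3.
have Pp t : 0 <= t -> P t.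
  move=> t0; have [t1|/ltW t1] := leP t 1; first exact: P1.
  by have [t2|/ltW t2] := leP t 2; [exact: P2|exact: P3].
move=> t; have [t0|/ltW t0] := leP 0 t; first exact: Pp.
by rewrite -[t]opprK; apply: PN; apply: Pp; rewrite oppr_ge0.
Qed.

Lemma bspline_ge0 t : 0 <= bspline t.
Proof.
elim/bspline_ind: t => [t|t t0 t1|t t1 t2|t t2]; first by rewrite bsplineN.
- by rewrite bspline_mid//; nra.
- by rewrite bspline_out// divr_ge0// exprn_ge0//; lra.
- by rewrite bspline0 ?normr0// ger0_norm//; lra.
Qed.

Lemma bspline_le1 t : `|bspline t| <= 1.
Proof.
elim/bspline_ind: t => [t|t t0 t1|t t1 t2|t t2]; first by rewrite bsplineN.
- rewrite bspline_mid// ler_norml; apply/andP; split; nra.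
- rewrite bspline_out// ler_norml.
  have : 0 <= (2 - t) ^+ 3 by apply: exprn_ge0; lra.
  have : (2 - t) ^+ 3 <= 1 by apply: exprn_ile1; lra.
  move=> h1 h2; apply/andP; split; lra.
- by rewrite bspline0 ?normr0// ger0_norm//; lra.
Qed.

(** The spline as a fourth difference of truncated cubes. Estimates that compare two or three points
    then concern the single function [p3], and no case analysis over pairs of pieces arises. *)
Lemma bspline_p3 t : bspline t =
  (p3 (t + 2) - 4 * p3 (t + 1) + 6 * p3 t - 4 * p3 (t - 1) + p3 (t - 2)) / 6.
Proof.
have pp x : 0 <= x -> p3 x = x ^+ 3 by move=> x0; rewrite /p3 max_l.
have pn x : x <= 0 -> p3 x = 0 by move=> x0; rewrite /p3 max_r// expr0n.
have [t2|/ltW t2] := leP t (-2).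
  rewrite bspline0; last by rewrite ler0_norm; lra.
  rewrite !pn; lra.
have [t1|/ltW t1] := leP t (-1).
  rewrite -bsplineN bspline_out; [|lra|lra].
  rewrite (pp (t + 2)) ?(pn (t + 1)) ?(pn t) ?(pn (t - 1)) ?(pn (t - 2)); try lra.
have [t0|/ltW t0] := leP t 0.
  rewrite -bsplineN bspline_mid; [|lra|lra].
  rewrite (pp (t + 2)) ?(pp (t + 1)) ?(pn t) ?(pn (t - 1)) ?(pn (t - 2)); try lra.
have [u1|/ltW u1] := leP t 1.
  rewrite bspline_mid; [|lra|lra].
  rewrite (pp (t + 2)) ?(pp (t + 1)) ?(pp t) ?(pn (t - 1)) ?(pn (t - 2)); try lra.
have [u2|/ltW u2] := leP t 2.
  rewrite bspline_out; [|lra|lra].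
  rewrite (pp (t + 2)) ?(pp (t + 1)) ?(pp t) ?(pp (t - 1)) ?(pn (t - 2)); try lra.
rewrite bspline0; last by rewrite ger0_norm; lra.
rewrite !pp; lra.
Qed.

Let offs : seq R := [:: 2; 1; 0; -1; -2].

Let offs_bnd c : c \in offs -> -2 <= c /\ c <= 2.
Proof.
by rewrite !inE => /or4P[/eqP->|/eqP->|/eqP->|/orP[]/eqP->]; split; lra.
Qed.

Let offs_in : [/\ 2 \in offs, 1 \in offs, 0 \in offs, -1 \in offs & -2 \in offs].
Proof. by split; rewrite !inE eqxx ?orbT. Qed.

(** [75 = 3 * 5 ^ 2] bounds the derivative on [[-5, 5]]. *)
Let p3_lip x y : `|x| <= 5 -> `|y| <= 5 -> `|p3 x - p3 y| <= 75 * `|x - y|.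
Proof.
wlog xy : x y / y <= x.
  by move=> W hx hy; have [/W->//|/ltW/W h] := leP y x; rewrite (distrC (p3 x)) (distrC x) h.
move=> + + ; rewrite ler_norml => /andP[x1 x2]; rewrite ler_norml => /andP[y1 y2].
rewrite (_ : `|x - y| = x - y); last by rewrite ger0_norm ?subr_ge0.
pose a := Num.max x 0; pose b := Num.max y 0.
have b0 : 0 <= b by rewrite le_max lexx orbT.
have ba : b <= a by rewrite /a /b ge_max !le_max xy lexx /= orbT.
have a5 : a <= 5 by rewrite ge_max x2; lra.
have abx : a - b <= x - y.
  by rewrite /a /b; case: (leP x 0); case: (leP y 0) => *; lra.
rewrite /p3 -/a -/b.
have -> : a ^+ 3 - b ^+ 3 = (a - b) * (a ^+ 2 + a * b + b ^+ 2) by ring.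
rewrite ger0_norm; last by apply: mulr_ge0; nra.
rewrite mulrC; apply: ler_pM => //; nra.
Qed.

(** The coefficients in [bspline_p3] have absolute sum 16, and [16 * 75 / 6 = 200]. Truncated cubes
    are Lipschitz only on bounded sets; if one point lies beyond 3, either both values vanish or the
    points are more than 1 apart. *)
Lemma bspline_lip x y : `|bspline x - bspline y| <= 200 * `|x - y|.
Proof.
have far u v : 3 < `|u| -> `|bspline u - bspline v| <= 200 * `|u - v|.
  move=> u3; rewrite bspline0 ?sub0r ?normrN; last lra.
  have [v2|v2] := leP 2 `|v|; first by rewrite bspline0// normr0 mulr_ge0.
  have := bspline_le1 v; have := lerB_dist u v; lra.
have [x3|x3] := leP `|x| 3; last exact: far.
have [y3|y3] := leP `|y| 3; last by rewrite (distrC (bspline x)) (distrC x); exact: far.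
rewrite !bspline_p3.
have L c : `|c| <= 2 -> `|p3 (x + c) - p3 (y + c)| <= 75 * `|x - y|.
  move=> c2; have -> : x - y = (x + c) - (y + c) by ring.
  apply: p3_lip; have := ler_normD x c; have := ler_normD y c; lra.
have L2 c : c \in offs -> `|p3 (x + c) - p3 (y + c)| <= 75 * `|x - y|.
  by move=> /offs_bnd[c1 c2]; apply: L; rewrite ler_norml c1.
have [i1 i2 i3 i4 i5] := offs_in.
move: (L2 _ i1) (L2 _ i2) (L2 _ i3) (L2 _ i4) (L2 _ i5).
rewrite !addr0 !ler_norml; clear.
move: (p3 (x + 2)) (p3 (x + 1)) (p3 x) (p3 (x - 1)) (p3 (x - 2)) (p3 (y + 2))
  (p3 (y + 1)) (p3 y) (p3 (y - 1)) (p3 (y - 2)) `|x - y| => *.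
apply/andP; split; lra.
Qed.

(** The second derivative is at most [6 (|y| + s)] between [y - s] and [y + s]. The four cases are
    the positions of the kink at [0] among [y - s], [y] and [y + s]. *)
Let p3_diff2 y s : 0 <= s -> `|p3 (y + s) + p3 (y - s) - 2 * p3 y| <= 6 * (`|y| + s) * s ^+ 2.
Proof.
move=> s0.
have pp x : 0 <= x -> p3 x = x ^+ 3 by move=> x0; rewrite /p3 max_l.
have pn x : x <= 0 -> p3 x = 0 by move=> x0; rewrite /p3 max_r// expr0n.
have [y1|/ltW y1] := leP y (- s).
  rewrite !pn ?mulr0 ?addr0 ?subr0 ?normr0; try lra.
  by rewrite !mulr_ge0// addr_ge0.
have [y2|/ltW y2] := leP s y.
  rewrite !pp; try lra.
  rewrite (_ : _ - _ = 6 * y * s ^+ 2); last by ring.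
  rewrite (ger0_norm (_ : 0 <= y)); last lra.
  rewrite ger0_norm; last by rewrite !mulr_ge0//; lra.
  by rewrite ler_wpM2r ?sqr_ge0//; lra.
have [y0|/ltW y0] := leP y 0.
  rewrite (pp (y + s)) ?(pn y) ?(pn (y - s)) ?mulr0 ?addr0 ?subr0; try lra.
  rewrite ger0_norm; last by apply: exprn_ge0; lra.
  rewrite ler0_norm//.
  have -> : (y + s) ^+ 3 = (y + s) * (y + s) ^+ 2 by ring.
  apply: ler_pM; [lra|exact: sqr_ge0|lra|].
  by rewrite ler_pXn2r ?nnegrE//; lra.
rewrite (pp (y + s)) ?(pp y) ?(pn (y - s)) ?addr0; try lra.
rewrite ger0_norm; last first.
  have : 0 <= s ^+ 3 by exact: exprn_ge0.
  have -> : (y + s) ^+ 3 - 2 * y ^+ 3 = s ^+ 3 + 3 * s ^+ 2 * y + y ^+ 2 * (3 * s - y) by ring.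
  have : 0 <= y ^+ 2 * (3 * s - y) by rewrite mulr_ge0// ?sqr_ge0//; lra.
  have : 0 <= s ^+ 2 * y by rewrite mulr_ge0// sqr_ge0.
  lra.
rewrite ger0_norm//.
have : 0 <= y ^+ 3 by exact: exprn_ge0.
have : (y + s) ^+ 3 <= 6 * (y + s) * s ^+ 2.
  have -> : (y + s) ^+ 3 = (y + s) * (y + s) ^+ 2 by ring.
  rewrite mulrAC [X in _ <= X]mulrC; apply: ler_wpM2l; first lra.
  nra.
lra.
Qed.

(** This quadratic order is what makes second differences integrable against a singular kernel. For
    [|x| < 3] and [s < 1] each truncated cube costs [6 * 6 * s ^ 2], in total [36 * 16 / 6 = 96];
    for [s >= 1] boundedness is enough, and in the remaining case all three values vanish. *)
Lemma bspline_diff2 x s :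
  `|bspline (x + s) + bspline (x - s) - 2 * bspline x| <= 200 * s ^+ 2.
Proof.
wlog s0 : s / 0 <= s.
  move=> W; have [/W//|/ltW s0] := leP 0 s.
  have := W (- s); rewrite opprK sqrrN (addrC (bspline (x - s))); apply.
  by rewrite oppr_ge0.
have [s1|s1] := leP 1 s.
  have := bspline_le1 (x + s); have := bspline_le1 (x - s); have := bspline_le1 x.
  rewrite !ler_norml => /andP[a1 a2] /andP[b1 b2] /andP[c1 c2].
  by apply/andP; split; nra.
have [x3|x3] := leP 3 `|x|.
  have := lerB_dist x s; have := lerB_dist x (- s); rewrite opprK normrN (ger0_norm s0) => h1 h2.
  by rewrite !bspline0 ?mulr0 ?addr0 ?subr0 ?normr0 ?mulr_ge0 ?sqr_ge0//; lra.
rewrite !bspline_p3.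
have L c : c \in offs ->
    `|p3 (x + s + c) + p3 (x - s + c) - 2 * p3 (x + c)| <= 36 * s ^+ 2.
  move=> /offs_bnd[c1 c2]; rewrite (addrAC x s) (addrAC x (- s)).
  apply: le_trans (p3_diff2 _ s0) _; apply: ler_wpM2r; first exact: sqr_ge0.
  have : `|c| <= 2 by rewrite ler_norml c1.
  have := ler_normD x c; lra.
have [i1 i2 i3 i4 i5] := offs_in.
move: (L _ i1) (L _ i2) (L _ i3) (L _ i4) (L _ i5).
rewrite !addr0 !ler_norml; clear.
move: (p3 (x + s + 2)) (p3 (x + s + 1)) (p3 (x + s)) (p3 (x + s - 1)) (p3 (x + s - 2))
  (p3 (x - s + 2)) (p3 (x - s + 1)) (p3 (x - s)) (p3 (x - s - 1)) (p3 (x - s - 2))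
  (p3 (x + 2)) (p3 (x + 1)) (p3 x) (p3 (x - 1)) (p3 (x - 2)) (s ^+ 2) => *.
apply/andP; split; lra.
Qed.

End bspline.

Section bspline_transform.
Variable R : realType.
Notation mu := (@lebesgue_measure R).
Notation bs := (@bspline R).

Lemma bmeas_bspline : bmeas bs.
Proof.
apply: (@bmeas_lipschitz _ _ 200 2%N (@bspline_lip R)) => x x2.
by rewrite bspline0// ltW.
Qed.

Lemma integrable_bsplineM (f : R -> R) : bmeas f ->
  mu.-integrable setT (EFin \o (fun x => bs x * f x)).
Proof.
move=> bf; apply: (@integrable_compact_support _ 2%N).
  by apply: bmeasM => //; exact: bmeas_bspline.
by move=> x x2; rewrite bspline0 ?mul0r// ltW.
Qed.

Lemma Rintegral_itv_cat (f : R -> R) a b c : a <= b -> b <= c -> bmeas f ->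
  \int[mu]_(x in `[a, c]) f x =
    \int[mu]_(x in `[a, b]) f x + \int[mu]_(x in `[b, c]) f x.
Proof.
move=> ab bc bf.
have fi u v : mu.-integrable `[u, v] (EFin \o f).
  apply: (@bmeas_integrable _ (measurableTypeR R) R mu `[u, v]%classic f) => //.
  by rewrite /= lebesgue_measure_itv /=; case: ifP => // _; rewrite -EFinB ltry.
rewrite -(Rintegral_itv_obnd_cbnd (r := b)); last first.
  apply: integrableS (fi b c) => //; exact: subset_itv_oc_cc.
rewrite -(Rintegral_itvB (fi a c) (x := b)) ?bnd_simp//.
by rewrite addrC subrK.
Qed.

Lemma is_derive_continuous (f : R -> R) (x df : R) : is_derive x 1 f df ->
  {for x, continuous f}.
Proof.
by move=> [dfx _]; apply: differentiable_continuous; exact/derivable1_diffP.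
Qed.

(** [F] comes from integrating by parts until the cubic is exhausted: each derivative of the cubic
    meets the next antiderivative of the cosine. *)
Lemma Rintegral_cubic_cos (a0 a1 a2 a3 w lo hi : R) : lo < hi -> w != 0 ->
  let F x := (a0 + a1 * x + a2 * x ^+ 2 + a3 * x ^+ 3) * (sin (w * x) / w)
   + (a1 + 2 * a2 * x + 3 * a3 * x ^+ 2) * (cos (w * x) / w ^+ 2)
   - (2 * a2 + 6 * a3 * x) * (sin (w * x) / w ^+ 3)
   - 6 * a3 * (cos (w * x) / w ^+ 4) in
  \int[mu]_(x in `[lo, hi]) ((a0 + a1 * x + a2 * x ^+ 2 + a3 * x ^+ 3) * cos (w * x))
  = F hi - F lo.
Proof.
move=> lohi w0 F.
apply: FTC_R => //.
- move=> x; rewrite /F; apply: is_derive_eq; rewrite /GRing.scale /=.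
  by field.
- by move=> x; apply: is_derive_continuous.
Qed.

(** The zero frequency, where the previous [F] would divide by zero. The factor [cos (0 * x)] is
    kept so that both lemmas rewrite the same integrals. *)
Lemma Rintegral_cubic (a0 a1 a2 a3 lo hi : R) : lo < hi ->
  let F x := a0 * x + a1 / 2 * x ^+ 2 + a2 / 3 * x ^+ 3 + a3 / 4 * x ^+ 4 in
  \int[mu]_(x in `[lo, hi]) ((a0 + a1 * x + a2 * x ^+ 2 + a3 * x ^+ 3) * cos (0 * x))
  = F hi - F lo.
Proof.
move=> lohi F; under eq_Rintegral do rewrite mul0r cos0 mulr1.
apply: FTC_R => //.
- move=> x; rewrite /F; apply: is_derive_eq; rewrite /GRing.scale /=.
  by field.
- by move=> x; apply: is_derive_continuous.
Qed.

Definition sinc4 (w : R) : R := if w == 0 then 1 else (2 * sin (w / 2) / w) ^+ 4.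

(** Each piece is spelled out as a full cubic, zero and unit coefficients included, to match the
    shape expected by [Rintegral_cubic_cos]. *)
Lemma Rintegral_bspline_split (f : R -> R) : bmeas f ->
  \int[mu]_x (bs x * f x) =
  \int[mu]_(x in `[- 2, - 1]) ((8 / 6 + 2 * x + 1 * x ^+ 2 + 1 / 6 * x ^+ 3) * f x)
  + (\int[mu]_(x in `[- 1, 0]) ((2 / 3 + 0 * x + -1 * x ^+ 2 + - (1 / 2) * x ^+ 3) * f x)
  + (\int[mu]_(x in `[0, 1]) ((2 / 3 + 0 * x + -1 * x ^+ 2 + 1 / 2 * x ^+ 3) * f x)
  + \int[mu]_(x in `[1, 2]) ((8 / 6 + -2 * x + 1 * x ^+ 2 + - (1 / 6) * x ^+ 3) * f x))).
Proof.
move=> bf.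
have -> : \int[mu]_x (bs x * f x) = \int[mu]_(x in `[- 2, 2]) (bs x * f x).
  rewrite [RHS]Rintegral_mkcond; apply: eq_Rintegral => x _.
  rewrite patchE; case: ifPn => //.
  rewrite mem_setE in_itv /= -ler_norml -ltNge => x2.
  by rewrite bspline0 ?mul0r// ltW.
have bb : bmeas (fun x => bs x * f x) by apply: bmeasM => //; exact: bmeas_bspline.
have l1 : - 2 <= - 1 :> R by lra.
have l2 : - 1 <= 0 :> R by lra.
have l3 : 0 <= 1 :> R by lra.
have l4 : 1 <= 2 :> R by lra.
rewrite (Rintegral_itv_cat l1 (le_trans l2 (le_trans l3 l4)) bb).
rewrite (Rintegral_itv_cat l2 (le_trans l3 l4) bb) (Rintegral_itv_cat l3 l4 bb).
congr (_ + (_ + (_ + _))); apply: eq_Rintegral => x; rewrite inE /= in_itv/= => /andP[x1 x2];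
  congr (_ * _).
- by rewrite -bsplineN bspline_out; [field|lra|lra].
- by rewrite -bsplineN bspline_mid; [field|lra|lra].
- by rewrite bspline_mid; [field|lra|lra].
- by rewrite bspline_out; [field|lra|lra].
Qed.

Lemma sin_double (x : R) : sin (x * 2) = 2 * sin x * cos x.
Proof. by rewrite mulr_natr sin_mulr2n -[LHS]mulr_natr; ring. Qed.

Lemma cos_double (x : R) : cos (x * 2) = 2 * cos x ^+ 2 - 1.
Proof.
by rewrite mulr_natr cos_mulr2n -[_ *+ 2]mulr_natr; ring.
Qed.

Lemma bspline_cos w : \int[mu]_x (bs x * cos (w * x)) = sinc4 w.
Proof.
have bc : bmeas (fun x : R => cos (w * x)).
  by under eq_fun do rewrite -[_ * _]addr0; exact: bmeas_cosM.
rewrite (Rintegral_bspline_split bc) /sinc4.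
have [->|w0] := eqVneq w 0.
  rewrite !Rintegral_cubic; try lra.
rewrite !Rintegral_cubic_cos//; try lra.
rewrite !mulr0 !mulr1 !mulrN !mulr1 sin0 cos0 !sinN !cosN.
rewrite sin_double cos_double.
(* As the spline is twice continuously differentiable, only the boundary terms in [w ^ -4] survive;
   the jumps 1, -4, 6, -4, 1 of the third derivative add up to this square. *)
have E : (2 * sin (w / 2) / w) ^+ 4 = 4 * (1 - cos w) ^+ 2 / w ^+ 4.
  have -> : cos w = 1 - 2 * sin (w / 2) ^+ 2.
    rewrite {1}(_ : w = (w / 2) * 2); last by field.
    by rewrite cos_double cos2sin2; ring.
  by field.
rewrite E; by field.
Qed.

Lemma bspline_sin w : \int[mu]_x (bs x * sin (w * x)) = 0.
Proof.
have := Rintegral_affine1 0 (_ : -1 != 0) (integrable_bsplineM (bmeas_sinM w)).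
rewrite oppr_eq0 oner_eq0 normrN normr1 mul1r => /(_ isT).
under [in RHS]eq_Rintegral do rewrite mulN1r addr0 bsplineN mulrN sinN mulrN -mulN1r.
rewrite RintegralZl//; last exact: (integrable_bsplineM (bmeas_sinM w)).
move=> h; lra.
Qed.

(** After the reflection [x -> t - x], the sine part vanishes because the spline is even. *)
Lemma bspline_transform w p t :
  \int[mu]_x (bs (t - x) * cos (w * x + p)) = sinc4 w * cos (w * t + p).
Proof.
have bc q : bmeas (fun x : R => cos (w * x + q)) by exact: bmeas_cosM.
have := Rintegral_affine1 t (_ : -1 != 0) (integrable_bsplineM (bc (- (w * t + p)))).
rewrite oppr_eq0 oner_eq0 normrN normr1 mul1r => /(_ isT).
under [in RHS]eq_Rintegral => x _.
  rewrite mulN1r (addrC (- x)) mulrBr [_ + - (_ + p)](_ : _ = - (w * x + p)); last by ring.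
  rewrite cosN; over.
move=> <-.
set q := w * t + p.
rewrite (_ : (fun x => bs x * cos (w * x + - q)) =
   (fun x => cos q * (bs x * cos (w * x)) + sin q * (bs x * sin (w * x)))); last first.
  by apply/funext => x; rewrite cosB; ring.
have i1 : mu.-integrable setT (EFin \o (fun x => bs x * cos (w * x))).
  apply: integrable_bsplineM.
  by under eq_fun do rewrite -[_ * _]addr0; exact: bmeas_cosM.
have i2 := integrable_bsplineM (bmeas_sinM w).
have iZ (c : R) (f : R -> R) : mu.-integrable setT (EFin \o f) -> mu.-integrable setT (EFin \o (fun x => c * f x)).
  by move=> fi; exact: (integrableZl (measurableT : measurable (setT : set (measurableTypeR R))) c fi).
apply: etrans (RintegralD (measurableT : measurable (setT : set (measurableTypeR R)))
  (iZ (cos q) _ i1) (iZ (sin q) _ i2)) _.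
have -> : \int[mu]_x (cos q * (bs x * cos (w * x))) = cos q * sinc4 w.
  by rewrite -bspline_cos; exact: (RintegralZl _ (measurableT : measurable (setT : set (measurableTypeR R))) i1).
have -> : \int[mu]_x (sin q * (bs x * sin (w * x))) = sin q * 0.
  by rewrite -(bspline_sin w); exact: (RintegralZl _ (measurableT : measurable (setT : set (measurableTypeR R))) i2).
by rewrite mulr0 addr0 mulrC.
Qed.

End bspline_transform.

(** * Poisson summation for the spline, and bounds for its transform *)

Section bspline_poisson.
Variable R : realType.
Notation mu := (@lebesgue_measure R).
Notation bs := (@bspline R).

Lemma sin_lip (a b : R) : `|sin a - sin b| <= `|a - b|.
Proof.
wlog ab : a b / b <= a.
  by move=> W; have [/W//|/ltW/W] := leP b a; rewrite distrC (distrC b).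
have [|c _ ->] := @MVT_segment R sin cos b a ab (fun x _ => is_derive_sin x).
  exact/continuous_subspaceT/continuous_sin.
by rewrite normrM ler_piMl// cos_max.
Qed.

Lemma cos_lip (a b : R) : `|cos a - cos b| <= `|a - b|.
Proof.
rewrite -!sinDpihalf (le_trans (sin_lip _ _))//.
by rewrite opprD addrACA subrr addr0.
Qed.

Lemma norm_sin_le (a : R) : `|sin a| <= `|a|.
Proof. by have := sin_lip a 0; rewrite sin0 !subr0. Qed.

Definition wave (xi : R) (r : int) : R := xi + 2 * pi * r%:~R.

(** Poisson summation for [bs (t - x) * cos (xi * x + p)], supported in [|x| <= |t| + 2].
    Multiplication by the Dirichlet kernel only moves the frequency to [xi + 2 pi r], the sine terms
    being odd in [r], and [bspline_transform] evaluates the integrals. *)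
Lemma bspline_poisson (t xi p : R) (M : nat) : `|t| + 2 <= M%:R ->
  (fun N => isum N (fun r => sinc4 (wave xi r) * cos (wave xi r * t + p))) @ \oo
  --> isum M (fun k => bs (t - k%:~R) * cos (xi * k%:~R + p)).
Proof.
move=> tM.
pose g x := bs (t - x) * cos (xi * x + p).
have gL x y : `|g x - g y| <= (200 + `|xi|) * `|x - y|.
  have -> : g x - g y = (bs (t - x) - bs (t - y)) * cos (xi * x + p) +
      bs (t - y) * (cos (xi * x + p) - cos (xi * y + p)) by rewrite /g; ring.
  apply: le_trans (ler_normD _ _) _; rewrite (mulrDl 200) lerD// normrM.
    rewrite (le_trans (ler_piMr _ (cos_max _)))// (le_trans (bspline_lip _ _))//.
    by rewrite (_ : t - x - (t - y) = y - x) 1?distrC//; ring.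
  rewrite (le_trans (ler_piMl _ (bspline_le1 _)))// (le_trans (cos_lip _ _))//.
  by rewrite (_ : xi * x + p - (xi * y + p) = xi * (x - y)) ?normrM//; ring.
have g0 x : M%:R < `|x| -> g x = 0.
  move=> Mx; rewrite /g bspline0 ?mul0r//.
  have := lerB_dist x t; rewrite distrC; lra.
have := poisson_sum gL g0.
rewrite (_ : (fun N => \int[mu]_x (g x * dirichlet N x)) =
  (fun N => isum N (fun r => sinc4 (wave xi r) * cos (wave xi r * t + p)))) //.
apply/funext => N.
pose F (i : 'I_N.*2.+1) x := bs (t - x) * cos (wave xi (i%:Z - N%:Z) * x + p).
transitivity (\int[mu]_x (\sum_(i <- index_enum 'I_N.*2.+1) F i x)).
  apply: eq_Rintegral => x _; rewrite -mulr_sumr /g -mulrA; congr (_ * _).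
  rewrite -/(isum N (fun r => cos (wave xi r * x + p))).
  have -> : isum N (fun r => cos (wave xi r * x + p)) =
    isum N (fun r => cos (xi * x + p) * cos (2 * pi * r%:~R * x) +
       - (sin (xi * x + p) * sin (2 * pi * r%:~R * x))).
    apply: eq_isum => r _; rewrite -cosD /wave; congr cos; ring.
  have od : isum N (fun r => - (sin (xi * x + p) * sin (2 * pi * r%:~R * x))) = 0.
    by apply: isum_odd => r; rewrite mulrNz mulrN mulNr sinN mulrN.
  rewrite isumD od addr0.
  by rewrite /isum mulr_sumr.
have iF i : mu.-integrable setT (EFin \o F i).
  have := integrable_affine1 t (_ : -1 != 0)
    (integrable_bsplineM (bmeas_cosM (- wave xi (i%:Z - N%:Z)) (wave xi (i%:Z - N%:Z) * t + p))).
  rewrite oppr_eq0 oner_eq0 => /(_ isT).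
  congr (integrable _ _ (EFin \o _)); apply/funext => x.
  rewrite /F mulN1r addrC; congr (_ * cos _); ring.
have [-> _] := @Rintegral_sum _ (measurableTypeR R) R mu _
    (index_enum 'I_N.*2.+1) setT F measurableT iF.
by apply: eq_bigr => i _; rewrite /F bspline_transform.
Qed.

Lemma sinc4_ge0 (w : R) : 0 <= sinc4 w.
Proof.
by rewrite /sinc4; case: ifP => // _; apply: exprn_even_ge0.
Qed.

Lemma norm_expr4 (x : R) : x ^+ 4 = `|x| ^+ 4.
Proof. by rewrite -normrX ger0_norm// exprn_even_ge0. Qed.

Lemma sinc4_le1 (w : R) : sinc4 w <= 1.
Proof.
rewrite /sinc4; case: ifPn => // w0; rewrite norm_expr4 exprn_ile1//.
rewrite normrM normfV ler_pdivrMr ?normr_gt0// mul1r normrM normr_nat.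
by have := norm_sin_le (w / 2); rewrite normrM normfV normr_nat; lra.
Qed.

Lemma sinc4_decay (w : R) : w != 0 -> sinc4 w <= 16 / w ^+ 4.
Proof.
move=> w0; rewrite /sinc4 (negbTE w0) exprMn exprVn ler_pM2r; last first.
  by rewrite invr_gt0 exprn_even_gt0.
rewrite exprMn (norm_expr4 (sin _)).
have : `|sin (w / 2)| ^+ 4 <= 1 by rewrite exprn_ile1// sin_max.
by move=> h; lra.
Qed.

(** Replacing [xi] by [xi + 2 pi r] changes [sin (xi / 2)] at most in sign, and the fourth power is
    a function of [cos xi]. Inside the cube the denominator vanishes only for [xi = 0] and [r = 0],
    where both conventions give 1. *)
Lemma sin_quotE (xi : R) (r : int) : - pi < xi < pi ->
  (2 * sin_quot xi r) ^+ 4 = sinc4 (wave xi r).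
Proof.
move=> /andP[x1 x2]; rewrite /sin_quot /sinc4 -/(wave xi r).
have pi0 := pi_gt0 R.
case: ifPn => [/eqP w0|w0].
  have r0 : r = 0.
    apply/eqP; rewrite -normr_le0 -ltzD1 add0r -(ltr_int R) intr_norm.
    have : `|2 * pi * r%:~R| < pi :> R.
      have -> : 2 * pi * r%:~R = - xi by move: w0; rewrite /wave; lra.
      by rewrite normrN ltr_norml x1.
    rewrite normrM (gtr0_norm (_ : 0 < 2 * pi)); last lra.
    by move=> h; rewrite -(ltr_pM2l pi0); have := normr_ge0 (r%:~R : R); nra.
  have -> : xi = 0 by move: w0; rewrite /wave r0 mulr0 addr0.
  by rewrite mul0r cos0 mulrC divfK// expr1n.
rewrite mulrA !exprMn; congr (_ * _ * _).
have sq (z : R) : sin z ^+ 4 = ((1 - cos (z * 2)) / 2) ^+ 2.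
  by rewrite cos_double cos2sin2; field.
by rewrite !sq !divfK// /wave cos_period.
Qed.

Lemma wave_ge (xi : R) (r : int) : - pi < xi < pi -> r != 0 ->
  2 * `|r|%:~R <= `|wave xi r|.
Proof.
move=> /andP[x1 x2] r0; have pi2 := pi_ge2 R.
have r1 : 1 <= `|r|%:~R :> R by rewrite (ler_int R 1); lia.
have := lerB_dist (2 * pi * r%:~R) (- xi).
rewrite opprK normrN (addrC _ xi) -/(wave xi r).
have : `|xi| < pi by rewrite ltr_norml x1.
rewrite normrM (gtr0_norm (_ : 0 < 2 * pi)); last lra.
(* For [n = |r| >= 1] this yields [2 pi n - pi >= 4 n - 2 >= 2 n]. *)
rewrite -intr_norm; have : 0 <= (pi - 2) * (2 * `|r|%:~R - 1) :> R.
  by apply: mulr_ge0; lra.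
lra.
Qed.

(** The weight [1 + w ^ 2] anticipates the quadratic growth of the symbol. The term [r = 0] is at
    most [1 + 4 ^ 2 = 17], the pair [n], [-n] at most [16 / n ^ 2], and the sum of the [1 / n ^ 2]
    is at most 2, whence [17 + 32]. *)
Lemma isum_wave_bound (xi : R) N : - pi < xi < pi ->
  isum N (fun r => (1 + wave xi r ^+ 2) * sinc4 (wave xi r)) <= 49.
Proof.
move=> xip; have /andP[x1 x2] := xip.
have pi4 : (pi : R) < 4 by have := pihalf_lt2 R; lra.
pose a r := (1 + wave xi r ^+ 2) * sinc4 (wave xi r).
suff : isum N a <= 17 + 16 * (2 - (N%:R + 2^-1)^-1).
  move=> /le_trans; apply.
  have : 0 <= 16 * (N%:R + 2^-1)^-1 :> R by rewrite mulr_ge0// invr_ge0 addr_ge0.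
  lra.
have ar r : r != 0 -> a r <= 8 / (`|r|%:~R) ^+ 2.
  move=> r0; have wr := wave_ge xip r0.
  have r1 : 1 <= `|r|%:~R :> R by rewrite (ler_int R 1); lia.
  have w0 : wave xi r != 0 by rewrite -normr_gt0; lra.
  set w := wave xi r in wr w0 *; set n := `|r|%:~R in wr r1 *.
  have w2 : 4 * n ^+ 2 <= w ^+ 2.
    rewrite -(real_normK (num_real w)); nra.
  have n1 : 1 <= n ^+ 2 by rewrite exprn_ege1.
  rewrite /a -/w; apply: (@le_trans _ _ ((1 + w ^+ 2) * (16 / w ^+ 4))).
    by apply: ler_wpM2l; [rewrite addr_ge0// sqr_ge0|exact: sinc4_decay].
  have -> : (1 + w ^+ 2) * (16 / w ^+ 4) = 16 * (1 + w ^+ 2) / (w ^+ 2) ^+ 2.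
    by field.
  rewrite ler_pdivrMr; last by rewrite exprn_gt0//; lra.
  rewrite mulrAC ler_pdivlMr; last lra.
  nra.
elim: N => [|N IH].
  rewrite isum0 /a /wave mulr0z mulr0 addr0 add0r invrK subrr mulr0 addr0.
  rewrite -[X in _ <= X]mulr1; apply: ler_pM => //; [by rewrite addr_ge0// sqr_ge0|exact: sinc4_ge0| |exact: sinc4_le1].
  nra.
rewrite isumS.
have h1 := ar (- N.+1%:Z) isT; have h2 := ar N.+1%:Z isT.
rewrite normrN in h1.
(* The inverse of [(N + 1) ^ 2 - 1 / 4] telescopes and dominates that of [(N + 1) ^ 2]. *)
have step : ((N%:R + 1) ^+ 2)^-1 <= (N%:R + 2^-1)^-1 - (N.+1%:R + 2^-1)^-1 :> R.
  have N0 : 0 <= N%:R :> R by exact: ler0n.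
  rewrite -[N.+1%:R]natr1 -(_ : ((N%:R + 1) ^+ 2 - 4^-1)^-1 = (N%:R + 2^-1)^-1 - (N%:R + 1 + 2^-1)^-1 :> R); last first.
    field; apply/andP; split; [|apply/andP; split]; apply/eqP; nra.
  rewrite lef_pV2 ?posrE; [lra| |]; nra.
have e : `|N.+1%:Z|%:~R = N%:R + 1 :> R by rewrite ger0_norm// natr1.
rewrite e in h1 h2.
lra.
Qed.

End bspline_poisson.

(** * Euclidean space and the nonlocal operator *)

Section euclidean.
Variables (R : realType) (d : nat).
Implicit Types (x s t : 'rV[R]_d).

Lemma dot_ge0 s : 0 <= dot s s.
Proof. by apply: sumr_ge0 => j _; rewrite -expr2 sqr_ge0. Qed.

Lemma enorm_ge0 s : 0 <= enorm s. Proof. exact: sqrtr_ge0. Qed.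

Lemma enorm_sqr s : enorm s ^+ 2 = dot s s.
Proof. by rewrite /enorm sqr_sqrtr// dot_ge0. Qed.

Lemma dotZ a b s t : dot (a *: s) (b *: t) = a * b * dot s t.
Proof. by rewrite /dot mulr_sumr; apply: eq_bigr => j _; rewrite !mxE; ring. Qed.

Lemma enormZ a s : enorm (a *: s) = `|a| * enorm s.
Proof. by rewrite /enorm dotZ sqrtrM ?sqrtr_sqr// -expr2 sqr_ge0. Qed.

Lemma enormN s : enorm (- s) = enorm s.
Proof. by rewrite -scaleN1r enormZ normrN normr1 mul1r. Qed.

Lemma norm_coord_le s j : `|s ord0 j| <= enorm s.
Proof.
rewrite -(@ler_pXn2r _ 2) ?nnegrE ?enorm_ge0// enorm_sqr real_normK ?num_real//.
rewrite /dot (bigD1 j) //= -expr2 lerDl.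
by apply: sumr_ge0 => i _; rewrite -expr2 sqr_ge0.
Qed.

Lemma enorm_eq0 s : enorm s = 0 -> s = 0.
Proof.
move=> s0; apply/rowP => j; rewrite mxE; apply/eqP.
by rewrite -normr_le0 -s0 norm_coord_le.
Qed.

Lemma enorm0 : enorm (0 : 'rV[R]_d) = 0.
Proof. by rewrite -[0](scale0r 0) enormZ normr0 mul0r. Qed.

Lemma dotC s t : dot s t = dot t s.
Proof. by apply: eq_bigr => j _; rewrite mulrC. Qed.

Lemma dotDl s t x : dot (s + t) x = dot s x + dot t x.
Proof. by rewrite /dot -big_split; apply: eq_bigr => j _; rewrite mxE mulrDl. Qed.

Lemma dotNl s x : dot (- s) x = - dot s x.
Proof. by rewrite -scaleN1r -[x in LHS]scale1r dotZ mulr1 mulN1r. Qed.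

Lemma dot0l x : dot 0 x = 0.
Proof. by rewrite /dot big1// => j _; rewrite mxE mul0r. Qed.

(** Cauchy-Schwarz, from the squared length of the part of [t] orthogonal to [s], scaled by
    [dot s s] to avoid a division. *)
Lemma dot_sqr_le s t : dot s t ^+ 2 <= dot s s * dot t t.
Proof.
have [s0|s0] := eqVneq (dot s s) 0.
  have -> : s = 0 by apply: enorm_eq0; rewrite /enorm s0 sqrtr0.
  by rewrite !dot0l expr0n mul0r.
have sp : 0 < dot s s by rewrite lt_neqAle eq_sym s0 dot_ge0.
have E (a b : R) : dot (b *: t - a *: s) (b *: t - a *: s) =
    b ^+ 2 * dot t t - 2 * a * b * dot s t + a ^+ 2 * dot s s.
  rewrite /dot !mulr_sumr -sumrB -big_split; apply: eq_bigr => j _.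
  by rewrite !mxE /=; ring.
have := dot_ge0 (dot s s *: t - dot s t *: s); rewrite E.
rewrite (_ : _ + _ = dot s s * (dot s s * dot t t - dot s t ^+ 2)); last by ring.
by rewrite pmulr_rge0// subr_ge0.
Qed.

Lemma measurable_coord j : measurable_fun setT (fun x : 'rV[R]_d => x ord0 j).
Proof. exact: (measurable_rV_coord j). Qed.

Lemma measurable_dot d1 (T1 : measurableType d1) (f g : T1 -> 'rV[R]_d) :
  measurable_fun setT f -> measurable_fun setT g ->
  measurable_fun setT (fun x : T1 => dot (f x) (g x)).
Proof.
move=> mf mg; rewrite /dot.
have -> : (fun x : T1 => \sum_(j < d) f x ord0 j * g x ord0 j) =
   (fun x : T1 => \sum_(j <- index_enum 'I_d) f x ord0 j * g x ord0 j) by [].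
elim: (index_enum _) => [|j r IH].
  by under eq_fun do rewrite big_nil; exact: measurable_cst.
under eq_fun do rewrite big_cons.
apply: measurable_funD => //; apply: measurable_funM.
  exact: (measurableT_comp (measurable_coord j) mf).
exact: (measurableT_comp (measurable_coord j) mg).
Qed.

Lemma measurable_enorm : measurable_fun setT (@enorm R d).
Proof.
have ms : measurable_fun setT (@Num.sqrt R).
  by apply: continuous_measurable_fun; exact: sqrt_continuous.
apply: (measurableT_comp ms (g := fun s : 'rV[R]_d => dot s s)).
exact: measurable_dot.
Qed.

Lemma measurable_addv d1 (T1 : measurableType d1) (f g : T1 -> 'rV[R]_d) :
  measurable_fun setT f -> measurable_fun setT g ->
  measurable_fun setT (fun x : T1 => f x + g x).
Proof.
move=> mf mg; apply: measurable_fun_rV => i.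
under eq_fun do rewrite mxE.
apply: measurable_funD.
  exact: (measurableT_comp (measurable_coord i) mf).
exact: (measurableT_comp (measurable_coord i) mg).
Qed.

Lemma measurable_oppv d1 (T1 : measurableType d1) (f : T1 -> 'rV[R]_d) :
  measurable_fun setT f -> measurable_fun setT (fun x : T1 => - f x).
Proof.
move=> mf; apply: measurable_fun_rV => i.
under eq_fun do rewrite mxE.
apply: measurableT_comp => //.
exact: (measurableT_comp (measurable_coord i) mf).
Qed.

Lemma measurable_eball r : measurable (@eball R d r).
Proof.
rewrite (_ : eball r = @enorm R d @^-1` `]-oo, r[%classic).
  rewrite -[X in measurable X]setTI; exact: measurable_enorm.
by apply/seteqP; split=> x /=; rewrite in_itv.
Qed.

End euclidean.

Section kernel.
Variables (R : realType) (d : nat) (rho : R -> R).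
Hypothesis hrho : kernel_profile d rho.

Let rho_ge0 r : 0 < r -> 0 <= rho r. Proof. by have [h _ _ _] := hrho; exact: h. Qed.
Let rho_ni r1 r2 : 0 < r1 -> r1 <= r2 -> rho r2 <= rho r1.
Proof. by have [_ h _ _] := hrho; exact: h. Qed.

Definition rho_pos (r : R) : R := if 0 < r then rho r else 0.

(** [rho] is monotone only on positive reals. The functions [rho (max r (1 / (n + 1)))] are monotone
    on the whole line, and at each [r > 0] they are eventually equal to [rho r]. *)
Lemma measurable_rho_pos : measurable_fun setT rho_pos.
Proof.
apply: measurable_fun_if => //.
  exact: measurable_fun_ltr.
set D := _ `&` _.
have DE : D = `]0, +oo[%classic.
  by apply/seteqP; split=> r; rewrite /D /= in_itv/= andbT // => -[].
have mD : measurable D by rewrite DE; exact: measurable_itv.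
pose g (n : nat) r := rho (Num.max r n.+1%:R^-1).
have n0 (n : nat) : 0 < n.+1%:R^-1 :> R by rewrite invr_gt0.
apply: (@measurable_fun_cvg _ _ _ D g).
  move=> n; apply: nonincreasing_measurable => // r1 r2 r12.
  apply: rho_ni; first by rewrite lt_max n0 orbT.
  by rewrite ge_max !le_max r12 lexx /= orbT.
move=> r; rewrite DE /= in_itv/= andbT => r0.
apply: cvg_near_cst; have := near_infty_natSinv_lt (PosNum r0).
apply: filterS => n /= nr; rewrite /g max_l//; exact: ltW.
Qed.

(* [rho] is unconstrained at [0], so the kernel is set to [0] at the origin. *)
Definition kern (delta : R) (s : 'rV[R]_d) : R :=
  if 0 < enorm s < delta then rescale d rho delta (enorm s) else 0.

Lemma kernE delta s : 0 < delta -> kern delta s =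
  \1_(eball delta) s * (delta ^- (d + 2) * rho_pos (enorm s / delta)).
Proof.
move=> d0; rewrite /kern indicE /rho_pos pmulr_lgt0 ?invr_gt0//.
have -> : (s \in eball delta) = (enorm s < delta) by apply/idP/idP; rewrite inE.
by case: (boolP (0 < enorm s)) => _; case: (boolP (enorm s < delta)) => _ /=;
  rewrite ?mul1r ?mul0r ?mulr0.
Qed.

Lemma kern_ge0 delta s : 0 < delta -> 0 <= kern delta s.
Proof.
move=> d0; rewrite /kern; case: ifP => // /andP[s0 _].
rewrite /rescale mulr_ge0// ?invr_ge0 ?exprn_ge0 ?(ltW d0)//.
by rewrite rho_ge0// divr_gt0.
Qed.

Lemma kernN delta s : kern delta (- s) = kern delta s.
Proof. by rewrite /kern enormN. Qed.

Lemma kern_supp delta s : kern delta s != 0 -> enorm s < delta.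
Proof. by rewrite /kern; case: ifP => [/andP[]//|]; rewrite eqxx. Qed.

Lemma measurable_kern delta : 0 < delta -> measurable_fun setT (kern delta).
Proof.
move=> d0; rewrite (_ : kern delta = fun s => \1_(eball delta) s *
  (delta ^- (d + 2) * rho_pos (enorm s / delta))); last first.
  by apply/funext => s; exact: kernE.
apply: measurable_funM; first by apply: measurable_indic; exact: measurable_eball.
apply: measurable_funM => //.
apply: (measurableT_comp measurable_rho_pos).
apply: measurable_funM => //; exact: measurable_enorm.
Qed.

(** The normalization of [rho] provides the finite second moment; at the origin the factor [dot s s]
    makes both integrands vanish. *)
Lemma kern1_integrable :
  (leb R d).-integrable setT (EFin \o (fun s => kern 1 s * dot s s)).
Proof.
have [_ _ _ hint] := hrho.
apply/integrableP; split.
  apply/measurable_EFinP; apply: measurable_funM; first exact: measurable_kern.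
  exact: measurable_dot.
apply: (@le_lt_trans _ _ (2 * d%:R)%:E); last exact: ltry.
rewrite -hint [X in (_ <= X)%E]integral_mkcond le_eqVlt; apply/orP; left; apply/eqP.
apply: eq_integral => s _; rewrite patchE /=.
rewrite ger0_norm; last by rewrite mulr_ge0 ?dot_ge0 ?kern_ge0.
case: ifPn => [|].
  rewrite inE /eball /kern /= => sl; rewrite sl andbT.
  case: ifPn => [_|]; first by rewrite /rescale expr1n !invr1 mul1r mulr1 enorm_sqr.
  rewrite -leNgt => s0; have -> : enorm s = 0 by apply/eqP; rewrite eq_le s0 enorm_ge0.
  by rewrite mul0r expr0n mulr0.
rewrite notin_setE /eball /kern /= => /negP /negbTE ->.
by rewrite andbF mul0r.
Qed.

(** Scaling: [kern delta s |s|^2] equals [delta ^ -d] times [kern 1 (s / delta) |s / delta|^2]. *)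
Lemma kern_integrable delta : 0 < delta ->
  (leb R d).-integrable setT (EFin \o (fun s => kern delta s * dot s s)).
Proof.
move=> d0; have dn0 : delta != 0 by rewrite gt_eqF.
have := integrable_affine 0 (invr_neq0 dn0) kern1_integrable.
move=> /(integrableZl (measurableT : measurable (setT : set 'rV[R]_d)) (delta ^- d)).
apply: eq_integrable => // s _; rewrite /= -EFinM; congr (_%:E).
rewrite addr0 dotZ /kern enormZ (gtr0_norm (_ : 0 < delta^-1)) ?invr_gt0//.
rewrite pmulr_rgt0 ?invr_gt0// [delta^-1 * _]mulrC ltr_pdivrMr// mul1r.
case: ifP => _; last by rewrite !mul0r mulr0.
rewrite /rescale expr1n !invr1 mul1r mulr1 exprD.
have := expf_neq0 d dn0; move: (rho _) (delta ^+ d) (dot s s) => r c e c0.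
by field; rewrite c0 dn0.
Qed.

(** The condition [X 0 = 0] absorbs the difference between [rescale] and [kern] at the origin. *)
Lemma ball_kern delta (X : 'rV[R]_d -> R) : X 0 = 0 ->
  (EFin \o (fun s => rescale d rho delta (enorm s) * X s)) \_ (eball delta) =
  EFin \o (fun s => kern delta s * X s).
Proof.
move=> X0; apply/funext => s; rewrite patchE /=.
case: ifPn => [|].
  rewrite inE /eball /kern /= => -> /=; rewrite andbT; case: ifPn => //.
  rewrite -leNgt => s0; have -> : s = 0.
    by apply: enorm_eq0; apply/eqP; rewrite eq_le s0 enorm_ge0.
  by rewrite X0 !mulr0.
rewrite notin_setE /eball /kern /= => /negP /negbTE ->.
by rewrite andbF mul0r.
Qed.

Lemma Rintegral_ball_kern delta (X : 'rV[R]_d -> R) : X 0 = 0 ->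
  \int[leb R d]_(s in eball delta) (rescale d rho delta (enorm s) * X s) =
  \int[leb R d]_s (kern delta s * X s).
Proof.
move=> X0; rewrite /Rintegral integral_mkcond; congr fine.
by apply: eq_integral => s _; rewrite -[LHS]/((_ \_ _) s) (ball_kern _ X0).
Qed.

Lemma symbolE delta w : symbol rho delta w =
  \int[leb R d]_s (kern delta s * (1 - cos (dot s w))).
Proof. by apply: Rintegral_ball_kern; rewrite dot0l cos0 subrr. Qed.

(* The symmetrized form of [nonlocal], with an arbitrary kernel. *)
Definition Lop (kappa : 'rV[R]_d -> R) (w : 'rV[R]_d -> R) (x : 'rV[R]_d) : R :=
  2^-1 * \int[leb R d]_s (kappa s * (w (x + s) + w (x - s) - 2 * w x)).

(** One formula for both branches: when the literal integral converges absolutely, it is averaged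
    with its image under [s -> - s], the kernel being even. *)
Lemma nonlocal_Lop delta (u : 'rV[R]_d -> R) x : 0 < delta ->
  nonlocal rho delta u x = Lop (kern delta) u x.
Proof.
move=> d0; rewrite /nonlocal; case: asboolP => [ui|_]; last first.
  rewrite (@Rintegral_ball_kern delta (fun s => u (x + s) + u (x - s) - 2 * u x))//.
  by rewrite addr0 subr0; ring.
have X0 : u (x + 0) - u x = 0 by rewrite addr0 subrr.
rewrite (Rintegral_ball_kern _ X0).
have {}ui : (leb R d).-integrable setT (EFin \o (fun s => kern delta s * (u (x + s) - u x))).
  rewrite -(ball_kern _ X0); apply/(integrable_mkcond _ (@measurable_eball R d delta)).
  exact: ui.
have n1 : -1 != 0 :> R by rewrite oppr_eq0 oner_eq0.
have ui2 := integrable_affine 0 n1 ui.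
have := Rintegral_affine 0 n1 ui; rewrite normrN normr1 expr1n mul1r => E.
have vE : (fun s => kern delta (-1 *: s + 0) * (u (x + (-1 *: s + 0)) - u x)) =
   (fun s => kern delta s * (u (x - s) - u x)).
  by apply/funext => s; rewrite scaleN1r addr0 kernN.
rewrite vE in ui2 E.
have : \int[leb R d]_s (kern delta s * (u (x + s) - u x)) +
   \int[leb R d]_s (kern delta s * (u (x - s) - u x)) =
   \int[leb R d]_s (kern delta s * (u (x + s) + u (x - s) - 2 * u x)).
  rewrite -RintegralD//; apply: eq_Rintegral => s _; ring.
by rewrite /Lop => <-; rewrite -E; field.
Qed.

End kernel.

Section nonlocal_operator.
Variables (R : realType) (d : nat).
Implicit Types (x s : 'rV[R]_d) (w f g : 'rV[R]_d -> R).
Notation leb := (leb R d).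

(* The Lipschitz bound makes the class stable under products. *)
Definition smooth2 w := measurable_fun setT w /\ exists K, [/\ 0 <= K,
  forall x, `|w x| <= K, forall x s, `|w (x + s) - w x| <= K * enorm s &
  forall x s, `|w (x + s) + w (x - s) - 2 * w x| <= K * dot s s].

(** A discrete Leibniz rule. Besides the two second differences it contains two products of first
    differences, each factor of order [enorm s]; the four terms explain the constant
    [4 * (K * M)]. *)
Lemma smooth2M f g : smooth2 f -> smooth2 g -> smooth2 (fun x => f x * g x).
Proof.
move=> [mf [K [K0 fK fL fD]]] [mg [M [M0 gM gL gD]]].
split; first exact: measurable_funM.
have KM0 : 0 <= K * M by exact: mulr_ge0.
have B (a b c e : R) : `|a| <= c -> `|b| <= e -> `|a * b| <= c * e.
  by move=> ac be; rewrite normrM ler_pM.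
exists (4 * (K * M)); split => [|x|x s|x s]; first exact: mulr_ge0.
- by have := B _ _ _ _ (fK x) (gM x); lra.
- have -> : f (x + s) * g (x + s) - f x * g x =
    f (x + s) * (g (x + s) - g x) + (f (x + s) - f x) * g x by ring.
  apply: le_trans (ler_normD _ _) _.
  have := B _ _ _ _ (fK (x + s)) (gL x s); have := B _ _ _ _ (fL x s) (gM x).
  have : 0 <= K * M * enorm s by rewrite mulr_ge0// enorm_ge0.
  lra.
- have -> : f (x + s) * g (x + s) + f (x - s) * g (x - s) - 2 * (f x * g x) =
    (f (x + s) + f (x - s) - 2 * f x) * g x + f x * (g (x + s) + g (x - s) - 2 * g x)
    + (f (x + s) - f x) * (g (x + s) - g x) + (f (x - s) - f x) * (g (x - s) - g x).
    by ring.
  have h1 := B _ _ _ _ (fD x s) (gM x); have h2 := B _ _ _ _ (fK x) (gD x s).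
  have h3 := B _ _ _ _ (fL x s) (gL x s).
  have h4 := B _ _ _ _ (fL x (- s)) (gL x (- s)).
  rewrite enormN in h4.
  have e : K * enorm s * (M * enorm s) = K * M * dot s s.
    by rewrite -enorm_sqr; ring.
  rewrite e in h3 h4.
  do 3 (apply: le_trans (ler_normD _ _) _; rewrite -lerBrDr).
  lra.
Qed.

Lemma smooth2_cst c : smooth2 (fun=> c).
Proof.
split; first exact: measurable_cst.
exists `|c|; split => [//|//|x s|x s].
  by rewrite subrr normr0 mulr_ge0// enorm_ge0.
by rewrite (_ : c + c - 2 * c = 0) ?normr0 ?mulr_ge0 ?dot_ge0//; ring.
Qed.

Lemma smooth2_prod I (r : seq I) (f : I -> 'rV[R]_d -> R) :
  (forall i, smooth2 (f i)) -> smooth2 (fun x => \prod_(i <- r) f i x).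
Proof.
move=> sf; elim: r => [|i r IH].
  by under eq_fun do rewrite big_nil; exact: smooth2_cst.
by under eq_fun do rewrite big_cons; exact: smooth2M.
Qed.

Lemma smooth2_coord (j : 'I_d) (h c : R) : 0 < h ->
  smooth2 (fun x => bspline (x ord0 j / h - c)).
Proof.
move=> h0; split.
  apply: (measurableT_comp (bmeas_bspline R).1).
  apply: measurable_funB => //; apply: measurable_funM => //.
  exact: measurable_coord.
have [L [L0 lip lip2]] : exists L : R, [/\ 0 <= L,
    forall x y : R, `|bspline x - bspline y| <= L * `|x - y| &
    forall x s : R, `|bspline (x + s) + bspline (x - s) - 2 * bspline x| <= L * s ^+ 2].
  by exists 200; split; [|exact: bspline_lip|exact: bspline_diff2].
have hV : 0 <= h^-1 by rewrite invr_ge0 ltW.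
have sj s : `|s ord0 j / h| <= enorm s * h^-1.
  by rewrite normrM (ger0_norm hV) ler_wpM2r// norm_coord_le.
have L1 : 0 <= L * h^-1 by exact: mulr_ge0.
have L2 : 0 <= L * h^-1 ^+ 2 by rewrite mulr_ge0// exprn_ge0.
exists (1 + L * h^-1 + L * h^-1 ^+ 2); split => [|x|x s|x s].
- by rewrite addr_ge0// addr_ge0.
- apply: le_trans (bspline_le1 _) _.
  by rewrite -addrA lerDl addr_ge0.
- apply: le_trans (lip _ _) _; rewrite mxE.
  rewrite (_ : _ - _ - _ = s ord0 j / h); last by ring.
  apply: le_trans (ler_wpM2l L0 (sj s)) _.
  rewrite mulrCA mulrC ler_wpM2r ?enorm_ge0// -addrA addrCA lerDl addr_ge0//.
- rewrite !mxE.
  rewrite (_ : (x ord0 j + s ord0 j) / h - c = (x ord0 j / h - c) + s ord0 j / h); last by ring.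
  rewrite (_ : (x ord0 j - s ord0 j) / h - c = (x ord0 j / h - c) - s ord0 j / h); last by ring.
  apply: le_trans (lip2 _ _) _.
  have h1 : (s ord0 j / h) ^+ 2 <= dot s s * h^-1 ^+ 2.
    rewrite exprMn ler_wpM2r ?exprn_ge0// -enorm_sqr -(real_normK (num_real (s ord0 j))).
    by rewrite ler_pXn2r ?nnegrE ?enorm_ge0// norm_coord_le.
  apply: le_trans (ler_wpM2l L0 h1) _.
  by rewrite mulrCA mulrC ler_wpM2r ?dot_ge0// lerDr addr_ge0.
Qed.

Variables (kappa : 'rV[R]_d -> R) (delta : R).
Hypotheses (delta0 : 0 < delta) (kappa0 : forall s, 0 <= kappa s)
  (mkappa : measurable_fun setT kappa)
  (ikappa : leb.-integrable setT (EFin \o (fun s => kappa s * dot s s)))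
  (skappa : forall s, kappa s != 0 -> enorm s < delta).

(** The second moment controls every function of order [dot s s], even if [kappa] itself is not
    integrable near the origin. *)
Lemma kappa_integrable (X : 'rV[R]_d -> R) K : measurable_fun setT X ->
  (forall s, `|X s| <= K * dot s s) ->
  leb.-integrable setT (EFin \o (fun s => kappa s * X s)).
Proof.
move=> mX XK.
apply: (le_integrable measurableT _ _ (integrableZl measurableT K ikappa)).
  by apply/measurable_EFinP; exact: measurable_funM.
move=> s _; rewrite /= lee_fin normrM (ger0_norm (kappa0 s)).
apply: (@le_trans _ _ (kappa s * (K * dot s s))); first by rewrite ler_wpM2l.
by rewrite mulrCA ler_norm.
Qed.

Lemma measurable_diff2 w x : measurable_fun setT w ->
  measurable_fun setT (fun s => w (x + s) + w (x - s) - 2 * w x).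
Proof.
move=> mw; apply: measurable_funB => //; apply: measurable_funD.
  by apply: (measurableT_comp mw); exact: measurable_addv.
apply: (measurableT_comp mw); apply: measurable_addv => //.
exact: measurable_oppv.
Qed.

Lemma Lop_integrable w x : smooth2 w ->
  leb.-integrable setT (EFin \o (fun s => kappa s * (w (x + s) + w (x - s) - 2 * w x))).
Proof.
move=> [mw [K [_ _ _ wD]]]; apply: (@kappa_integrable _ K) => //.
exact: measurable_diff2.
Qed.

Lemma Lop_sum I (r : seq I) (a : I -> R) (w : I -> 'rV[R]_d -> R) x :
  (forall i, smooth2 (w i)) ->
  Lop kappa (fun y => \sum_(i <- r) a i * w i y) x =
  \sum_(i <- r) a i * Lop kappa (w i) x.
Proof.
move=> sw.
have iw i : leb.-integrable setT (EFin \o (fun s =>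
    a i * (kappa s * (w i (x + s) + w i (x - s) - 2 * w i x)))).
  by have := integrableZl measurableT (a i) (Lop_integrable x (sw i)).
rewrite /Lop.
transitivity (2^-1 * \int[leb]_s (\sum_(i <- r) a i * (kappa s * (w i (x + s) + w i (x - s) - 2 * w i x)))).
  congr (_ * _); apply: eq_Rintegral => s _.
  rewrite mulr_sumr -sumrN -!big_split mulr_sumr; apply: eq_bigr => i _ /=.
  by ring.
have [-> _] := Rintegral_sum r measurableT iw.
rewrite mulr_sumr; apply: eq_bigr => i _.
rewrite RintegralZl//; first by ring.
exact: Lop_integrable.
Qed.

Lemma Lop_local w w' x : (forall y, enorm (y - x) < delta -> w y = w' y) ->
  Lop kappa w x = Lop kappa w' x.
Proof.
move=> ww; rewrite /Lop; congr (_ * _); apply: eq_Rintegral => s _.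
have [->|/skappa sd] := eqVneq (kappa s) 0; first by rewrite !mul0r.
rewrite !ww ?subrr ?enorm0// ?(addrC x) ?addrK//.
by rewrite enormN.
Qed.

Lemma Lop_shift w x c : Lop kappa (fun y => w (y + c)) x = Lop kappa w (x + c).
Proof.
rewrite /Lop; congr (_ * _); apply: eq_Rintegral => s _.
by rewrite (addrAC x s) (addrAC x (- s)).
Qed.

Lemma Lop_opp w x : Lop kappa (fun y => w (- y)) x = Lop kappa w (- x).
Proof.
rewrite /Lop; congr (_ * _); apply: eq_Rintegral => s _.
by rewrite !opprD opprK (addrC (w (- x - s))).
Qed.

Lemma Lop_bounded w : smooth2 w -> exists C, forall x, `|Lop kappa w x| <= C.
Proof.
move=> [mw [K [K0 wK wL wD]]].
exists (2^-1 * (K * \int[leb]_s (kappa s * dot s s))) => x.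
rewrite normrM ger0_norm ?invr_ge0// ler_wpM2l ?invr_ge0//.
have iw := Lop_integrable x (conj mw (ex_intro _ K (And4 K0 wK wL wD))).
apply: le_trans (le_normr_Rintegral measurableT iw) _.
rewrite -RintegralZl//; apply: le_Rintegral => //.
- exact: (integrable_norm iw).
- by have := integrableZl measurableT K ikappa.
- move=> s _; rewrite normrM (ger0_norm (kappa0 s)) mulrCA.
  by rewrite ler_wpM2l.
Qed.

(** Tonelli gives measurability in the parameter for nonnegative integrands, so the integrand on the
    product space is split into its positive and negative parts. *)
Lemma measurable_Lop w : measurable_fun setT w -> measurable_fun setT (Lop kappa w).
Proof.
move=> mw; rewrite /Lop; apply: measurable_funM => //.
pose F (p : 'rV[R]_d * 'rV[R]_d) : R :=
  kappa p.2 * (w (p.1 + p.2) + w (p.1 - p.2) - 2 * w p.1).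
have mF : measurable_fun setT F.
  apply: measurable_funM; first exact: (measurableT_comp mkappa measurable_snd).
  apply: measurable_funB; last first.
    by apply: measurable_funM => //; exact: (measurableT_comp mw measurable_fst).
  apply: measurable_funD.
    apply: (measurableT_comp mw); apply: measurable_addv.
      exact: measurable_fst.
    exact: measurable_snd.
  apply: (measurableT_comp mw); apply: measurable_addv.
    exact: measurable_fst.
  by apply: measurable_oppv; exact: measurable_snd.
have mEF : measurable_fun setT (EFin \o F) by exact/measurable_EFinP.
have -> : (fun x => \int[leb]_s (kappa s * (w (x + s) + w (x - s) - 2 * w x))) =
  fine \o (fun x => \int[leb]_s ((EFin \o F)^\+ (x, s)) - \int[leb]_s ((EFin \o F)^\- (x, s)))%E.
  apply/funext => x; rewrite /= /Rintegral; congr fine.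
  rewrite integralE; congr (_ - _)%E; apply: eq_integral => s _.
    by rewrite !funeposE.
  by rewrite !funenegE.
apply: (measurableT_comp (fine_measurable measurableT)).
apply: emeasurable_funB.
  apply: (measurable_fun_fubini_tonelli_F (m2 := leb) (EFin \o F)^\+%E) => //.
  exact: measurable_funepos.
apply: (measurable_fun_fubini_tonelli_F (m2 := leb) (EFin \o F)^\-%E) => //.
exact: measurable_funeneg.
Qed.

End nonlocal_operator.

(** * The reproducing kernel basis *)

Section reproducing_kernel_basis.
Variables (R : realType) (d : nat) (h : 'rV[R]_d).
Hypothesis h0 : forall j, 0 < h ord0 j.
Implicit Types (x s : 'rV[R]_d) (k l m : 'rV[int]_d) (v : 'rV[int]_d -> R).
Notation leb := (leb R d).
Notation Psi := (rk_basis h).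

Let hn0 j : h ord0 j != 0. Proof. by rewrite gt_eqF. Qed.

Lemma rk_basisE k x :
  Psi k x = \prod_(j < d) bspline (x ord0 j / h ord0 j - (k ord0 j)%:~R).
Proof.
apply: eq_bigr => j _; rewrite /bspline; congr (spline _).
have -> : x ord0 j / h ord0 j - (k ord0 j)%:~R =
   (x ord0 j - (k ord0 j)%:~R * h ord0 j) / h ord0 j by field.
by rewrite normrM normfV (gtr0_norm (h0 j)); field.
Qed.

Lemma smooth2_rk_basis k : smooth2 (Psi k).
Proof.
have -> : Psi k = fun x => \prod_(j < d) bspline (x ord0 j / h ord0 j - (k ord0 j)%:~R).
  by apply/funext => x; exact: rk_basisE.
by apply: smooth2_prod => j; exact: smooth2_coord.
Qed.

Lemma rk_basis_shift k m x : Psi (k + m) x = Psi m (x - gridpoint h k).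
Proof.
rewrite !rk_basisE; apply: eq_bigr => j _; congr bspline.
by rewrite !mxE intrD; field.
Qed.

Lemma rk_basisN k x : Psi (- k) (- x) = Psi k x.
Proof.
rewrite !rk_basisE; apply: eq_bigr => j _; rewrite -bsplineN; congr bspline.
by rewrite !mxE mulrNz; ring.
Qed.

Lemma rk_basis_supp j k x : Psi k x != 0 ->
  `|x ord0 j / h ord0 j - (k ord0 j)%:~R| < 2.
Proof.
rewrite rk_basisE; apply: contra_neqT; rewrite -leNgt => xj; rewrite (bigD1 j) //=.
by rewrite bspline0// mul0r.
Qed.

Lemma rk_basis_integrable k : leb.-integrable setT (EFin \o Psi k).
Proof.
have fi j : (@lebesgue_measure R).-integrable setT
    (EFin \o (fun t => bspline (t / h ord0 j - (k ord0 j)%:~R))).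
  have bi : (@lebesgue_measure R).-integrable setT (EFin \o @bspline R).
    apply: (@integrable_compact_support _ 2%N); first exact: bmeas_bspline.
    by move=> x x2; rewrite bspline0 ?ltW.
  have hV : (h ord0 j)^-1 != 0 by exact: invr_neq0.
  have := integrable_affine1 (- (k ord0 j)%:~R) hV bi.
  congr (integrable _ _ (EFin \o _)); apply/funext => x.
  by rewrite mulrC.
have [+ _] := leb_prod fi.
congr (integrable _ _ (EFin \o _)); apply/funext => x.
by rewrite rk_basisE.
Qed.

Lemma box_out N k : k \notin box d N -> exists j, (N%:R < `|k ord0 j|%:~R :> R).
Proof.
rewrite mem_box negb_forall => /existsP[j]; rewrite -ltNge => kj; exists j.
by rewrite -(ltr_int R) in kj.
Qed.

Lemma coord_div_le x j : `|x ord0 j / h ord0 j| = `|x ord0 j| / h ord0 j.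
Proof. by rewrite normrM normfV (gtr0_norm (h0 j)). Qed.

Lemma interp_box v x N :
  (forall j, `|x ord0 j| / h ord0 j + 2 <= N%:R) ->
  interp h v x = \sum_(k <- box d N) v k * Psi k x.
Proof.
move=> xN; rewrite /interp; apply: fsbigTE => k /box_out[j kj].
have [->|/(rk_basis_supp j)] := eqVneq (Psi k x) 0; first by rewrite mulr0.
have := xN j; rewrite -coord_div_le; move: kj; rewrite intr_norm.
have := lerB_dist (k ord0 j)%:~R (x ord0 j / h ord0 j); rewrite distrC; lra.
Qed.

Lemma box_exists (f : 'I_d -> R) : exists N0 : nat, forall N, (N0 <= N)%N ->
  forall j, f j <= N%:R.
Proof.
exists (\max_(j < d) (Num.truncn (f j)).+1)%N => N N0 j.
apply: (@le_trans _ _ (Num.truncn (f j)).+1%:R).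
  by rewrite ltW// truncnS_gt.
rewrite ler_nat (leq_trans _ N0)//.
exact: (leq_bigmax (F := fun j => (Num.truncn (f j)).+1) j).
Qed.

Lemma measurable_interp v : measurable_fun setT (interp h v).
Proof.
apply: (@measurable_fun_cvg _ _ _ _ (fun N x => \sum_(k <- box d N) v k * Psi k x)).
  move=> N; elim: (enum_fset _) => [|k r IH].
    by under eq_fun do rewrite big_nil; exact: measurable_cst.
  under eq_fun do rewrite big_cons.
  apply: measurable_funD => //; apply: measurable_funM => //.
  exact: (smooth2_rk_basis k).1.
move=> x _; apply: cvg_near_cst.
have [N0 hN] := box_exists (fun j => `|x ord0 j| / h ord0 j + 2).
by exists N0 => // N /= NN; rewrite -interp_box//; exact: hN.
Qed.

Variables (kappa : 'rV[R]_d -> R) (delta : R).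
Hypotheses (delta0 : 0 < delta) (kappa0 : forall s, 0 <= kappa s)
  (mkappa : measurable_fun setT kappa)
  (ikappa : leb.-integrable setT (EFin \o (fun s => kappa s * dot s s)))
  (skappa : forall s, kappa s != 0 -> enorm s < delta).
Notation L := (Lop kappa).

(** [L] at [x] sees only points within [delta] of [x], and on that ball one box holds all nonzero
    terms; linearity is thus applied to a finite sum. *)
Lemma Lop_interp_box v x N :
  (forall j, (`|x ord0 j| + delta) / h ord0 j + 2 <= N%:R) ->
  L (interp h v) x = \sum_(k <- box d N) v k * L (Psi k) x.
Proof.
move=> xN.
rewrite -(Lop_sum kappa0 mkappa ikappa); last exact: smooth2_rk_basis.
apply: (Lop_local delta0 skappa) => y yx; apply: interp_box => j.
apply: le_trans (xN j); rewrite lerD2r ler_pM2r ?invr_gt0//.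
have := norm_coord_le (y - x) j; rewrite !mxE.
have := lerB_dist (y ord0 j) (x ord0 j); lra.
Qed.

Lemma Lop_rk_basis_supp k x j : L (Psi k) x != 0 ->
  `|x ord0 j / h ord0 j - (k ord0 j)%:~R| < 2 + delta / h ord0 j.
Proof.
apply: contra_neqT; rewrite -leNgt => xj.
have -> : L (Psi k) x = L (fun=> 0) x.
  apply: (Lop_local delta0 skappa) => y yx; apply/eqP.
  apply: contraLR xj => /(rk_basis_supp j) yk; rewrite -ltNge.
  have := norm_coord_le (y - x) j; rewrite !mxE => yx2.
  have : `|(y ord0 j - x ord0 j) / h ord0 j| < delta / h ord0 j.
    rewrite normrM normfV (gtr0_norm (h0 j)) ltr_pM2r ?invr_gt0//.
    exact: le_lt_trans yx.
  have := ler_distD (y ord0 j / h ord0 j) (x ord0 j / h ord0 j) (k ord0 j)%:~R.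
  rewrite (_ : (y ord0 j - x ord0 j) / h ord0 j = y ord0 j / h ord0 j - x ord0 j / h ord0 j); last by ring.
  rewrite (distrC (y ord0 j / _) (x ord0 j / _)) => h1 h2; lra.
rewrite /Lop (_ : (fun s => _) = fun=> 0).
  by rewrite Rintegral_cst// mul0r mulr0.
by apply/funext => s; rewrite addr0 mulr0 subr0 mulr0.
Qed.

Lemma Lop_rk_basis_shift k m x :
  L (Psi (k + m)) x = L (Psi m) (x - gridpoint h k).
Proof.
rewrite -[RHS](Lop_shift kappa (Psi m) x (- gridpoint h k)).
by congr (L _ x); apply/funext => y; rewrite rk_basis_shift.
Qed.

Lemma Lop_rk_basisN k x : L (Psi (- k)) x = L (Psi k) (- x).
Proof.
rewrite -Lop_opp; congr (L _ x); apply/funext => y.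
by rewrite -[y in LHS]opprK rk_basisN.
Qed.

Definition collocation_coef m : R := - L (Psi m) 0.

Definition galerkin_coef m : R := \int[leb]_x (Psi 0 x * - L (Psi m) x).

Lemma galerkin_integrable k m :
  leb.-integrable setT (EFin \o (fun x => Psi k x * - L (Psi m) x)).
Proof.
have [C hC] := Lop_bounded kappa0 mkappa ikappa (smooth2_rk_basis m).
have bL : bmeas (fun x => - L (Psi m) x).
  split; last by exists C => x; rewrite normrN.
  apply: measurableT_comp => //; apply: measurable_Lop => //.
  exact: (smooth2_rk_basis m).1.
have := bmeasM_integrable measurableT bL (rk_basis_integrable k).
by apply: eq_integrable => // x _; rewrite /= mulrC.
Qed.

(** Translation by the grid point of [k]: the stiffness matrix depends only on the difference of the
    indices, so the bilinear form is a convolution. *)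
Lemma galerkin_shift k m :
  \int[leb]_x (Psi k x * - L (Psi (k + m)) x) = galerkin_coef m.
Proof.
have := Rintegral_affine (gridpoint h k) (oner_neq0 R) (galerkin_integrable k (k + m)).
rewrite normr1 expr1n mul1r => ->; apply: eq_Rintegral => x _.
rewrite scale1r Lop_rk_basis_shift addrK -[k in Psi k]addr0 rk_basis_shift.
by rewrite addrK.
Qed.

Lemma collocation_coefN m : collocation_coef (- m) = collocation_coef m.
Proof. by rewrite /collocation_coef Lop_rk_basisN oppr0. Qed.

(** Reflection [x -> - x]. Evenness, as in [collocation_coefN], is what removes the sine part of the
    multiplier in [fourier_series_multiplier]. *)
Lemma galerkin_coefN m : galerkin_coef (- m) = galerkin_coef m.
Proof.
have n1 : -1 != 0 :> R by rewrite oppr_eq0 oner_eq0.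
have := Rintegral_affine 0 n1 (galerkin_integrable 0 (- m)).
rewrite normrN normr1 expr1n mul1r => E; rewrite /galerkin_coef E.
apply: eq_Rintegral => x _; rewrite scaleN1r addr0.
by rewrite Lop_rk_basisN opprK -[0 in LHS]oppr0 rk_basisN.
Qed.

Lemma collocation_restr k m : - restr h (L (Psi (k + m))) k = collocation_coef m.
Proof. by rewrite /restr Lop_rk_basis_shift subrr. Qed.

End reproducing_kernel_basis.

(** * Interpolated plane waves *)

Section dominated_convergence_real.
Context d (T : measurableType d) (R : realType).
Variables (mu : {measure set T -> \bar R}) (f_ : nat -> T -> R) (f g : T -> R).
Hypotheses (mf_ : forall n, measurable_fun setT (f_ n))
  (cf : forall x, f_ ^~ x @ \oo --> f x)
  (ig : mu.-integrable setT (EFin \o g))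
  (fg : forall n x, `|f_ n x| <= g x).

Lemma dominated_convergence_real :
  mu.-integrable setT (EFin \o f) /\
  (fun n => \int[mu]_x f_ n x) @ \oo --> \int[mu]_x f x.
Proof.
have mf : measurable_fun setT f.
  by apply: (measurable_fun_cvg mf_) => x _; exact: cf.
have mEf n : measurable_fun setT (EFin \o f_ n) by exact/measurable_EFinP.
have mE : measurable_fun setT (EFin \o f) by exact/measurable_EFinP.
have cE x : (fun n => (EFin \o f_ n) x) @ \oo --> (EFin \o f) x.
  by apply/fine_cvgP; split; [exact: nearW|exact: cf].
have dE n x : (`|(EFin \o f_ n) x| <= (EFin \o g) x)%E by rewrite /= lee_fin.
have [fi _ If] := dominated_convergence measurableT mEf mE (aeW mu (fun x _ => cE x))
  ig (aeW mu (fun x n _ => dE n x)).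
split => //.
move: If; rewrite -(fineK (integrable_fin_num measurableT fi)) => If.
exact: fine_cvg If.
Qed.

End dominated_convergence_real.

Section complex_products.
Variable R : realType.
Implicit Types (z : R[i]).

Lemma expiD (a b : R) : expi (a + b) = expi a * expi b.
Proof. by rewrite /expi cosD sinD; simpc; rewrite (addrC (_ * sin b)). Qed.

Lemma expi0 : expi (0 : R) = 1.
Proof. by rewrite /expi cos0 sin0. Qed.

Lemma ReM z1 z2 : complex.Re (z1 * z2) =
  complex.Re z1 * complex.Re z2 - complex.Im z1 * complex.Im z2.
Proof. by case: z1; case: z2. Qed.

Lemma ImM z1 z2 : complex.Im (z1 * z2) =
  complex.Re z1 * complex.Im z2 + complex.Im z1 * complex.Re z2.
Proof. by case: z1; case: z2. Qed.

Lemma ReD z1 z2 : complex.Re (z1 + z2) = complex.Re z1 + complex.Re z2.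
Proof. by case: z1; case: z2. Qed.

Lemma ImD z1 z2 : complex.Im (z1 + z2) = complex.Im z1 + complex.Im z2.
Proof. by case: z1; case: z2. Qed.

Lemma Re_sum I (r : seq I) (F : I -> R[i]) :
  complex.Re (\sum_(i <- r) F i) = \sum_(i <- r) complex.Re (F i).
Proof.
elim: r => [|i r IH]; first by rewrite !big_nil.
by rewrite !big_cons ReD IH.
Qed.

Lemma Im_sum I (r : seq I) (F : I -> R[i]) :
  complex.Im (\sum_(i <- r) F i) = \sum_(i <- r) complex.Im (F i).
Proof.
elim: r => [|i r IH]; first by rewrite !big_nil.
by rewrite !big_cons ImD IH.
Qed.

(** The one-dimensional Poisson formulas multiply over the coordinates as exponentials, not as
    cosines. Complex limits are encoded by two real ones, which [bspline_poisson] supplies with the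
    phases [0] and [- pi / 2]. *)
Definition cvgC (u : nat -> R[i]) (l : R[i]) :=
  (fun n => complex.Re (u n)) @ \oo --> complex.Re l /\
  (fun n => complex.Im (u n)) @ \oo --> complex.Im l.

Lemma cvgCM u v l m : cvgC u l -> cvgC v m -> cvgC (fun n => u n * v n) (l * m).
Proof.
move=> [ur ui] [vr vi]; split.
  under eq_cvg do rewrite ReM; rewrite ReM.
  by apply: cvgB; apply: cvgM.
under eq_cvg do rewrite ImM; rewrite ImM.
by apply: cvgD; apply: cvgM.
Qed.

Lemma cvgC_prod I (r : seq I) (u : I -> nat -> R[i]) (l : I -> R[i]) :
  (forall i, cvgC (u i) (l i)) ->
  cvgC (fun n => \prod_(i <- r) u i n) (\prod_(i <- r) l i).
Proof.
move=> ul; elim: r => [|i r IH].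
  rewrite big_nil; split.
    by under eq_cvg do rewrite big_nil; exact: cvg_cst.
  by under eq_cvg do rewrite big_nil; exact: cvg_cst.
rewrite big_cons (_ : (fun n => _) = (fun n => u i n * \prod_(j <- r) u j n)).
  exact: cvgCM.
by apply/funext => n; rewrite big_cons.
Qed.

Lemma prod_expi I (r : seq I) (c t : I -> R) :
  \prod_(i <- r) ((c i)%:C%C * expi (t i)) =
  (\prod_(i <- r) c i)%:C%C * expi (\sum_(i <- r) t i).
Proof.
elim: r => [|i r IH]; first by rewrite !big_nil expi0 mulr1.
by rewrite !big_cons IH expiD rmorphM /=; ring.
Qed.

Lemma ReCM (c t : R) : complex.Re (c%:C%C * expi t) = c * cos t.
Proof. by rewrite ReM /= mul0r subr0. Qed.

Lemma ImCM (c t : R) : complex.Im (c%:C%C * expi t) = c * sin t.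
Proof. by rewrite ImM /= mul0r addr0. Qed.

End complex_products.

Lemma cvgn_eq (R : realType) (u v : nat -> R) (a b : R) :
  (u @ \oo --> a) -> u =1 v -> a = b -> v @ \oo --> b.
Proof. by move=> ua /funext <- <-. Qed.

Section lattice_poisson.
Variables (R : realType) (d : nat) (h xi : 'rV[R]_d).
Hypotheses (h0 : forall j, 0 < h ord0 j) (xicube : (@cube R d) xi).
Implicit Types (x s : 'rV[R]_d) (k r : 'rV[int]_d).
Notation leb := (leb R d).
Notation om := (shifted_freq h xi).

Let wv r j := wave (xi ord0 j) (r ord0 j).

(* By [sin_quotE], [damping r] is the product of the [(2 * sin_quot (xi_j) r_j) ^+ 4]. *)
Definition damping r : R := \prod_(j < d) sinc4 (wv r j).

Definition plane_sum N x : R := \sum_(r <- box d N) damping r * cos (dot x (om r)).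

Definition plane_wave : 'rV[R]_d -> R :=
  interp h (fun k => cos (dot (map_mx intr k) xi)).

Lemma damping_ge0 r : 0 <= damping r.
Proof. by apply: prodr_ge0 => j _; exact: sinc4_ge0. Qed.

Lemma dot_shifted_freq x r : dot x (om r) = \sum_(j < d) wv r j * (x ord0 j / h ord0 j).
Proof. by apply: eq_bigr => j _; rewrite mxE /wv /wave; field; rewrite gt_eqF. Qed.

(* Poisson summation in each coordinate. *)
Lemma cvg_plane_sum x : plane_sum ^~ x @ \oo --> plane_wave x.
Proof.
have [M hM] := box_exists (fun j => `|x ord0 j| / h ord0 j + 2).
rewrite /plane_wave (interp_box h0 _ (hM _ (leqnn M))).
pose y j := x ord0 j / h ord0 j.
pose u j N : R[i] := isum N (fun r : int => (sinc4 (wave (xi ord0 j) r))%:C%C *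
   expi (wave (xi ord0 j) r * y j)).
pose l j : R[i] := isum M (fun k : int => (bspline (y j - k%:~R))%:C%C * expi (xi ord0 j * k%:~R)).
have ul j : cvgC (u j) (l j).
  have yM : `|y j| + 2 <= M%:R by rewrite /y coord_div_le// hM.
  split.
    apply: (cvgn_eq (@bspline_poisson R (y j) (xi ord0 j) 0 M yM)) => [N|].
      by rewrite /u /isum Re_sum; apply: eq_bigr => i _; rewrite ReCM addr0.
    by rewrite /l /isum Re_sum; apply: eq_bigr => i _; rewrite ReCM addr0.
  apply: (cvgn_eq (@bspline_poisson R (y j) (xi ord0 j) (- (pi / 2)) M yM)) => [N|].
    by rewrite /u /isum Im_sum; apply: eq_bigr => i _; rewrite ImCM cosBpihalf.
  by rewrite /l /isum Im_sum; apply: eq_bigr => i _; rewrite ImCM cosBpihalf.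
have [ulr _] := cvgC_prod (index_enum 'I_d) ul.
apply: (cvgn_eq ulr) => [N|].
  rewrite /u -sum_box_prod Re_sum /plane_sum.
  by apply: eq_bigr => r _; rewrite prod_expi ReCM dot_shifted_freq.
rewrite /l -sum_box_prod Re_sum; apply: eq_bigr => k _.
rewrite prod_expi ReCM mulrC rk_basisE//; congr (cos _ * _).
by apply: eq_bigr => j _; rewrite mxE mulrC.
Qed.

(** By [1 + sum_j a_j <= prod_j (1 + a_j)] the quadratic weight is dominated by a product, so the
    box sum factors into sums at most 49 each. The constant [H] pays for the division of the
    frequencies by [h]. *)
Lemma damping_bound : exists B, forall N,
  \sum_(r <- box d N) damping r * (1 + dot (om r) (om r)) <= B.
Proof.
pose H := 1 + \sum_(j < d) (h ord0 j)^-1 ^+ 2.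
have H1 : 1 <= H by rewrite lerDl sumr_ge0// => j _; exact: sqr_ge0.
pose P r := \prod_(j < d) ((1 + wv r j ^+ 2) * sinc4 (wv r j)).
exists (H * 49 ^+ d) => N.
have PN : \sum_(r <- box d N) P r <= 49 ^+ d.
  rewrite (sum_box_prod N (fun j (r : int) => (1 + wave (xi ord0 j) r ^+ 2) * sinc4 (wave (xi ord0 j) r))).
  rewrite -[X in _ ^+ X]card_ord -prodr_const; apply: ler_prod => j _.
  rewrite isum_wave_bound// andbT; apply: sumr_ge0 => i _.
  by rewrite mulr_ge0 ?sinc4_ge0// addr_ge0// sqr_ge0.
apply: (@le_trans _ _ (H * \sum_(r <- box d N) P r)); last first.
  by rewrite ler_wpM2l// (le_trans _ H1).
rewrite mulr_sumr; apply: ler_sum => r _.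
rewrite /P big_split /= mulrA mulrC -/(damping r) ler_wpM2r ?damping_ge0//.
have key (I : Type) (q : seq I) (a : I -> R) : (forall i, 0 <= a i) ->
    1 + \sum_(i <- q) a i <= \prod_(i <- q) (1 + a i).
  move=> a0; elim: q => [|i q IH]; first by rewrite !big_nil addr0.
  rewrite !big_cons.
  have s0 : 0 <= \sum_(j <- q) a j by exact: sumr_ge0.
  have := a0 i; nra.
apply: (@le_trans _ _ (H * (1 + \sum_(j < d) wv r j ^+ 2))); last first.
  rewrite ler_wpM2l ?(le_trans _ H1)//; apply: key => j; exact: sqr_ge0.
rewrite mulrDr mulr1 lerD// mulr_sumr; apply: ler_sum => j _.
rewrite mxE -/(wave _ _) -/(wv r j) -expr2 exprMn mulrC ler_wpM2r ?sqr_ge0//.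
rewrite /H (bigD1 j) //= addrCA lerDl addr_ge0// sumr_ge0// => i _.
exact: sqr_ge0.
Qed.

Lemma one_sub_cos_le (t : R) : 0 <= 1 - cos t <= t ^+ 2 / 2.
Proof.
rewrite subr_ge0 cos_le1 /= {1}(_ : t = t / 2 * 2); last by field.
rewrite cos_double cos2sin2.
have : sin (t / 2) ^+ 2 <= (t / 2) ^+ 2.
  rewrite -(real_normK (num_real (sin _))) -(real_normK (num_real (t / 2))).
  by rewrite ler_pXn2r ?nnegrE// norm_sin_le.
move=> h1; nra.
Qed.

Variables (kappa : 'rV[R]_d -> R).
Hypotheses (kappa0 : forall s, 0 <= kappa s) (mkappa : measurable_fun setT kappa)
  (ikappa : leb.-integrable setT (EFin \o (fun s => kappa s * dot s s))).

Definition ksymbol w : R := \int[leb]_s (kappa s * (1 - cos (dot s w))).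

Lemma measurable_cos_dot w p : measurable_fun setT (fun s : 'rV[R]_d => cos (dot s w + p)).
Proof.
have mc : measurable_fun setT (@cos R).
  by apply: continuous_measurable_fun; exact: continuous_cos.
apply: (measurableT_comp mc (g := fun s : 'rV[R]_d => dot s w + p)).
by apply: measurable_funD => //; exact: measurable_dot.
Qed.

Lemma measurable_cos_dot0 w : measurable_fun setT (fun s : 'rV[R]_d => cos (dot s w)).
Proof. by have := measurable_cos_dot w 0; under eq_fun do rewrite addr0. Qed.

Lemma ksymbol_integrable w :
  leb.-integrable setT (EFin \o (fun s => kappa s * (1 - cos (dot s w)))).
Proof.
apply: (kappa_integrable kappa0 mkappa ikappa (K := dot w w / 2)).
  by apply: measurable_funB => //; exact: measurable_cos_dot0.
move=> s; have /andP[c0 c1] := one_sub_cos_le (dot s w).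
rewrite ger0_norm// (le_trans c1)//.
have := dot_sqr_le s w; lra.
Qed.

Lemma ksymbol_ge0 w : 0 <= ksymbol w.
Proof.
by apply: Rintegral_ge0 => s _; rewrite mulr_ge0// subr_ge0 cos_le1.
Qed.

Lemma ksymbol_le : exists C, forall w, ksymbol w <= C * dot w w.
Proof.
exists (2^-1 * \int[leb]_s (kappa s * dot s s)) => w.
rewrite mulrAC -RintegralZl//; apply: le_Rintegral => //.
- exact: ksymbol_integrable.
- by have := integrableZl measurableT (2^-1 * dot w w) ikappa.
- move=> s _; rewrite mulrCA ler_wpM2l//.
  have /andP[_ c1] := one_sub_cos_le (dot s w).
  have := dot_sqr_le s w; lra.
Qed.

Definition symbol_sum N x : R :=
  \sum_(r <- box d N) ksymbol (om r) * damping r * cos (dot x (om r)).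

Lemma symbol_sum_bound : exists B, forall N,
  \sum_(r <- box d N) ksymbol (om r) * damping r <= B.
Proof.
have [C hC] := ksymbol_le; have [B hB] := damping_bound.
exists (`|C| * B) => N; rewrite (le_trans _ (ler_wpM2l (normr_ge0 C) (hB N)))//.
rewrite mulr_sumr; apply: ler_sum => r _.
rewrite mulrCA mulrC ler_wpM2l ?damping_ge0// (le_trans (hC _))//.
apply: (@le_trans _ _ (`|C| * dot (om r) (om r))).
  by rewrite ler_wpM2r ?dot_ge0// ler_norm.
by rewrite ler_wpM2l// lerDr.
Qed.

(** [(1 - cos (s . w)) cos (x . w)] is minus half the second difference of [cos (y . w)] at [y = x].
    The partial sums are therefore integrals of [kappa] against second differences of [plane_sum],
    which converge pointwise, and [damping_bound] dominates them uniformly in [N] by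
    [B / 2 * (kappa s * dot s s)]. *)
Lemma cvg_symbol_sum x : symbol_sum ^~ x @ \oo --> - Lop kappa plane_wave x.
Proof.
pose F N s := kappa s * \sum_(r <- box d N) damping r * ((1 - cos (dot s (om r))) * cos (dot x (om r))).
have FE N s : F N s = kappa s * (plane_sum N x - 2^-1 * (plane_sum N (x + s) + plane_sum N (x - s))).
  rewrite /F; congr (_ * _); rewrite /plane_sum -big_split mulr_sumr -sumrB.
  apply: eq_bigr => r _ /=.
  by rewrite !dotDl dotNl cosD cosB; field.
have SF N : symbol_sum N x = \int[leb]_s F N s.
  transitivity (\int[leb]_s (\sum_(r <- box d N)
     (damping r * cos (dot x (om r))) * (kappa s * (1 - cos (dot s (om r)))))).
    have ir r : leb.-integrable setT (EFin \o (fun s => (damping r * cos (dot x (om r))) * (kappa s * (1 - cos (dot s (om r)))))).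
      by have := integrableZl measurableT (damping r * cos (dot x (om r))) (ksymbol_integrable (om r)).
    have [-> _] := Rintegral_sum (box d N) measurableT ir.
    apply: eq_bigr => r _; rewrite RintegralZl//; last exact: ksymbol_integrable.
    by rewrite -/(ksymbol _); ring.
  apply: eq_Rintegral => s _; rewrite /F mulr_sumr; apply: eq_bigr => r _; ring.
have [B hB] := damping_bound.
have mP N : measurable_fun setT (plane_sum N).
  rewrite /plane_sum; elim: (enum_fset _) => [|r q IH].
    by under eq_fun do rewrite big_nil; exact: measurable_cst.
  under eq_fun do rewrite big_cons.
  apply: measurable_funD => //; apply: measurable_funM => //.
  exact: measurable_cos_dot0.
have mF N : measurable_fun setT (F N).
  rewrite (_ : F N = fun s => kappa s * (plane_sum N x - 2^-1 * (plane_sum N (x + s) + plane_sum N (x - s)))).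
    apply: measurable_funM => //; apply: measurable_funB => //.
    apply: measurable_funM => //; apply: measurable_funD.
      by apply: (measurableT_comp (mP N)); exact: measurable_addv.
    apply: (measurableT_comp (mP N)); apply: measurable_addv => //.
    exact: measurable_oppv.
  by apply/funext => s; exact: FE.
have cF s : F ^~ s @ \oo -->
    kappa s * (plane_wave x - 2^-1 * (plane_wave (x + s) + plane_wave (x - s))).
  under eq_cvg do rewrite FE.
  apply: cvgM; first exact: cvg_cst.
  apply: cvgB; first exact: cvg_plane_sum.
  apply: cvgM; first exact: cvg_cst.
  by apply: cvgD; exact: cvg_plane_sum.
have iB : leb.-integrable setT (EFin \o (fun s => B / 2 * (kappa s * dot s s))).
  by have := integrableZl measurableT (B / 2) ikappa.
have dF N s : `|F N s| <= B / 2 * (kappa s * dot s s).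
  rewrite /F normrM (ger0_norm (kappa0 s)) mulrCA ler_wpM2l//.
  apply: le_trans (ler_norm_sum _ _ _) _.
  apply: (@le_trans _ _ (\sum_(r <- box d N) damping r * (1 + dot (om r) (om r)) * (dot s s / 2))).
    apply: ler_sum => r _; rewrite normrM (ger0_norm (damping_ge0 r)) -mulrA ler_wpM2l ?damping_ge0//.
    have /andP[c0 c1] := one_sub_cos_le (dot s (om r)).
    rewrite normrM (ger0_norm c0) (le_trans (ler_piMr c0 (cos_max _)))//.
    have := dot_sqr_le s (om r); have := dot_ge0 s; lra.
  rewrite -mulr_suml (le_trans (ler_wpM2r _ (hB N)))//; last lra.
  by rewrite divr_ge0// dot_ge0.
have [iG +] := dominated_convergence_real mF cF iB dF.
move=> /cvgn_eq; apply => [N|]; first by rewrite SF.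
rewrite /Lop.
have -> : (fun s => kappa s * (plane_wave (x + s) + plane_wave (x - s) - 2 * plane_wave x)) =
    (fun s => -2 * (kappa s * (plane_wave x - 2^-1 * (plane_wave (x + s) + plane_wave (x - s))))).
  by apply/funext => s; field.
by rewrite RintegralZl//; field.
Qed.

End lattice_poisson.

(** * The symbols of the two schemes *)

Section basis_transform.
Variable R : realType.
Notation mu := (@lebesgue_measure R).

Lemma scaled_bspline_transform (h w p : R) : 0 < h ->
  mu.-integrable setT (EFin \o (fun t => bspline (t / h) * cos (w * t + p))) /\
  \int[mu]_t (bspline (t / h) * cos (w * t + p)) = h * sinc4 (h * w) * cos p.
Proof.
move=> h0; have hn0 : h != 0 by rewrite gt_eqF.
have ib := integrable_bsplineM (bmeas_cosM (w * h) p).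
have E : (fun t => bspline (h^-1 * t + 0) * cos (w * h * (h^-1 * t + 0) + p)) =
   (fun t => bspline (t / h) * cos (w * t + p)).
  by apply/funext => t; rewrite addr0 (mulrC _ t); congr (_ * cos _); field.
have := integrable_affine1 0 (invr_neq0 hn0) ib; rewrite E => ih; split => //.
have := Rintegral_affine1 0 (invr_neq0 hn0) ib; rewrite E.
have := bspline_transform (w * h) p 0; rewrite mulr0 add0r.
have -> : (fun x => bspline (0 - x) * cos (w * h * x + p)) =
  (fun x : R => bspline x * cos (w * h * x + p)).
  by apply/funext => x; rewrite sub0r bsplineN.
move=> ->; rewrite normfV (gtr0_norm h0) (mulrC w) -[h * _ * _]mulrA => ->.
by rewrite mulrA divff// mul1r.
Qed.

(** Induction on the dimension: once the first coordinate is fixed, its contribution joins the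
    phase, so both hypothesis and claim range over all phases. That [c j] does not depend on the
    phase says that the sine transform of [f j] vanishes. It serves the spline as well as the
    indicator of the cube. *)
Lemma leb_cos_transform n (f : 'I_n -> R -> R) (w c : 'I_n -> R) (p : R) :
  (forall j, mu.-integrable setT (EFin \o f j)) ->
  (forall j q, mu.-integrable setT (EFin \o (fun t => f j t * cos (w j * t + q))) /\
     \int[mu]_t (f j t * cos (w j * t + q)) = c j * cos q) ->
  let F := fun x : 'rV[R]_n => \prod_(j < n) f j (x ord0 j) *
     cos (\sum_(j < n) w j * x ord0 j + p) in
  (leb R n).-integrable setT (EFin \o F) /\
  \int[leb R n]_x F x = \prod_(j < n) c j * cos p.
Proof.
elim: n f w c p => [|n IH] f w c p fi fc F.
  have FE : F = cst (cos p) by apply/funext => x; rewrite /F !big_ord0 mul1r add0r.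
  have mF : measurable_fun setT (EFin \o F) by rewrite FE; exact/measurable_EFinP.
  rewrite big_ord0 mul1r; split.
    apply/integrableP; split => //.
    rewrite (leb0E (F := fun x => `|(EFin \o F) x|%E)) ?ltry//.
    exact: measurableT_comp.
  by rewrite /Rintegral (leb0E mF) /= FE.
pose f' j := f (lift ord0 j); pose w' j := w (lift ord0 j).
pose G q := fun x : 'rV[R]_n => \prod_(j < n) f' j (x ord0 j) *
     cos (\sum_(j < n) w' j * x ord0 j + q).
have GI q := IH f' w' (fun j => c (lift ord0 j)) q (fun j => fi _) (fun j => fc _).
set P := \prod_(j < n) _ in GI.
have iF : (leb R n.+1).-integrable setT (EFin \o F).
  have b0 : bmeas (fun x : 'rV[R]_n.+1 => cos (\sum_(j < n.+1) w j * x ord0 j + p)).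
    split; last by exists 1 => x; exact: cos_max.
    have := measurable_cos_dot (\row_j w j) p.
    congr (measurable_fun _ _); apply/funext => x; congr (cos (_ + _)).
    by apply: eq_bigr => j _; rewrite mxE mulrC.
  have [ip _] := leb_prod fi.
  have := bmeasM_integrable measurableT b0 ip.
  congr (integrable _ _ (EFin \o _)); apply/funext => x.
  by rewrite /F mulrC.
split => //; rewrite leb_fubini//.
have FE t x : F (rV_cons (t, x)) = f ord0 t * G (w ord0 * t + p) x.
  rewrite /F !big_ord_recl rV_cons0 /G -mulrA; congr (_ * (_ * cos _)).
    by apply: eq_bigr => j _; rewrite rV_consS.
  rewrite -addrA addrCA; congr (_ + _).
  by apply: eq_bigr => j _; rewrite rV_consS.
under eq_integral => t _.
  under eq_integral => x _ do rewrite FE EFinM.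
  rewrite integralZl//; last by have [] := GI (w ord0 * t + p).
  rewrite -(fineK (integrable_fin_num measurableT (GI (w ord0 * t + p)).1)).
  rewrite -[fine _]/(\int[leb R n]_x G (w ord0 * t + p) x) (GI _).2 -EFinM.
  over.
have [i0 I0] := fc ord0 p.
rewrite big_ord_recl -/P.
transitivity (P * \int[mu]_t (f ord0 t * cos (w ord0 * t + p))).
  rewrite -RintegralZl//; apply: eq_Rintegral => t _; ring.
by rewrite I0 /P; ring.
Qed.

Lemma bspline_leb_transform n (h w : 'I_n -> R) : (forall j, 0 < h j) ->
  \int[leb R n]_x (\prod_(j < n) bspline (x ord0 j / h j) *
     cos (\sum_(j < n) w j * x ord0 j)) = \prod_(j < n) (h j * sinc4 (h j * w j)).
Proof.
move=> h0.
have ib j : mu.-integrable setT (EFin \o (fun t => bspline (t / h j))).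
  have [+ _] := scaled_bspline_transform 0 0 (h0 j).
  congr (integrable _ _ (EFin \o _)); apply/funext => t.
  by rewrite mul0r addr0 cos0 mulr1.
have [_ +] := leb_cos_transform 0 ib
  (fun j q => scaled_bspline_transform (w j) q (h0 j)).
rewrite cos0 mulr1 => <-; apply: eq_Rintegral => x _; by rewrite addr0.
Qed.

End basis_transform.

Section symbols.
Variables (R : realType) (d : nat) (h : 'rV[R]_d).
Hypothesis h0 : forall j, 0 < h ord0 j.
Variable kappa : 'rV[R]_d -> R.
Notation leb := (leb R d).
Hypotheses (kappa0 : forall s, 0 <= kappa s)
  (mkappa : measurable_fun setT kappa)
  (ikappa : leb.-integrable setT (EFin \o (fun s => kappa s * dot s s))).
Notation Psi := (rk_basis h).
Notation L := (Lop kappa).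
Let H := \prod_(j < d) h ord0 j.

Lemma damping_le1 xi r : damping (R := R) (d := d) xi r <= 1.
Proof.
rewrite /damping -[X in _ <= X](expr1n _ #|'I_d|) -prodr_const.
by apply: ler_prod => j _; rewrite sinc4_ge0 sinc4_le1.
Qed.

Section fixed_frequency.
Variable xi : 'rV[R]_d.
Hypothesis xicube : (@cube R d) xi.
Notation om := (shifted_freq h xi).

Lemma rk_basis_transform r :
  \int[leb]_x (Psi 0 x * cos (dot x (om r))) = H * damping xi r.
Proof.
have := @bspline_leb_transform R d (fun j => h ord0 j) (fun j => om r ord0 j) h0.
rewrite big_split /= -/H => E.
rewrite (_ : damping xi r = \prod_(i < d) sinc4 (h ord0 i * om r ord0 i)).
  rewrite -E; apply: eq_Rintegral => x _; rewrite rk_basisE//; congr (_ * cos _).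
    by apply: eq_bigr => j _; rewrite mxE subr0.
  by apply: eq_bigr => j _; rewrite mulrC.
apply: eq_bigr => j _; congr sinc4; rewrite mxE /wave; field; by rewrite gt_eqF.
Qed.

Lemma symbol_summable : zsummable (fun r => ksymbol kappa (om r) * damping xi r).
Proof.
have [B hB] := symbol_sum_bound h xicube kappa0 mkappa ikappa.
apply: (@summable_box _ _ _ B) => N; apply: le_trans (hB N).
by apply: ler_sum => r _; rewrite ger0_norm// mulr_ge0 ?damping_ge0 ?ksymbol_ge0.
Qed.

Lemma symbol_summable2 :
  zsummable (fun r => ksymbol kappa (om r) * damping xi r * damping xi r).
Proof.
have [B hB] := symbol_sum_bound h xicube kappa0 mkappa ikappa.
apply: (@summable_box _ _ _ B) => N; apply: le_trans (hB N).
apply: ler_sum => r _; rewrite ger0_norm ?mulr_ge0 ?damping_ge0 ?ksymbol_ge0//.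
by rewrite ler_piMr ?damping_le1// mulr_ge0 ?damping_ge0 ?ksymbol_ge0.
Qed.

Lemma zsum_symbol : zsum (fun r => ksymbol kappa (om r) * damping xi r) =
  - L (plane_wave h xi) 0.
Proof.
apply: cvg_box_eq; first exact: symbol_summable.
have lim := @cvg_symbol_sum R d h xi h0 xicube kappa kappa0 mkappa ikappa 0.
apply: (cvgn_eq lim) => // N.
by apply: eq_bigr => r _; rewrite dot0l cos0 mulr1.
Qed.

(** The second factor [damping] appears as the transform of [Psi 0] at [w_r]; sum and integral are
    exchanged under the bound [B * |Psi 0|]. *)
Lemma zsum_symbol2 :
  H * zsum (fun r => ksymbol kappa (om r) * damping xi r * damping xi r) =
  \int[leb]_x (Psi 0 x * - L (plane_wave h xi) x).
Proof.
have Hn0 : H != 0 by rewrite prodf_seq_neq0; apply/allP => j _; rewrite gt_eqF.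
rewrite -[RHS](mulVKf Hn0); congr (_ * _).
apply: cvg_box_eq; first exact: symbol_summable2.
have [B hB] := symbol_sum_bound h xicube kappa0 mkappa ikappa.
pose F N x := Psi 0 x * symbol_sum h xi kappa N x.
have mc r : measurable_fun setT (fun x : 'rV[R]_d => cos (dot x (om r))).
  exact: measurable_cos_dot0.
have mF N : measurable_fun setT (F N).
  apply: measurable_funM; first exact: (smooth2_rk_basis h0 0).1.
  rewrite /symbol_sum; elim: (enum_fset _) => [|r q IH].
    by under eq_fun do rewrite big_nil; exact: measurable_cst.
  under eq_fun do rewrite big_cons.
  by apply: measurable_funD => //; apply: measurable_funM.
have cF x : F ^~ x @ \oo --> Psi 0 x * - L (plane_wave h xi) x.
  apply: cvgM; first exact: cvg_cst.
  exact: cvg_symbol_sum.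
have iP := rk_basis_integrable h0 0.
have iB : leb.-integrable setT (EFin \o (fun x => B * `|Psi 0 x|)).
  by have := integrableZl measurableT B (integrable_norm iP).
have dF N x : `|F N x| <= B * `|Psi 0 x|.
  rewrite /F normrM mulrC ler_wpM2r// (le_trans _ (hB N))//.
  apply: le_trans (ler_norm_sum _ _ _) _; apply: ler_sum => r _.
  have a0 : 0 <= ksymbol kappa (om r) * damping xi r.
    by rewrite mulr_ge0 ?damping_ge0 ?ksymbol_ge0.
  by rewrite normrM (ger0_norm a0) ler_piMr// cos_max.
have [_ lim] := dominated_convergence_real mF cF iB dF.
have lim2 : (fun N => H^-1 * \int[leb]_x F N x) @ \oo -->
    H^-1 * \int[leb]_x (Psi 0 x * - L (plane_wave h xi) x).
  by apply: cvgM => //; exact: cvg_cst.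
apply: (cvgn_eq lim2) => // N.
have ir r : leb.-integrable setT (EFin \o (fun x => (ksymbol kappa (om r) * damping xi r) * (Psi 0 x * cos (dot x (om r))))).
  have bc : bmeas (fun x : 'rV[R]_d => cos (dot x (om r))).
    by split; [exact: mc|exists 1 => x; exact: cos_max].
  have := integrableZl measurableT (ksymbol kappa (om r) * damping xi r) (bmeasM_integrable measurableT bc iP).
  apply: eq_integrable => // x _; rewrite /= -!EFinM; congr (_%:E); ring.
transitivity (H^-1 * \int[leb]_x (\sum_(r <- box d N) (ksymbol kappa (om r) * damping xi r) * (Psi 0 x * cos (dot x (om r))))).
  congr (_ * _); apply: eq_Rintegral => x _; rewrite /F /symbol_sum mulr_sumr.
  by apply: eq_bigr => r _; ring.
have [-> _] := Rintegral_sum (box d N) measurableT ir.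
rewrite mulr_sumr; apply: eq_bigr => r _.
rewrite RintegralZl//; last first.
  have bc : bmeas (fun x : 'rV[R]_d => cos (dot x (om r))).
    by split; [exact: mc|exists 1 => x; exact: cos_max].
  have := bmeasM_integrable measurableT bc iP.
  by apply: eq_integrable => // x _; rewrite /= mulrC.
by rewrite rk_basis_transform; field.
Qed.

End fixed_frequency.
End symbols.

Lemma zsumZ (R : realType) d (c : R) (f : 'rV[int]_d -> R) : zsummable f ->
  zsummable (fun k => c * f k) /\ zsum (fun k => c * f k) = c * zsum f.
Proof.
move=> fs; have cfs : zsummable (fun k => c * f k).
  have [M fM] := bound_summable fs.
  apply: (@summable_bound _ _ _ (`|c| * M)) => A.
  rewrite (eq_bigr (fun k => `|c| * `|f k|)) => [|k _]; last by rewrite normrM.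
  by rewrite -mulr_sumr ler_wpM2l.
split => //; apply: cvg_box_eq => //.
have lim : (fun N => c * \sum_(k <- box d N) f k) @ \oo --> c * zsum f.
  by apply: cvgM; [exact: cvg_cst|exact: cvg_box_zsum].
by apply: (cvgn_eq lim) => // N; rewrite mulr_sumr.
Qed.

Lemma le_zsum (R : realType) d (f g : 'rV[int]_d -> R) :
  zsummable f -> zsummable g -> (forall k, f k <= g k) -> zsum f <= zsum g.
Proof.
move=> /cvg_box_zsum cf /cvg_box_zsum cg fg.
rewrite -(cvg_lim _ cf)// -(cvg_lim _ cg)//; apply: ler_lim.
- by apply/cvg_ex; exists (zsum f).
- by apply/cvg_ex; exists (zsum g).
- by apply: nearW => N; exact: ler_sum.
Qed.

Section eigenvalues.
Variables (R : realType) (d : nat) (h : 'rV[R]_d).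
Hypothesis h0 : forall j, 0 < h ord0 j.
Notation leb := (leb R d).
Notation Psi := (rk_basis h).
Let H := \prod_(j < d) h ord0 j.

Section kernel_expansion.
Variables (kappa : 'rV[R]_d -> R) (delta : R).
Hypotheses (delta0 : 0 < delta) (kappa0 : forall s, 0 <= kappa s)
  (mkappa : measurable_fun setT kappa)
  (ikappa : leb.-integrable setT (EFin \o (fun s => kappa s * dot s s)))
  (skappa : forall s, kappa s != 0 -> enorm s < delta).
Notation L := (Lop kappa).

(** The margin 4 is that of the Galerkin form: 2 for [x] ranging over the support of [Psi 0], and 2
    for the support of the summed basis function. One [N] then serves both forms. *)
Lemma collocation_expansion xi N : (forall j, delta / h ord0 j + 4 <= N%:R) ->
  - L (plane_wave h xi) 0 = \sum_(k <- box d N)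
    cos (dot (map_mx intr k) xi) * collocation_coef h kappa k.
Proof.
move=> hN; rewrite /plane_wave (@Lop_interp_box R d h h0 kappa delta delta0 kappa0 mkappa ikappa skappa _ _ N).
  by rewrite -sumrN; apply: eq_bigr => k _; rewrite /collocation_coef mulrN.
by move=> j; rewrite mxE normr0 add0r; have := hN j; lra.
Qed.

Lemma galerkin_expansion xi N : (forall j, delta / h ord0 j + 4 <= N%:R) ->
  \int[leb]_x (Psi 0 x * - L (plane_wave h xi) x) = \sum_(k <- box d N)
    cos (dot (map_mx intr k) xi) * galerkin_coef h kappa k.
Proof.
move=> hN.
have ig k : leb.-integrable setT (EFin \o (fun x => cos (dot (map_mx intr k) xi) * (Psi 0 x * - L (Psi k) x))).
  by have := integrableZl measurableT (cos (dot (map_mx intr k) xi))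
    (galerkin_integrable h0 kappa0 mkappa ikappa 0 k).
transitivity (\int[leb]_x (\sum_(k <- box d N) cos (dot (map_mx intr k) xi) * (Psi 0 x * - L (Psi k) x))).
  apply: eq_Rintegral => x _.
  have [P0|P0] := eqVneq (Psi 0 x) 0.
    by rewrite P0 mul0r big1// => k _; rewrite mul0r mulr0.
  rewrite /plane_wave (@Lop_interp_box R d h h0 kappa delta delta0 kappa0 mkappa ikappa skappa _ _ N).
    by rewrite -sumrN mulr_sumr; apply: eq_bigr => k _; ring.
  move=> j; have := rk_basis_supp h0 j P0; rewrite mxE subr0 coord_div_le// => xj.
  by rewrite mulrDl; have := hN j; lra.
have [-> _] := Rintegral_sum (box d N) measurableT ig.
apply: eq_bigr => k _; rewrite RintegralZl//.
exact: galerkin_integrable.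
Qed.

End kernel_expansion.

Variables (rho : R -> R) (delta : R).
Hypotheses (hrho : kernel_profile d rho) (delta0 : 0 < delta).
Notation kap := (@kern R d rho delta).

Let k0 s : 0 <= kap s. Proof. exact: kern_ge0. Qed.
Let mk := measurable_kern hrho delta0.
Let ik := kern_integrable hrho delta0.
Let sk := @kern_supp R d rho delta.

(** The power of 2 gives each coordinate the factor that turns its sine quotient into [sinc4].
    Collocation is [p = 1] and Galerkin [p = 2]. *)
Let sin_prod p (xi : 'rV[R]_d) (r : 'rV[int]_d) : (@cube R d) xi ->
  2 ^+ (4 * p * d) * \prod_(j < d) (h ord0 j * sin_quot (xi ord0 j) (r ord0 j) ^+ (4 * p)) =
  H * damping xi r ^+ p.
Proof.
move=> xic; rewrite exprM -[X in _ ^+ X * _]card_ord -prodr_const -big_split /=.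
rewrite /damping -prodrXl -big_split /=; apply: eq_bigr => j _.
by rewrite -sin_quotE// -exprM exprMn; ring.
Qed.

Lemma lambda_termE p xi r : (@cube R d) xi ->
  lambda_term (4 * p) rho delta h xi r =
  (2 ^+ (4 * p * d))^-1 * H * (ksymbol kap (shifted_freq h xi r) * damping xi r ^+ p).
Proof.
move=> xic; rewrite /lambda_term symbolE.
apply: (mulfI (_ : 2 ^+ (4 * p * d) != 0)); first by rewrite expf_neq0.
rewrite mulrCA sin_prod// -!mulrA mulVKf ?expf_neq0// /ksymbol; ring.
Qed.

Lemma lambda_C_summable xi : (@cube R d) xi ->
  zsummable (lambda_term 4 rho delta h xi) /\
  lambda_C rho delta h xi = H * - Lop kap (plane_wave h xi) 0.
Proof.
move=> xic.
have [s1 s2] := zsumZ ((2 ^+ (4 * d))^-1 * H) (symbol_summable h k0 mk ik xic).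
have E : lambda_term 4 rho delta h xi =
    fun r => (2 ^+ (4 * d))^-1 * H * (ksymbol kap (shifted_freq h xi r) * damping xi r).
  by apply/funext => r; rewrite -[4%N]/(4 * 1)%N lambda_termE// expr1.
rewrite /lambda_C E; split => //.
rewrite s2 zsum_symbol// -!mulrA mulVKf ?expf_neq0//.
Qed.

Lemma lambda_G_summable xi : (@cube R d) xi ->
  zsummable (lambda_term 8 rho delta h xi) /\
  lambda_G rho delta h xi = \int[leb]_x (Psi 0 x * - Lop kap (plane_wave h xi) x).
Proof.
move=> xic.
have [s1 s2] := zsumZ ((2 ^+ (8 * d))^-1 * H) (symbol_summable2 h k0 mk ik xic).
have E : lambda_term 8 rho delta h xi =
    fun r => (2 ^+ (8 * d))^-1 * H * (ksymbol kap (shifted_freq h xi r) * damping xi r * damping xi r).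
  by apply/funext => r; rewrite -[8%N]/(4 * 2)%N lambda_termE// expr2 mulrA.
rewrite /lambda_G E; split => //.
rewrite s2 -zsum_symbol2// -!mulrA mulVKf ?expf_neq0//.
Qed.

Lemma lambda_C_expansion xi N : (@cube R d) xi ->
  (forall j, delta / h ord0 j + 4 <= N%:R) ->
  lambda_C rho delta h xi = \sum_(k <- box d N)
    cos (dot (map_mx intr k) xi) * (H * collocation_coef h kap k).
Proof.
move=> xic hN; rewrite (lambda_C_summable xic).2.
rewrite (collocation_expansion delta0 k0 mk ik sk _ hN) mulr_sumr.
by apply: eq_bigr => k _; ring.
Qed.

Lemma lambda_G_expansion xi N : (@cube R d) xi ->
  (forall j, delta / h ord0 j + 4 <= N%:R) ->
  lambda_G rho delta h xi = \sum_(k <- box d N)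
    cos (dot (map_mx intr k) xi) * galerkin_coef h kap k.
Proof.
move=> xic hN; rewrite (lambda_G_summable xic).2.
exact: (galerkin_expansion delta0 k0 mk ik sk _ hN).
Qed.

Lemma lambda_G_le_C xi : (@cube R d) xi ->
  lambda_G rho delta h xi <= lambda_C rho delta h xi.
Proof.
move=> xic; have H0 : 0 <= H by apply: prodr_ge0 => j _; exact: ltW.
rewrite (lambda_G_summable xic).2 (lambda_C_summable xic).2.
rewrite -(zsum_symbol2 h0 k0 mk ik xic) -(zsum_symbol h0 k0 mk ik xic).
rewrite ler_wpM2l//.
apply: le_zsum => [||r].
- exact: (symbol_summable2 h k0 mk ik xic).
- exact: (symbol_summable h k0 mk ik xic).
- by rewrite ler_piMr ?damping_le1// mulr_ge0 ?damping_ge0 ?ksymbol_ge0.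
Qed.

End eigenvalues.

(** * Parseval's identity *)

Section L2_limit.
Context d (T : measurableType d) (R : realType).
Variables (mu : {measure set T -> \bar R}) (D : set T).
Hypotheses (mD : measurable D) (Doo : (mu D < +oo)%E).

Let sq2_lt (f1 f2 g1 g2 : T -> R) (e : R) :
  measurable_fun D f1 -> measurable_fun D f2 -> bmeas g1 -> bmeas g2 ->
  (\int[mu]_(x in D) ((f1 x - g1 x) ^+ 2 + (f2 x - g2 x) ^+ 2)%:E < e%:E)%E ->
  mu.-integrable D (EFin \o (fun x => (f1 x - g1 x) ^+ 2 + (f2 x - g2 x) ^+ 2)) /\
  \int[mu]_(x in D) ((f1 x - g1 x) ^+ 2 + (f2 x - g2 x) ^+ 2) < e.
Proof.
move=> mf1 mf2 bg1 bg2 le.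
have i : mu.-integrable D (EFin \o (fun x => (f1 x - g1 x) ^+ 2 + (f2 x - g2 x) ^+ 2)).
  apply/integrableP; split.
    apply/measurable_EFinP; apply: measurable_funD; apply: measurable_funX;
    apply: measurable_funB => //; apply: measurable_funTS.
      exact: bg1.1.
    exact: bg2.1.
  apply: le_lt_trans (lt_trans le (ltry _)); rewrite le_eqVlt; apply/orP; left.
  apply/eqP; apply: eq_integral => x _; rewrite /= ger0_norm//.
  by rewrite addr_ge0// sqr_ge0.
split => //; rewrite -lte_fin; apply: le_lt_trans le.
by rewrite /Rintegral fineK//; exact: integrable_fin_num.
Qed.

(* With [p = f - f'] and [q = g - g'], [f g - f' g' = p g + f q - p q], and each
   product is split by AM-GM with a small weight [t] on the fixed factor. *)
Lemma L2_limit (f1 f2 g1 g2 : T -> R) (sg s : R) : `|sg| <= 1 ->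
  measurable_fun D f1 -> measurable_fun D f2 ->
  measurable_fun D g1 -> measurable_fun D g2 ->
  (forall e, 0 < e -> exists f1' f2' g1' g2' : T -> R,
    [/\ [/\ bmeas f1', bmeas f2', bmeas g1' & bmeas g2'],
    (\int[mu]_(x in D) ((f1 x - f1' x) ^+ 2 + (f2 x - f2' x) ^+ 2)%:E < e%:E)%E,
    (\int[mu]_(x in D) ((g1 x - g1' x) ^+ 2 + (g2 x - g2' x) ^+ 2)%:E < e%:E)%E &
    `|\int[mu]_(x in D) (f1' x * g1' x + sg * (f2' x * g2' x)) - s| < e]) ->
  mu.-integrable D (EFin \o (fun x => f1 x * g1 x + sg * (f2 x * g2 x))) /\
  \int[mu]_(x in D) (f1 x * g1 x + sg * (f2 x * g2 x)) = s.
Proof.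
move=> sg1 mf1 mf2 mg1 mg2 approx.
have bi f : bmeas f -> mu.-integrable D (EFin \o f) by exact: bmeas_integrable.
pose NN x := f1 x ^+ 2 + f2 x ^+ 2 + (g1 x ^+ 2 + g2 x ^+ 2).
have mNN : measurable_fun D NN.
  by apply: measurable_funD; apply: measurable_funD; apply: measurable_funX.
have mQ : measurable_fun D (fun x => f1 x * g1 x + sg * (f2 x * g2 x)).
  apply: measurable_funD; first exact: measurable_funM.
  by apply: measurable_funM => //; exact: measurable_funM.
(* A single approximation, with error 1, shows that the limits are square integrable, by
   [u ^ 2 <= 2 (u - v) ^ 2 + 2 v ^ 2]. *)
have iN : mu.-integrable D (EFin \o NN).
  have [f1' [f2' [g1' [g2' [[b1 b2 b3 b4] Hf Hg _]]]]] := approx 1 ltr01.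
  have [if_ _] := sq2_lt mf1 mf2 b1 b2 Hf; have [ig_ _] := sq2_lt mg1 mg2 b3 b4 Hg.
  have bb : bmeas (fun x => 2 * (f1' x * f1' x + f2' x * f2' x + (g1' x * g1' x + g2' x * g2' x))).
    by apply: bmeasZ; apply: bmeasD; apply: bmeasD; exact: bmeasM.
  have := integrableD mD (integrableZl mD 2 (integrableD mD if_ ig_)) (bi _ bb).
  apply: le_integrable => //; first exact/measurable_EFinP.
  move=> x _; rewrite /= lee_fin [X in _ <= X]ger0_norm; last first.
    rewrite addr_ge0// mulr_ge0// !addr_ge0// ?sqr_ge0// -expr2 sqr_ge0//.
  rewrite ger0_norm; last by rewrite !addr_ge0 ?sqr_ge0.
  have key (u v : R) : u ^+ 2 <= 2 * (u - v) ^+ 2 + 2 * (v * v).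
    by have := sqr_ge0 (u - 2 * v); nra.
  have := key (f1 x) (f1' x); have := key (f2 x) (f2' x).
  have := key (g1 x) (g1' x); have := key (g2 x) (g2' x); rewrite /NN; lra.
have iQ : mu.-integrable D (EFin \o (fun x => f1 x * g1 x + sg * (f2 x * g2 x))).
  apply: le_integrable iN => //; first exact/measurable_EFinP.
  move=> x _; rewrite /= lee_fin [X in _ <= X]ger0_norm; last by rewrite !addr_ge0 ?sqr_ge0.
  have key (u v : R) : `|u * v| <= (u ^+ 2 + v ^+ 2) / 2.
    rewrite ler_norml; have := sqr_ge0 (u - v); have := sqr_ge0 (u + v).
    by move=> *; apply/andP; split; nra.
  apply: le_trans (ler_normD _ _) _; rewrite (normrM sg).
  have h2 : `|sg| * `|f2 x * g2 x| <= `|f2 x * g2 x| by rewrite ler_piMl.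
  have := key (f1 x) (g1 x); have := key (f2 x) (g2 x).
  have := sqr_ge0 (f1 x); have := sqr_ge0 (f2 x); have := sqr_ge0 (g1 x); have := sqr_ge0 (g2 x).
  rewrite /NN; lra.
split => //.
pose I := \int[mu]_(x in D) NN x.
have I0 : 0 <= I by apply: Rintegral_ge0 => x _; rewrite !addr_ge0 ?sqr_ge0.
suff main eta : 0 < eta ->
    `|\int[mu]_(x in D) (f1 x * g1 x + sg * (f2 x * g2 x)) - s| < eta.
  apply/eqP; rewrite -subr_eq0 -normr_le0 leNgt; apply/negP => /main.
  by rewrite ltxx.
move=> eta0.
(* First [t] is fixed so that [t * I <= eta / 4], then [e] so that [c * e = eta / 4], where [c]
   collects the AM-GM weight [1 / t] and the weight 1 of the product [p q]. The total error is below
   [2 * c * e + t * I + e <= eta]. *)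
pose t := eta / (4 * (I + 1)).
have I1 : 0 < I + 1 by lra.
have t0 : 0 < t by rewrite divr_gt0// mulr_gt0.
have tI : t * I <= eta / 4.
  rewrite /t mulrAC ler_pdivrMr ?mulr_gt0//; nra.
pose c := t^-1 + 1.
have c1 : 1 <= c by rewrite lerDr invr_ge0 ltW.
pose e := eta / (4 * c).
have c0 : 0 < c by lra.
have e0 : 0 < e by rewrite divr_gt0// mulr_gt0.
have ce : c * e = eta / 4 by rewrite /e; field; rewrite gt_eqF.
have ee : e <= eta / 4 by rewrite -ce ler_peMl// ltW.
have [f1' [f2' [g1' [g2' [[b1 b2 b3 b4] Hf Hg Hs]]]]] := approx e e0.
have [if_ lf] := sq2_lt mf1 mf2 b1 b2 Hf; have [ig_ lg] := sq2_lt mg1 mg2 b3 b4 Hg.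
have bQ : bmeas (fun x => f1' x * g1' x + sg * (f2' x * g2' x)).
  by apply: bmeasD; [exact: bmeasM|apply: bmeasZ; exact: bmeasM].
have iQ' := bi _ bQ.
pose E1 x := (f1 x - f1' x) ^+ 2 + (f2 x - f2' x) ^+ 2.
pose E2 x := (g1 x - g1' x) ^+ 2 + (g2 x - g2' x) ^+ 2.
have iE : mu.-integrable D (EFin \o (fun x => E1 x + E2 x)).
  by have := integrableD mD if_ ig_; apply: eq_integrable.
have icE : mu.-integrable D (EFin \o (fun x => c * (E1 x + E2 x))).
  by have := integrableZl mD c iE.
have itN : mu.-integrable D (EFin \o (fun x => t * NN x)).
  by have := integrableZl mD t iN.
have idQ : mu.-integrable D (EFin \o (fun x => (f1 x * g1 x + sg * (f2 x * g2 x)) -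
     (f1' x * g1' x + sg * (f2' x * g2' x)))).
  by have := integrableB mD iQ iQ'; apply: eq_integrable.
have ptw x : `|(f1 x * g1 x + sg * (f2 x * g2 x)) - (f1' x * g1' x + sg * (f2' x * g2' x))|
     <= c * (E1 x + E2 x) + t * NN x.
  have amgm (w u v : R) : 0 < w -> `|u * v| <= (w^-1 * u ^+ 2 + w * v ^+ 2) / 2.
    move=> w0; have wn : w != 0 by rewrite gt_eqF.
    have A1 : 0 <= w^-1 * (u - w * v) ^+ 2 by rewrite mulr_ge0 ?sqr_ge0// invr_ge0 ltW.
    have A2 : 0 <= w^-1 * (u + w * v) ^+ 2 by rewrite mulr_ge0 ?sqr_ge0// invr_ge0 ltW.
    have e1 : w^-1 * (u - w * v) ^+ 2 = w^-1 * u ^+ 2 - 2 * (u * v) + w * v ^+ 2 by field.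
    have e2 : w^-1 * (u + w * v) ^+ 2 = w^-1 * u ^+ 2 + 2 * (u * v) + w * v ^+ 2 by field.
    by rewrite ler_norml; apply/andP; split; lra.
  have one (f f' g g' : R) : `|f * g - f' * g'| <=
      c * ((f - f') ^+ 2 + (g - g') ^+ 2) / 2 + t * (f ^+ 2 + g ^+ 2) / 2.
    have -> : f * g - f' * g' = (f - f') * g + (g - g') * f - (f - f') * (g - g') by ring.
    have := amgm t (f - f') g t0; have := amgm t (g - g') f t0.
    have := amgm 1 (f - f') (g - g') ltr01; rewrite invr1 !mul1r /c.
    have := ler_normB ((f - f') * g + (g - g') * f) ((f - f') * (g - g')).
    have := ler_normD ((f - f') * g) ((g - g') * f).
    move: ((f - f') ^+ 2) ((g - g') ^+ 2) (f ^+ 2) (g ^+ 2) (t^-1) `|_| `|_| `|_| `|_| `|_| => *; nra.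
  have -> : (f1 x * g1 x + sg * (f2 x * g2 x)) - (f1' x * g1' x + sg * (f2' x * g2' x))
     = (f1 x * g1 x - f1' x * g1' x) + sg * (f2 x * g2 x - f2' x * g2' x) by ring.
  apply: le_trans (ler_normD _ _) _; rewrite (normrM sg).
  have o1 := one (f1 x) (f1' x) (g1 x) (g1' x); have o2 := one (f2 x) (f2' x) (g2 x) (g2' x).
  have h2 : `|sg| * `|f2 x * g2 x - f2' x * g2' x| <= `|f2 x * g2 x - f2' x * g2' x| by rewrite ler_piMl.
  have E0 : 0 <= c * (E1 x + E2 x) by rewrite mulr_ge0 ?(ltW c0)// !addr_ge0 ?sqr_ge0.
  have N0 : 0 <= t * NN x by rewrite mulr_ge0 ?(ltW t0)// !addr_ge0 ?sqr_ge0.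
  apply: (le_trans (lerD o1 (le_trans h2 o2))); move: E0 N0; rewrite /E1 /E2 /NN; lra.
have dist : `|\int[mu]_(x in D) (f1 x * g1 x + sg * (f2 x * g2 x)) -
    \int[mu]_(x in D) (f1' x * g1' x + sg * (f2' x * g2' x))| <= c * (2 * e) + t * I.
  rewrite -RintegralB//; apply: le_trans (le_normr_Rintegral mD idQ) _.
  apply: (@le_trans _ _ (\int[mu]_(x in D) (c * (E1 x + E2 x) + t * NN x))).
    apply: le_Rintegral => //; first exact: (integrable_norm idQ).
    by have := integrableD mD icE itN; apply: eq_integrable.
  rewrite RintegralD// !RintegralZl// RintegralD// lerD2r ler_pM2l//.
  move: lf lg; rewrite -/(E1 _) -/(E2 _) => lf lg.
  have := ltW (ltrD lf lg); rewrite /E1 /E2; lra.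
have -> : \int[mu]_(x in D) (f1 x * g1 x + sg * (f2 x * g2 x)) - s =
  (\int[mu]_(x in D) (f1 x * g1 x + sg * (f2 x * g2 x)) -
    \int[mu]_(x in D) (f1' x * g1' x + sg * (f2' x * g2' x))) +
  (\int[mu]_(x in D) (f1' x * g1' x + sg * (f2' x * g2' x)) - s) by ring.
apply: le_lt_trans (ler_normD _ _) _.
have := ltr_leD Hs dist; lra.
Qed.

End L2_limit.

Lemma measurable_cube (R : realType) d : measurable (@cube R d).
Proof.
have -> : @cube R d =
    \bigcap_(i in [set: 'I_d]) (rV_coord i @^-1` `]- pi, pi[%classic).
  apply/seteqP; split => x /= h i; first by move=> _; rewrite /= in_itv /= h.
  by have := h i I; rewrite /= in_itv.
apply: fin_bigcap_measurable; first exact: finite_finset.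
move=> i _; rewrite -[X in measurable X]setTI.
by apply: (measurable_rV_coord i) => //; exact: measurable_itv.
Qed.

Lemma leb_cube_fin (R : realType) d : (leb R d (@cube R d) < +oo)%E.
Proof.
pose b : 'rV[R]_d := const_mx pi.
have := @leb_box R d (- b) b; move=> H.
apply: (@le_lt_trans _ _ (leb R d (rV_box (- b) b))).
  apply: le_measure; rewrite ?inE.
  - exact: measurable_cube.
  - exact: measurable_rV_box.
  - by move=> x xc j; have /andP[x1 x2] := xc j; rewrite !mxE !ltW.
rewrite H ?ltry// => j; rewrite !mxE; have := pi_gt0 R; lra.
Qed.

Section orthogonality.
Variables (R : realType) (d : nat).
Notation cube := (@cube R d).
Notation leb := (leb R d).
Notation mu := (@lebesgue_measure R).

(** The indicator of the cube is a product of these one-dimensional ones, so [leb_cos_transform]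
    computes integrals over the cube. *)
Let chi (t : R) : R := (t \in `]- pi, pi[%classic)%:R.

Let chiM (g : R -> R) : (fun t => chi t * g t) = g \_ `]- pi, pi[%classic.
Proof. by apply/funext => t; rewrite /chi patchE; case: ifP; rewrite ?mul1r ?mul0r. Qed.

Let cos_itv (n : int) (q : R) :
  mu.-integrable setT (EFin \o (fun t => chi t * cos (n%:~R * t + q))) /\
  \int[mu]_t (chi t * cos (n%:~R * t + q)) = (if n == 0 then 2 * pi else 0) * cos q.
Proof.
have p0 := pi_gt0 R.
have bc := bmeas_cosM (n%:~R) q.
pose c (t : measurableTypeR R) := cos (n%:~R * t + q).
have i b0 b1 : mu.-integrable [set` Interval (BSide b0 (- pi)) (BSide b1 pi)] (EFin \o c).
  apply: bmeas_integrable => //; by rewrite /= lebesgue_measure_itv/=; case: ifP; rewrite ?ltry.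
split.
  rewrite chiM -restrict_EFin.
  have mD : measurable (`]- pi, pi[%classic : set R) by exact: measurable_itv.
  by have := (integrable_mkcond (mu := mu) (EFin \o c) mD).1 (i _ _).
rewrite chiM -Rintegral_mkcond.
have -> : \int[mu]_(t in `]- pi, pi[) c t = \int[mu]_(t in `[- pi, pi]) c t.
  rewrite Rintegral_itv_obnd_cbnd; last exact: i.
  by rewrite Rintegral_itv_bndo_bndc//; exact: i.
have [n0|n0] := eqVneq n 0.
  transitivity (\int[mu]_(t in `[(- pi : R), pi]) cst (cos q) t).
    by apply: eq_Rintegral => t _; rewrite /c n0 mulr0z mul0r add0r.
  rewrite Rintegral_cst//= lebesgue_measure_itv/= lte_fin gtrN//.
  by rewrite -EFinD /= opprK mulrC; congr (_ * _); ring.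
rewrite mul0r (@Rintegral_cosM R (n%:~R) q)//; last by rewrite intr_eq0.
  rewrite [X in sin X - _](_ : _ = n%:~R * - pi + q + 2 * pi * n%:~R); last by ring.
  by rewrite sin_period subrr mul0r.
by rewrite gtrN.
Qed.

Lemma cube_cos (k : 'rV[int]_d) (p : R) :
  \int[leb]_(xi in cube) cos (dot (map_mx intr k) xi + p) =
  (if k == 0 then (2 * pi) ^+ d else 0) * cos p.
Proof.
have ichi (j : 'I_d) : mu.-integrable setT (EFin \o (fun t => chi t)).
  have [+ _] := cos_itv 0 0; apply: eq_integrable => // t _.
  by rewrite /= mul0r add0r cos0 mulr1.
have [_] := leb_cos_transform (f := fun=> chi) p ichi (fun j : 'I_d => cos_itv (k ord0 j)).
have -> : \prod_(j < d) (if k ord0 j == 0 then 2 * pi else 0 : R) =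
    if k == 0 then (2 * pi) ^+ d else 0.
  case: eqP => [->|/eqP k0].
    under eq_bigr do rewrite mxE eqxx.
    by rewrite prodr_const card_ord.
  have /existsP[j kj] : [exists j, k ord0 j != 0].
    apply: contraR k0; rewrite negb_exists => /forallP k0.
    by apply/eqP/rowP => j; rewrite mxE; apply/eqP; have := k0 j; rewrite negbK.
  by rewrite (bigD1 j)//= (negbTE kj) mul0r.
move=> <-; rewrite Rintegral_mkcond; apply: eq_Rintegral => x _.
rewrite patchE; case: ifPn => xc.
  rewrite big1 ?mul1r; last first.
    move=> j _; rewrite /chi mem_set//=; rewrite inE in xc.
    by rewrite in_itv; exact: xc.
  congr (cos (_ + _)); apply: eq_bigr => j _; by rewrite !mxE.
suff [j xj] : exists j : 'I_d, chi (x ord0 j) = 0 by rewrite (bigD1 j)//= xj !mul0r.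
apply: contrapT => nx; move/negP : xc; apply; rewrite inE => j.
apply: contrapT => xj; apply: nx; exists j; rewrite /chi memNset//= in_itv.
Qed.

Lemma bmeas_cos_dot (w : 'rV[R]_d) p : bmeas (fun xi : 'rV[R]_d => cos (dot w xi + p)).
Proof.
split; last by exists 1 => x; exact: cos_max.
by have := measurable_cos_dot w p; congr (measurable_fun _ _); apply/funext => x; rewrite dotC.
Qed.

Lemma bmeas_sin_dot (w : 'rV[R]_d) : bmeas (fun xi : 'rV[R]_d => sin (dot w xi)).
Proof.
have := bmeas_cos_dot w (- (pi / 2)); congr bmeas.
by apply/funext => x; rewrite cosBpihalf.
Qed.

Implicit Types (u w : 'rV[int]_d -> R) (B : {fset 'rV[int]_d}).

Lemma Re_fourier_sum u B xi : complex.Re (fourier_sum u B xi) =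
  \sum_(k <- B) u k * cos (dot (map_mx intr k) xi).
Proof.
rewrite /fourier_sum Re_sum; apply: eq_bigr => k _.
by rewrite mulrC ReCM cosN.
Qed.

Lemma Im_fourier_sum u B xi : complex.Im (fourier_sum u B xi) =
  - \sum_(k <- B) u k * sin (dot (map_mx intr k) xi).
Proof.
rewrite /fourier_sum Im_sum -sumrN; apply: eq_bigr => k _.
by rewrite mulrC ImCM sinN mulrN.
Qed.

Lemma bmeas_Re_fourier_sum u B : bmeas (fun xi => complex.Re (fourier_sum u B xi)).
Proof.
under eq_fun do rewrite Re_fourier_sum.
apply: bmeas_sum => k; apply: bmeasZ.
by have := bmeas_cos_dot (map_mx intr k) 0; under eq_fun do rewrite addr0.
Qed.

Lemma bmeas_Im_fourier_sum u B : bmeas (fun xi => complex.Im (fourier_sum u B xi)).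
Proof.
under eq_fun do rewrite Im_fourier_sum.
by apply: bmeasN; apply: bmeas_sum => k; apply: bmeasZ; exact: bmeas_sin_dot.
Qed.

(** Orthogonality leaves the diagonal. The phase [p = 0] gives the real part of Parseval's identity,
    and [p = pi / 2] turns the cosine into the sine of its imaginary part. *)
Lemma cube_double_sum u w B p :
  \int[leb]_(xi in cube) (\sum_(k <- B) \sum_(l <- B)
     u k * w l * cos (dot (map_mx intr k) xi - dot (map_mx intr l) xi + p)) =
  (2 * pi) ^+ d * cos p * \sum_(k <- B) u k * w k.
Proof.
have E (k l : 'rV[int]_d) (xi : 'rV[R]_d) :
    dot (map_mx intr k) xi - dot (map_mx intr l) xi = dot (map_mx intr (k - l)) xi.
  rewrite /dot -sumrB; apply: eq_bigr => j _.
  by rewrite !mxE rmorphB /= mulrBl.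
have mc := @measurable_cube R d.
have i (k l : 'rV[int]_d) : leb.-integrable cube (EFin \o (fun xi =>
    u k * w l * cos (dot (map_mx intr k) xi - dot (map_mx intr l) xi + p))).
  apply: bmeas_integrable => //; first exact: leb_cube_fin.
  by apply: bmeasZ; under eq_fun do rewrite E; exact: bmeas_cos_dot.
have [-> _] := Rintegral_sum B mc (fun k => (Rintegral_sum B mc (i k)).2).
rewrite mulr_sumr; apply: eq_big_seq => k kB.
have [-> _] := Rintegral_sum B mc (i k).
rewrite (bigD1_seq k)//= big1.
  rewrite addr0 RintegralZl//; last first.
    apply: bmeas_integrable => //; first exact: leb_cube_fin.
    by under eq_fun do rewrite E; exact: bmeas_cos_dot.
  under eq_Rintegral do rewrite E.
  by rewrite cube_cos subrr eqxx; ring.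
move=> l lk; rewrite RintegralZl//; last first.
  apply: bmeas_integrable => //; first exact: leb_cube_fin.
  by under eq_fun do rewrite E; exact: bmeas_cos_dot.
under eq_Rintegral do rewrite E.
by rewrite cube_cos subr_eq0 eq_sym (negbTE lk); ring.
Qed.

(** Convergence along finite sets is directed, so one set [B] approximates both series and the sum
    at once; [L2_limit] then passes to the limit. *)
Lemma parseval u w (f g : 'rV[R]_d -> R[i]) :
  is_fourier_series u f -> is_fourier_series w g ->
  zsummable (fun k => u k * w k) ->
  cintegrable cube (fun xi => f xi * (g xi)^*) /\
  cintegral cube (fun xi => f xi * (g xi)^*) =
    ((2 * pi) ^+ d * zsum (fun k => u k * w k))%:C%C.
Proof.
move=> [mf1 mf2 fu] [mg1 mg2 gw] uws.
have P0 : 0 < (2 * pi : R) ^+ d by rewrite exprn_gt0// mulr_gt0// pi_gt0.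
have mc := @measurable_cube R d.
have approx (e : R) : 0 < e -> exists B, [/\
    (\int[leb]_(xi in cube) (complex.Re (f xi - fourier_sum u B xi) ^+ 2 +
            complex.Im (f xi - fourier_sum u B xi) ^+ 2)%:E < e%:E)%E,
    (\int[leb]_(xi in cube) (complex.Re (g xi - fourier_sum w B xi) ^+ 2 +
            complex.Im (g xi - fourier_sum w B xi) ^+ 2)%:E < e%:E)%E &
    `|(2 * pi) ^+ d * \sum_(k <- B) u k * w k -
      (2 * pi) ^+ d * zsum (fun k => u k * w k)| < e].
  move=> e0; have [A1 H1] := fu e e0; have [A2 H2] := gw e e0.
  have [A3 H3] := zsum_has_zsum uws (divr_gt0 e0 P0).
  exists (A1 `|` A2 `|` A3)%fset; split.
  - by apply: H1; rewrite -fsetUA fsubsetUl.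
  - by apply: H2; rewrite (fsetUC A1) -fsetUA fsubsetUl.
  - rewrite -mulrBr normrM gtr0_norm// mulrC -ltr_pdivlMr//.
    by apply: H3; rewrite fsubsetUr.
have normsq (a b : R[i]) : complex.Re (a - b) ^+ 2 + complex.Im (a - b) ^+ 2 =
    (complex.Re a - complex.Re b) ^+ 2 + (complex.Im a - complex.Im b) ^+ 2.
  by case: a; case: b.
have ReJ (a b : R[i]) : complex.Re (a * b^*) =
    complex.Re a * complex.Re b + 1 * (complex.Im a * complex.Im b).
  by case: a => ? ?; case: b => ? ? /=; ring.
have ImJ (a b : R[i]) : complex.Im (a * b^*) =
    complex.Im a * complex.Re b + -1 * (complex.Re a * complex.Im b).
  by case: a => ? ?; case: b => ? ? /=; ring.
have [iR IR] : leb.-integrable cube (EFin \o fun xi => complex.Re (f xi * (g xi)^*)) /\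
    \int[leb]_(xi in cube) complex.Re (f xi * (g xi)^*) =
    (2 * pi) ^+ d * zsum (fun k => u k * w k).
  under eq_Rintegral do rewrite ReJ; under eq_fun do rewrite ReJ.
  apply: L2_limit => //; [exact: leb_cube_fin|by rewrite normr1|] => e /approx[B [h1 h2 h3]].
  exists (fun xi => complex.Re (fourier_sum u B xi)), (fun xi => complex.Im (fourier_sum u B xi)).
  exists (fun xi => complex.Re (fourier_sum w B xi)), (fun xi => complex.Im (fourier_sum w B xi)).
  split.
  - by split; try exact: bmeas_Re_fourier_sum; exact: bmeas_Im_fourier_sum.
  - by move: h1; congr (_ < _)%E; apply: eq_integral => xi _; rewrite normsq.
  - by move: h2; congr (_ < _)%E; apply: eq_integral => xi _; rewrite normsq.
  - move: h3; have := cube_double_sum u w B 0; rewrite cos0 mulr1 => <-.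
    congr (`|_ - _| < _); apply: eq_Rintegral => xi _.
    rewrite !Re_fourier_sum !Im_fourier_sum mul1r mulrNN !big_distrlr -big_split /=.
    apply: eq_bigr => k _; rewrite -big_split /=; apply: eq_bigr => l _.
    by rewrite addr0 cosB; ring.
(* Exchanging the real and imaginary parts of the first function, with sign [-1], puts the imaginary
   part in the shape of [L2_limit]. *)
have [iI II] : leb.-integrable cube (EFin \o fun xi => complex.Im (f xi * (g xi)^*)) /\
    \int[leb]_(xi in cube) complex.Im (f xi * (g xi)^*) = 0.
  under eq_Rintegral do rewrite ImJ; under eq_fun do rewrite ImJ.
  apply: L2_limit => //; [exact: leb_cube_fin|by rewrite normrN1|] => e /approx[B [h1 h2 h3]].
  exists (fun xi => complex.Im (fourier_sum u B xi)), (fun xi => complex.Re (fourier_sum u B xi)).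
  exists (fun xi => complex.Re (fourier_sum w B xi)), (fun xi => complex.Im (fourier_sum w B xi)).
  split.
  - by split; try exact: bmeas_Re_fourier_sum; exact: bmeas_Im_fourier_sum.
  - by move: h1; congr (_ < _)%E; apply: eq_integral => xi _; rewrite normsq addrC.
  - by move: h2; congr (_ < _)%E; apply: eq_integral => xi _; rewrite normsq.
  - have := cube_double_sum u w B (pi / 2); rewrite cos_pihalf mulr0 mul0r => E.
    rewrite [X in `|X - _|](_ : _ = 0) ?subrr ?normr0; last first.
      rewrite -E; apply: eq_Rintegral => xi _.
      rewrite !Re_fourier_sum !Im_fourier_sum mulN1r mulrN opprK mulNr !big_distrlr -sumrN -big_split /=.
      apply: eq_bigr => k _; rewrite -sumrN -big_split /=; apply: eq_bigr => l _.
      by rewrite cosDpihalf sinB; ring.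
    exact: le_lt_trans (normr_ge0 _) h3.
by split; [split|rewrite /cintegral IR II].
Qed.

End orthogonality.

(** * Trigonometric polynomials as multipliers *)

Section fourier_multiplier.
Variables (R : realType) (d : nat).
Notation cube := (@cube R d).
Notation leb := (leb R d).
Implicit Types (u v w : 'rV[int]_d -> R) (f g : 'rV[R]_d -> R[i]).

Definition shift_fset (m : 'rV[int]_d) (B : {fset 'rV[int]_d}) : {fset 'rV[int]_d} :=
  [fset (k + m)%R | k : 'rV[int]_d in B]%fset.

Lemma sum_shift_fset (V : nmodType) m B (F : 'rV[int]_d -> V) :
  \sum_(k <- shift_fset m B) F k = \sum_(k <- B) F (k + m).
Proof. by rewrite big_imfset//= => k l _ _ /addIr. Qed.

Lemma shift_fsetK m B : shift_fset m (shift_fset (- m) B) = B.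
Proof.
apply/fsetP => k; apply/imfsetP/idP => /= [[l /imfsetP[j /= jB ->] ->]|kB].
  by rewrite addrNK.
by exists (k - m); rewrite ?addrNK//; apply/imfsetP; exists k.
Qed.

Lemma shift_fset_sub m A B : (shift_fset (- m) A `<=` B)%fset ->
  (A `<=` shift_fset m B)%fset.
Proof.
move=> AB; rewrite -(shift_fsetK m A); apply/fsubsetP => k /imfsetP[l /= lA ->].
by apply/imfsetP; exists l => //=; exact: (fsubsetP AB).
Qed.

Lemma dot_intrD (k m : 'rV[int]_d) (xi : 'rV[R]_d) :
  dot (map_mx intr (k + m)) xi = dot (map_mx intr k) xi + dot (map_mx intr m) xi.
Proof.
rewrite /dot -big_split; apply: eq_bigr => j _.
by rewrite !mxE rmorphD /= mulrDl.
Qed.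

(** A modulation has modulus one, so it preserves the L^2 error; the finite index sets are
    translated along. *)
Lemma fourier_series_shift m v g : is_fourier_series v g ->
  is_fourier_series (fun k => v (k + m))
    (fun xi => expi (dot (map_mx intr m) xi) * g xi).
Proof.
move=> [mg1 mg2 vg].
have mC : measurable_fun cube (fun xi => cos (dot (map_mx intr m) xi)).
  apply: measurable_funTS.
  by have := (bmeas_cos_dot (map_mx intr m : 'rV[R]_d) 0).1; under eq_fun do rewrite addr0.
have mS : measurable_fun cube (fun xi => sin (dot (map_mx intr m) xi)).
  by apply: measurable_funTS; exact: (bmeas_sin_dot (map_mx intr m : 'rV[R]_d)).1.
split.
- under eq_fun do rewrite ReM /=.
  by apply: measurable_funB; exact: measurable_funM.
- under eq_fun do rewrite ImM /=.
  by apply: measurable_funD; exact: measurable_funM.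
move=> e e0; have [A HA] := vg e e0.
exists (shift_fset (- m) A) => B /shift_fset_sub/HA; congr (_ < _)%E.
apply: eq_integral => xi _.
have -> : fourier_sum (fun k => v (k + m)) B xi =
    expi (dot (map_mx intr m) xi) * fourier_sum v (shift_fset m B) xi.
  rewrite /fourier_sum sum_shift_fset mulr_sumr; apply: eq_bigr => k _.
  rewrite mulrA -expiD dot_intrD; congr (expi _ * _); ring.
rewrite -mulrBr; move: (g xi - _) => z.
rewrite ReM ImM /=; congr (_%:E).
have := cos2Dsin2 (dot (map_mx intr m) xi).
move: (cos _) (sin _) => c s cs.
transitivity ((c ^+ 2 + s ^+ 2) * (complex.Re z ^+ 2 + complex.Im z ^+ 2)); last by ring.
by rewrite cs mul1r.
Qed.

Lemma fourier_seriesD (c : R) v w f g :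
  is_fourier_series v f -> is_fourier_series w g ->
  is_fourier_series (fun k => c * v k + w k) (fun xi => c%:C%C * f xi + g xi).
Proof.
move=> [mf1 mf2 vf] [mg1 mg2 wg]; have mc := @measurable_cube R d.
split.
- under eq_fun do rewrite ReD ReM /= mul0r subr0.
  by apply: measurable_funD => //; exact: measurable_funM.
- under eq_fun do rewrite ImD ImM /= mul0r addr0.
  by apply: measurable_funD => //; exact: measurable_funM.
move=> e e0.
(* From [|c p + q|^2 <= 2 c^2 |p|^2 + 2 |q|^2], each error contributes at most [e / 2]; the summand
   1 keeps the divisor positive when [c = 0]. *)
have c0 : 0 < 4 * (c ^+ 2 + 1) by rewrite mulr_gt0// ltr_wpDl// sqr_ge0.
have [A1 H1] := vf _ (divr_gt0 e0 c0).
have [A2 H2] := wg (e / 4) (divr_gt0 e0 (ltr0n _ 4)).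
exists (A1 `|` A2)%fset => B AB.
have {}H1 := H1 B (fsubset_trans (fsubsetUl _ _) AB).
have {}H2 := H2 B (fsubset_trans (fsubsetUr _ _) AB).
pose X xi := complex.Re (f xi - fourier_sum v B xi) ^+ 2 +
            complex.Im (f xi - fourier_sum v B xi) ^+ 2.
pose Y xi := complex.Re (g xi - fourier_sum w B xi) ^+ 2 +
            complex.Im (g xi - fourier_sum w B xi) ^+ 2.
have mD (z : 'rV[R]_d -> R[i]) u' : measurable_fun cube (fun xi => complex.Re (z xi)) ->
   measurable_fun cube (fun xi => complex.Im (z xi)) ->
   measurable_fun cube (fun xi => complex.Re (z xi - fourier_sum u' B xi) ^+ 2 +
     complex.Im (z xi - fourier_sum u' B xi) ^+ 2).
  move=> m1 m2; rewrite (_ : (fun xi => _) = (fun xi =>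
      (complex.Re (z xi) - complex.Re (fourier_sum u' B xi)) ^+ 2 +
      (complex.Im (z xi) - complex.Im (fourier_sum u' B xi)) ^+ 2)).
    apply: measurable_funD; apply: measurable_funX; apply: measurable_funB => //;
    apply: measurable_funTS.
      by have [] := bmeas_Re_fourier_sum u' B.
    by have [] := bmeas_Im_fourier_sum u' B.
  by apply/funext => xi; case: (z xi) => ? ?; case: (fourier_sum _ _ _).
have mX : measurable_fun cube (EFin \o X) by apply/measurable_EFinP; exact: mD.
have mY : measurable_fun cube (EFin \o Y) by apply/measurable_EFinP; exact: mD.
have X0 xi : (0 <= (X xi)%:E)%E by rewrite lee_fin addr_ge0 ?sqr_ge0.
have Y0 xi : (0 <= (Y xi)%:E)%E by rewrite lee_fin addr_ge0 ?sqr_ge0.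
have k0 : 0 <= 2 * c ^+ 2 by rewrite mulr_ge0 ?sqr_ge0.
have le : (\int[leb]_(xi in cube) (complex.Re (c%:C%C * f xi + g xi - fourier_sum (fun k => c * v k + w k) B xi) ^+ 2 +
     complex.Im (c%:C%C * f xi + g xi - fourier_sum (fun k => c * v k + w k) B xi) ^+ 2)%:E <=
   (2 * c ^+ 2)%:E * \int[leb]_(xi in cube) (X xi)%:E + 2%:E * \int[leb]_(xi in cube) (Y xi)%:E)%E.
  rewrite -ge0_integralZl// -ge0_integralZl// -ge0_integralD//; last 4 first.
  - by move=> xi _; rewrite mule_ge0// lee_fin.
  - exact: measurable_funeM.
  - by move=> xi _; rewrite mule_ge0// lee_fin.
  - exact: measurable_funeM.
  apply: ge0_le_integral => //.
  - by move=> xi _; rewrite lee_fin addr_ge0 ?sqr_ge0.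
  - apply/measurable_EFinP; apply: (mD (fun xi => c%:C%C * f xi + g xi)).
    + under eq_fun do rewrite ReD ReM /= mul0r subr0.
      by apply: measurable_funD => //; exact: measurable_funM.
    + under eq_fun do rewrite ImD ImM /= mul0r addr0.
      by apply: measurable_funD => //; exact: measurable_funM.
  - by apply: emeasurable_funD; exact: measurable_funeM.
  - move=> xi _; rewrite -!EFinM -EFinD lee_fin /X /Y.
    have -> : c%:C%C * f xi + g xi - fourier_sum (fun k => c * v k + w k) B xi =
       c%:C%C * (f xi - fourier_sum v B xi) + (g xi - fourier_sum w B xi).
      rewrite (_ : fourier_sum (fun k => c * v k + w k) B xi = c%:C%C * fourier_sum v B xi + fourier_sum w B xi).
        ring.
      rewrite /fourier_sum mulr_sumr -big_split /=; apply: eq_bigr => k _.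
      rewrite rmorphD rmorphM /=; ring.
    move: (f xi - _) (g xi - _) => [x1 x2] [y1 y2] /=.
    rewrite !mul0r subr0 addr0.
    have := sqr_ge0 (c * x1 - y1); have := sqr_ge0 (c * x2 - y2); nra.
apply: le_lt_trans le _.
have fX : (\int[leb]_(xi in cube) (X xi)%:E)%E \is a fin_num.
  by rewrite ge0_fin_numE; [exact: lt_trans H1 (ltry _)|exact: integral_ge0].
have fY : (\int[leb]_(xi in cube) (Y xi)%:E)%E \is a fin_num.
  by rewrite ge0_fin_numE; [exact: lt_trans H2 (ltry _)|exact: integral_ge0].
have X1 : (0 <= \int[leb]_(xi in cube) (X xi)%:E)%E by exact: integral_ge0.
move: H1 H2 X1; rewrite -[(\int[leb]_(xi in _) _)%E]/(\int[leb]_(xi in cube) (X xi)%:E)%E.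
rewrite -[X in _ -> (X < _)%E -> _]/(\int[leb]_(xi in cube) (Y xi)%:E)%E.
rewrite -(fineK fX) -(fineK fY); move: (fine _) (fine _) => a b.
rewrite -!EFinM -EFinD !lte_fin lee_fin ltr_pdivlMr// => H1 H2 a0.
by nra.
Qed.

Lemma fourier_series0 : is_fourier_series ((fun=> 0) : 'rV[int]_d -> R) (fun=> 0).
Proof.
split; [exact: measurable_cst|exact: measurable_cst|].
move=> e e0; exists fset0 => B _.
have S0 (xi : 'rV[R]_d) : fourier_sum ((fun=> 0) : 'rV[int]_d -> R) B xi = 0.
  by rewrite /fourier_sum big1// => k _; rewrite mulr0.
rewrite integral0_eq ?lte_fin// => xi _.
by rewrite S0 subrr /= expr0n addr0.
Qed.

Lemma fourier_series_sum I (r : seq I) (a : I -> R) (v : I -> 'rV[int]_d -> R)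
    (f : I -> 'rV[R]_d -> R[i]) :
  (forall i, is_fourier_series (v i) (f i)) ->
  is_fourier_series (fun k => \sum_(i <- r) a i * v i k)
    (fun xi => \sum_(i <- r) (a i)%:C%C * f i xi).
Proof.
move=> vf; elim: r => [|i r IH].
  under eq_fun do rewrite big_nil; under [X in is_fourier_series _ X]eq_fun do rewrite big_nil.
  exact: fourier_series0.
under eq_fun do rewrite big_cons; under [X in is_fourier_series _ X]eq_fun do rewrite big_cons.
exact: fourier_seriesD.
Qed.

Lemma eq_fourier_series v f g : (forall xi, cube xi -> f xi = g xi) ->
  is_fourier_series v f -> is_fourier_series v g.
Proof.
move=> fg [mf1 mf2 vf]; split.
- apply: eq_measurable_fun mf1 => xi; rewrite inE => xic; by rewrite fg.
- apply: eq_measurable_fun mf2 => xi; rewrite inE => xic; by rewrite fg.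
move=> e e0; have [A HA] := vf e e0; exists A => B /HA; congr (_ < _)%E.
by apply: eq_integral => xi; rewrite inE => xic; rewrite fg.
Qed.

Lemma sum_box_opp (V : nmodType) N (F : 'rV[int]_d -> V) :
  \sum_(k <- box d N) F k = \sum_(k <- box d N) F (- k).
Proof.
rewrite -(big_map (fun k => - k) xpredT F); apply: perm_big; apply: uniq_perm.
- exact: fset_uniq.
- by rewrite map_inj_uniq ?fset_uniq//; exact: oppr_inj.
have boxN k : (- k \in box d N) = (k \in box d N).
  by rewrite !mem_box; apply: eq_forallb => j; rewrite mxE normrN.
move=> k; apply/idP/mapP => [kb|[l lb ->]]; last by rewrite boxN.
by exists (- k); rewrite ?opprK// boxN.
Qed.

(* [lam] is the trigonometric polynomial with coefficients [a], whose sine part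
   vanishes as [a] is even, so it acts on [v] as a convolution. *)
Lemma fourier_series_multiplier (lam : 'rV[R]_d -> R) N (a : 'rV[int]_d -> R) v g :
  (forall k, a (- k) = a k) ->
  (forall xi, cube xi -> lam xi = \sum_(k <- box d N) cos (dot (map_mx intr k) xi) * a k) ->
  is_fourier_series v g ->
  is_fourier_series (fun k => \sum_(m <- box d N) a m * v (k + m))
    (fun xi => (lam xi)%:C%C * g xi).
Proof.
move=> aN lamE vg.
have := fourier_series_sum (box d N) a (fun m => fourier_series_shift m vg).
apply: eq_fourier_series => xi /lamE ->.
under eq_bigr do rewrite mulrA; rewrite -mulr_suml; congr (_ * _).
apply/eqP; rewrite eq_complex; apply/andP; split; apply/eqP.
  by rewrite Re_sum; apply: eq_bigr => m _; rewrite ReCM mulrC.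
rewrite Im_sum [RHS]/=; under eq_bigr do rewrite ImCM.
set S := \sum_(m <- _) _.
have : S = - S.
  rewrite {1}/S sum_box_opp /S -sumrN; apply: eq_bigr => m _.
  have -> : dot (map_mx intr (- m)) xi = - dot (map_mx intr m) xi.
    by rewrite -dotNl; congr dot; apply/rowP => j; rewrite !mxE rmorphN.
  by rewrite aN sinN mulrN.
by move=> H; lra.
Qed.

Lemma zsummable_prod_shift u v m : square_summable u -> square_summable v ->
  zsummable (fun k => u k * v (k + m)).
Proof.
move=> /bound_summable[M uM] /bound_summable[M' vM].
apply: (@summable_bound _ _ _ ((M + M') / 2)) => A.
apply: (@le_trans _ _ (\sum_(k <- A) (u k ^+ 2 + v (k + m) ^+ 2) / 2)).
  apply: ler_sum => k _; rewrite ler_norml.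
  have := sqr_ge0 (u k - v (k + m)); have := sqr_ge0 (u k + v (k + m)).
  by move=> *; apply/andP; split; nra.
rewrite -mulr_suml big_split /= ler_pM2r ?invr_gt0// lerD//.
  by apply: le_trans (uM A); apply: ler_sum => k _; exact: ler_norm.
apply: le_trans (vM (shift_fset m A)); rewrite sum_shift_fset.
by apply: ler_sum => k _; exact: ler_norm.
Qed.

Lemma zsummable_sum I (r : seq I) (a : I -> R) (f : I -> 'rV[int]_d -> R) :
  (forall i, zsummable (f i)) -> zsummable (fun k => \sum_(i <- r) a i * f i k).
Proof.
move=> fs; elim: r => [|i r /bound_summable[M IH]].
  under eq_fun do rewrite big_nil.
  by apply: (@summable_bound _ _ _ 0) => A; rewrite big1// => k _; rewrite normr0.
have [M' fM] := bound_summable (fs i).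
apply: (@summable_bound _ _ _ (`|a i| * M' + M)) => A.
apply: (@le_trans _ _ (\sum_(k <- A) (`|a i| * `|f i k| + `|\sum_(j <- r) a j * f j k|))).
  by apply: ler_sum => k _; rewrite big_cons -normrM ler_normD.
by rewrite big_split /= -mulr_sumr lerD// ler_wpM2l.
Qed.

(** A real multiplier passes through the conjugation onto the second factor, which becomes the
    Fourier series of a finite convolution of [v]. *)
Lemma parseval_multiplier (lam : 'rV[R]_d -> R) N (a : 'rV[int]_d -> R) u v f g :
  (forall k, a (- k) = a k) ->
  (forall xi, cube xi -> lam xi = \sum_(k <- box d N) cos (dot (map_mx intr k) xi) * a k) ->
  square_summable u -> square_summable v ->
  is_fourier_series u f -> is_fourier_series v g ->
  [/\ zsummable (fun k => u k * \sum_(m <- box d N) a m * v (k + m)),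
    cintegrable cube (fun xi => f xi * (g xi)^* * (lam xi)%:C%C) &
    cintegral cube (fun xi => f xi * (g xi)^* * (lam xi)%:C%C) =
    ((2 * pi) ^+ d * zsum (fun k => u k * \sum_(m <- box d N) a m * v (k + m)))%:C%C].
Proof.
move=> aN lamE us vs uf vg.
have ws : zsummable (fun k => u k * \sum_(m <- box d N) a m * v (k + m)).
  have := zsummable_sum (box d N) a (fun m => zsummable_prod_shift m us vs).
  congr zsummable; apply/funext => k; rewrite mulr_sumr; apply: eq_bigr => m _; ring.
have := parseval uf (fourier_series_multiplier aN lamE vg) ws.
have -> : (fun xi => f xi * ((lam xi)%:C%C * g xi)^*) =
    (fun xi => f xi * (g xi)^* * (lam xi)%:C%C).
  apply/funext => xi; case: (f xi) => a1 a2; case: (g xi) => b1 b2.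
  by apply/eqP; rewrite eq_complex /=; apply/andP; split; apply/eqP; ring.
by case.
Qed.

End fourier_multiplier.

(** * The two bilinear forms *)

Section bilinear_forms.
Variables (R : realType) (d : nat) (h : 'rV[R]_d).
Hypothesis h0 : forall j, 0 < h ord0 j.
Variables (kappa : 'rV[R]_d -> R) (delta : R).
Notation leb := (leb R d).
Hypotheses (delta0 : 0 < delta) (kappa0 : forall s, 0 <= kappa s)
  (mkappa : measurable_fun setT kappa)
  (ikappa : leb.-integrable setT (EFin \o (fun s => kappa s * dot s s)))
  (skappa : forall s, kappa s != 0 -> enorm s < delta).
Notation L := (Lop kappa).
Notation Psi := (rk_basis h).
Implicit Types (x : 'rV[R]_d) (k m : 'rV[int]_d) (u v p : 'rV[int]_d -> R).

Lemma rk_basis_ge0 k x : 0 <= Psi k x.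
Proof. by rewrite rk_basisE//; apply: prodr_ge0 => j _; exact: bspline_ge0. Qed.

(** Here the box is centred at an index [k] near [x], so one [N] can serve all [x]; this makes the
    two bilinear forms convolutions over a fixed finite set. *)
Lemma Lop_interp_near v k x N :
  (forall j, `|x ord0 j / h ord0 j - (k ord0 j)%:~R| + 2 + delta / h ord0 j <= N%:R) ->
  L (interp h v) x = \sum_(m <- box d N) v (k + m) * L (Psi (k + m)) x.
Proof.
move=> hN.
have [N0 hN0] := box_exists (fun j => (`|x ord0 j| + delta) / h ord0 j + 2).
have [N1 hN1] := fset_sub_box (shift_fset k (box d N)).
have N0M : (N0 <= maxn N0 N1)%N by rewrite leq_maxl.
rewrite (Lop_interp_box h0 delta0 kappa0 mkappa ikappa skappa v (hN0 _ N0M)).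
(* The expansion over a large box around [0] is cut down to the translated box; the other indices
   lie too far from [x] to contribute. *)
have sub : (shift_fset k (box d N) `<=` box d (maxn N0 N1))%fset.
  exact: (fsubset_trans hN1 (subset_box d (leq_maxr N0 N1))).
rewrite (sum_fset_sub _ sub) sum_shift_fset [X in _ + X]big1_seq ?addr0.
  by apply: eq_bigr => m _; rewrite addrC.
move=> l /andP[_]; rewrite inE => /andP[lk _].
have [->|Ll] := eqVneq (L (Psi l) x) 0; first by rewrite mulr0.
have : l - k \notin box d N.
  apply: contra lk => lk; apply/imfsetP; exists (l - k) => //=.
  by rewrite addrNK.
move=> /(@box_out R)[j].
have := Lop_rk_basis_supp h0 delta0 skappa j Ll; have := hN j.
rewrite !mxE intr_norm intrD rmorphN /=.
set a := x ord0 j / h ord0 j; set b := (k ord0 j)%:~R; set c := (l ord0 j)%:~R.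
move=> h1 h2 h3.
have : `|c - b| <= `|a - c| + `|a - b|.
  by rewrite (distrC a c); exact: ler_distD.
move: h3; rewrite -/c -/b; lra.
Qed.

Lemma collocation_form v k N : (forall j, delta / h ord0 j + 4 <= N%:R) ->
  - restr h (L (interp h v)) k = \sum_(m <- box d N) collocation_coef h kappa m * v (k + m).
Proof.
move=> hN; rewrite /restr (@Lop_interp_near v k _ N).
  rewrite -sumrN; apply: eq_bigr => m _.
  by rewrite -(collocation_restr h0 kappa k m) /restr; ring.
move=> j; rewrite mxE mulfK ?gt_eqF// subrr normr0.
by have := hN j; lra.
Qed.

Lemma cvg_interp v x : (fun N => \sum_(k <- box d N) v k * Psi k x) @ \oo --> interp h v x.
Proof.
apply: cvg_near_cst.
have [N0 hN] := box_exists (fun j => `|x ord0 j| / h ord0 j + 2).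
by exists N0 => // N /= NN; rewrite -interp_box//; exact: hN.
Qed.

(** By translation all basis functions have the same integral [I0], so the integrals of the partial
    sums stay below [M * I0], and monotone convergence applies. *)
Lemma interp_integrable p : (forall k, 0 <= p k) -> zsummable p ->
  leb.-integrable setT (EFin \o interp h p) /\
  forall N x, \sum_(k <- box d N) p k * Psi k x <= interp h p x.
Proof.
move=> p0 ps.
have homo x : {homo (fun N => \sum_(k <- box d N) p k * Psi k x) : N M / (N <= M)%N >-> N <= M}.
  move=> N M NM; apply: ler_sum_fset; first exact: subset_box.
  by move=> k; rewrite mulr_ge0// rk_basis_ge0.
have le N x : \sum_(k <- box d N) p k * Psi k x <= interp h p x.
  rewrite -(cvg_lim _ (@cvg_interp p x))//; apply: nondecreasing_cvgn_le => //.
  by apply/cvg_ex; exists (interp h p x); exact: cvg_interp.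
split => //.
have ige0 x : 0 <= interp h p x.
  apply: le_trans (le 0%N x); apply: sumr_ge0 => k _.
  by rewrite mulr_ge0// rk_basis_ge0.
apply/integrableP; split; first by apply/measurable_EFinP; exact: measurable_interp.
have [M pM] := bound_summable ps.
pose I0 := \int[leb]_x Psi 0 x.
have I00 : 0 <= I0 by apply: Rintegral_ge0 => x _; exact: rk_basis_ge0.
have IE k : \int[leb]_x Psi k x = I0.
  have := Rintegral_affine (gridpoint h k) (oner_neq0 R) (rk_basis_integrable h0 k).
  rewrite normr1 expr1n mul1r => ->; apply: eq_Rintegral => x _.
  by rewrite scale1r -[k in Psi k]addr0 rk_basis_shift// addrK.
have ik N : leb.-integrable setT (EFin \o (fun x => \sum_(k <- box d N) p k * Psi k x)).
  have ip k : leb.-integrable setT (EFin \o (fun x => p k * Psi k x)).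
    by have := integrableZl measurableT (p k) (rk_basis_integrable h0 k).
  by have [] := Rintegral_sum (box d N) measurableT ip.
have IN N : (\int[leb]_x (\sum_(k <- box d N) p k * Psi k x)%:E <= (M * I0)%:E)%E.
  rewrite -(fineK (integrable_fin_num measurableT (ik N))) lee_fin.
  rewrite -[fine _]/(\int[leb]_x (\sum_(k <- box d N) p k * Psi k x)).
  have ip k : leb.-integrable setT (EFin \o (fun x => p k * Psi k x)).
    by have := integrableZl measurableT (p k) (rk_basis_integrable h0 k).
  have [-> _] := Rintegral_sum (box d N) measurableT ip.
  rewrite (eq_bigr (fun k => p k * I0)) => [|k _]; last first.
    by rewrite RintegralZl ?IE//; exact: rk_basis_integrable.
  rewrite -mulr_suml ler_wpM2r// (le_trans _ (pM (box d N)))//.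
  by apply: ler_sum => k _; exact: ler_norm.
have mS N : measurable_fun setT (fun x => (\sum_(k <- box d N) p k * Psi k x)%:E).
  by have /integrableP[] := ik N.
have S0 N x : setT x -> (0 <= (\sum_(k <- box d N) p k * Psi k x)%:E)%E.
  by move=> _; rewrite lee_fin sumr_ge0// => k _; rewrite mulr_ge0// rk_basis_ge0.
have Sh x : setT x -> {homo (fun N => (\sum_(k <- box d N) p k * Psi k x)%:E) : N M / (N <= M)%N >-> (N <= M)%E}.
  by move=> _ N N' NN; rewrite lee_fin homo.
have cv := @cvg_monotone_convergence _ _ R leb setT measurableT
  (fun N x => (\sum_(k <- box d N) p k * Psi k x)%:E) mS S0 Sh.
apply: (@le_lt_trans _ _ (M * I0)%:E); last exact: ltry.
have E : (\int[leb]_x `|(EFin \o interp h p) x|)%E =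
   (\int[leb]_x limn (fun N => (\sum_(k <- box d N) p k * Psi k x)%:E))%E.
  apply: eq_integral => x _; rewrite /= ger0_norm//.
  apply/esym/cvg_lim => //; apply/fine_cvgP; split; first exact: nearW.
  exact: cvg_interp.
have {}cv : (fun N => (\int[leb]_x (\sum_(k <- box d N) p k * Psi k x)%:E)%E) @ \oo -->
    (\int[leb]_x `|(EFin \o interp h p) x|)%E.
  by rewrite E.
rewrite -(cvg_lim _ cv)//; apply: lime_le; last by apply: nearW.
by apply/cvg_ex; eexists; exact: cv.
Qed.

(* The truncated sums are dominated by a multiple of the interpolant of the summable
   sequence [p]. *)
Lemma galerkin_form u v N : square_summable u -> square_summable v ->
  zsummable (fun k => u k * \sum_(m <- box d N) galerkin_coef h kappa m * v (k + m)) ->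
  (forall j, delta / h ord0 j + 4 <= N%:R) ->
  leb.-integrable setT (EFin \o (fun x => interp h u x * - L (interp h v) x)) /\
  inner_L2 (interp h u) (fun x => - L (interp h v) x) =
  zsum (fun k => u k * \sum_(m <- box d N) galerkin_coef h kappa m * v (k + m)).
Proof.
move=> us vs ws hN.
have [C hC] := Lop_bounded kappa0 mkappa ikappa (smooth2_rk_basis h0 0).
have C0 : 0 <= C by exact: le_trans (hC 0).
have LC k x : `|L (Psi k) x| <= C.
  by rewrite -[k]addr0 Lop_rk_basis_shift.
pose p k := `|u k| * \sum_(m <- box d N) `|v (k + m)|.
have p0 k : 0 <= p k by rewrite mulr_ge0// sumr_ge0.
have ps : zsummable p.
  have us' : square_summable (fun k => `|u k|).
    by move: us; rewrite /square_summable; congr zsummable; apply/funext => k; rewrite real_normK ?num_real.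
  have vs' : square_summable (fun k => `|v k|).
    by move: vs; rewrite /square_summable; congr zsummable; apply/funext => k; rewrite real_normK ?num_real.
  have := zsummable_sum (box d N) (fun=> 1) (fun m => zsummable_prod_shift m us' vs').
  congr zsummable; apply/funext => k; rewrite /p mulr_sumr.
  by apply: eq_bigr => m _; rewrite mul1r.
have [ip ple] := interp_integrable p0 ps.
pose F n x := \sum_(k <- box d n) \sum_(m <- box d N)
   u k * v (k + m) * (Psi k x * - L (Psi (k + m)) x).
have ig k m : leb.-integrable setT (EFin \o (fun x =>
   u k * v (k + m) * (Psi k x * - L (Psi (k + m)) x))).
  by have := integrableZl measurableT (u k * v (k + m))
    (galerkin_integrable h0 kappa0 mkappa ikappa k (k + m)).
have ig2 k := Rintegral_sum (box d N) measurableT (ig k).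
have ig3 n := Rintegral_sum (box d n) measurableT (fun k => (ig2 k).2).
have mF n : measurable_fun setT (F n).
  by have /integrableP[/measurable_EFinP] := (ig3 n).2.
(* Where [Psi k x] is nonzero, [x] is within 2 grid steps of [k] and the expansion centred at [k]
   holds; elsewhere both terms vanish. *)
have FE n x : F n x = \sum_(k <- box d n) u k * Psi k x * - L (interp h v) x.
  apply: eq_bigr => k _; have [Pk|Pk] := eqVneq (Psi k x) 0.
    by rewrite Pk mulr0 mul0r big1// => m _; rewrite mul0r mulr0.
  rewrite (@Lop_interp_near v k x N).
    by rewrite -sumrN mulr_sumr; apply: eq_bigr => m _; ring.
  by move=> j; have := rk_basis_supp h0 j Pk; have := hN j; lra.
have cF x : F ^~ x @ \oo --> interp h u x * - L (interp h v) x.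
  have lim : (fun n => (\sum_(k <- box d n) u k * Psi k x) * - L (interp h v) x) @ \oo -->
      interp h u x * - L (interp h v) x.
    by apply: cvgM; [exact: cvg_interp|exact: cvg_cst].
  by apply: (cvgn_eq lim) => [n|//]; rewrite FE mulr_suml.
have iC : leb.-integrable setT (EFin \o (fun x => C * interp h p x)).
  by have := integrableZl measurableT C ip.
have dF n x : `|F n x| <= C * interp h p x.
  apply: (@le_trans _ _ (\sum_(k <- box d n) C * (p k * Psi k x))); last first.
    by rewrite -mulr_sumr ler_wpM2l.
  apply: le_trans (ler_norm_sum _ _ _) _; apply: ler_sum => k _.
  apply: le_trans (ler_norm_sum _ _ _) _.
  rewrite (_ : C * (p k * Psi k x) = \sum_(m <- box d N) `|u k| * `|v (k + m)| * (Psi k x * C)); last first.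
    by rewrite -mulr_suml -mulr_sumr -/(p k); ring.
  apply: ler_sum => m _; rewrite !normrM normrN (ger0_norm (rk_basis_ge0 k x)).
  by rewrite ler_wpM2l ?mulr_ge0// ler_wpM2l ?rk_basis_ge0.
have [iL lim] := dominated_convergence_real mF cF iC dF.
split => //; rewrite /inner_L2.
have lim2 : (fun n => \int[leb]_x F n x) @ \oo --> zsum
   (fun k => u k * \sum_(m <- box d N) galerkin_coef h kappa m * v (k + m)).
  apply: (cvgn_eq (cvg_box_zsum ws)) => [n|//].
  rewrite (ig3 n).1; apply: eq_bigr => k _; rewrite (ig2 k).1 mulr_sumr.
  apply: eq_bigr => m _; rewrite RintegralZl//; last exact: galerkin_integrable.
  by rewrite galerkin_shift//; ring.
by rewrite -(cvg_lim _ lim)// (cvg_lim _ lim2).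
Qed.

End bilinear_forms.

Theorem lemma4p2 (R : realType) (d : nat) (rho : R -> R)
    (hd : (0 < d)%N) (hrho : kernel_profile d rho) :
  (forall (hhat : 'rV[R]_d) (hmax delta : R) (u v : 'rV[int]_d -> R)
      (ut vt : 'rV[R]_d -> R[i]),
    admissible_shape hhat -> 0 < hmax -> 0 < delta ->
    square_summable u -> square_summable v ->
    is_fourier_series u ut -> is_fourier_series v vt ->
    let h := hmax *: hhat in
    let Lv := nonlocal rho delta (interp h v) in
    let FG := fun xi => ut xi * (vt xi)^* * (lambda_G rho delta h xi)%:C%C in
    let FC := fun xi => ut xi * (vt xi)^* * (lambda_C rho delta h xi)%:C%C in
    [/\ (leb R d).-integrable setT (EFin \o fun x => interp h u x * - Lv x),
        cintegrable (@cube R d) FG &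
        (inner_L2 (interp h u) (fun x => - Lv x))%:C%C =
          ((2 * pi) ^- d)%:C%C * cintegral (@cube R d) FG] /\
    [/\ zsummable (fun k => u k * - restr h Lv k),
        cintegrable (@cube R d) FC &
        (inner_l2 h u (fun k => - restr h Lv k))%:C%C =
          ((2 * pi) ^- d)%:C%C * cintegral (@cube R d) FC]) /\
  (exists2 C : R, 0 < C &
    forall (hhat : 'rV[R]_d) (hmax delta : R) (xi : 'rV[R]_d),
      admissible_shape hhat -> 0 < hmax -> 0 < delta -> (@cube R d) xi ->
      let h := hmax *: hhat in
      [/\ zsummable (lambda_term 8 rho delta h xi),
          zsummable (lambda_term 4 rho delta h xi) &
          C * lambda_G rho delta h xi <= lambda_C rho delta h xi]).

Proof.
split; last first.
  exists 1 => // hhat hmax delta xi [hh0 _] hm0 d0 xic h.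
  have h0 j : 0 < h ord0 j by rewrite mxE mulr_gt0.
  split; [by have [] := lambda_G_summable h0 hrho d0 xic|
    by have [] := lambda_C_summable h0 hrho d0 xic|].
  by rewrite mul1r; exact: lambda_G_le_C.
move=> hhat hmax delta u v ut vt [hh0 _] hm0 d0 us vs uut vvt h Lv FG FC.
have h0 j : 0 < h ord0 j by rewrite mxE mulr_gt0.
have [N0 hN0] := box_exists (fun j => delta / h ord0 j + 4).
have hN := hN0 _ (leqnn N0).
pose kap := @kern R d rho delta.
have LvE : Lv = Lop kap (interp h v).
  by apply/funext => x; exact: nonlocal_Lop.
have k0 s : 0 <= kap s by exact: kern_ge0.
have mk := measurable_kern hrho d0.
have ik := kern_integrable hrho d0.
have sk := @kern_supp R d rho delta.
pose P := (2 * pi : R) ^+ d.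
have P0 : P != 0 by rewrite expf_neq0// mulf_neq0// gt_eqF// pi_gt0.
have cancel (z : R) : z%:C%C = (P^-1)%:C%C * (P * z)%:C%C.
  by rewrite -rmorphM /= mulKf.
split.
  have [ws iF IF] := parseval_multiplier (galerkin_coefN h0 k0 mk ik)
    (fun xi xic => lambda_G_expansion h0 hrho d0 xic hN) us vs uut vvt.
  have [iL IL] := galerkin_form h0 d0 k0 mk ik sk us vs ws hN.
  rewrite LvE; split => //.
  by rewrite IL IF -cancel.
pose H := \prod_(j < d) h ord0 j.
(* The factor [H] of [lambda_C] is put into the coefficients; pulled out of the final sum, it
   becomes the weight of [inner_l2]. *)
pose a m := H * collocation_coef h kap m.
have aN m : a (- m) = a m by rewrite /a collocation_coefN.
have [ws iF IF] := parseval_multiplier aN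
    (fun xi xic => lambda_C_expansion h0 hrho d0 xic hN) us vs uut vvt.
have H0 : H != 0 by rewrite gt_eqF// prodr_gt0// => j _.
have wE k : u k * \sum_(m <- box d N0) a m * v (k + m) = H * (u k * - restr h Lv k).
  rewrite LvE (collocation_form h0 d0 k0 mk ik sk v k hN).
  by rewrite !mulr_sumr; apply: eq_bigr => m _; rewrite /a; ring.
have cs : zsummable (fun k => u k * - restr h Lv k).
  have [+ _] := zsumZ H^-1 ws; congr zsummable.
  by apply/funext => k; rewrite wE mulKf.
split => //.
by rewrite IF -cancel (funext wE) (zsumZ H cs).2.
Qed.
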